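(* Let $n\ge 2$, let $V\in GL(n,\mathbb{R})$, and let $T^n_V=\mathbb{R}^n/V\mathbb{Z}^n$ be equipped with the flat metric $g_0$ induced by the Euclidean metric of $\mathbb{R}^n$. Let $f:(T^n_V,g_0)\to\mathbb{R}^N$ be an immersion such that there exists a Möbius transformation $\varphi$ of $\mathbb{R}^N$ satisfying $(\varphi\circ f)^*g_{\mathbb{R}^N}=g_0$. Then $$\mathcal{W}(f)\ge (4n\pi^2)^{n/2},$$ with equality if and only if $f$ is Möbius congruent to the Clifford torus $$\mathcal{T}^n=\mathbb{S}^1\left(\sqrt{1/n}\right)\times\cdots\times\mathbb{S}^1\left(\sqrt{1/n}\right)\subset\mathbb{S}^{2n-1}\subset\mathbb{R}^{2n}\subset\mathbb{R}^N.$$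
   Context: Immersions are smooth. For an immersion $f:M^n\to\mathbb{R}^N$ of a closed $n$-manifold ($n\ge2$), the Willmore functional is $$\mathcal{W}(f)=\left(\frac{n}{n-1}\right)^{n/2}\int_{M^n}\left(S-n|H|^2\right)^{n/2}\,\mathrm{d}V,$$ where $\mathrm{d}V$ is the volume element of the induced metric, $S$ is the squared norm of the second fundamental form of $f$ in $\mathbb{R}^N$, and $H$ is the mean curvature vector, normalized as $H=\frac1n\operatorname{tr}(\text{second fundamental form})$. $g_{\mathbb{R}^N}$ is the Euclidean metric. A Möbius transformation of $\mathbb{R}^N$ is a conformal transformation of $\mathbb{R}^N\cup\{\infty\}$ (a composition of similarities and inversions); when composed with an immersion into $\mathbb{R}^N$ it is understood that no point of the image is sent to $\infty$. The Clifford $n$-torus is the image of the embedding $c:T^n_{I_n}=\mathbb{R}^n/\mathbb{Z}^n\to\mathbb{S}^{2n-1}$, $c(x)=\frac{1}{\sqrt n}(\cos 2\pi x_1,\sin 2\pi x_1,\ldots,\cos 2\pi x_n,\sin 2\pi x_n)$. ''$f$ is Möbius congruent to the Clifford torus'' means that (in particular $N\ge 2n$ and) there are a Möbius transformation $\psi$ of $\mathbb{R}^N$ and a diffeomorphism $h:T^n_V\to T^n_{I_n}$ with $\psi\circ f=c\circ h$, where $\mathbb{R}^{2n}\subset\mathbb{R}^N$ is a standard linear inclusion. *)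

(* Defs.v *)
From HB Require Import structures.
From mathcomp Require Import all_boot all_order all_algebra.
From mathcomp Require Import all_classical all_reals all_analysis.

Set Implicit Arguments.
Unset Strict Implicit.
Unset Printing Implicit Defensive.

Import Order.TTheory GRing.Theory Num.Theory.
Import numFieldNormedType.Exports.
Import Quotient.

Local Open Scope classical_set_scope.
Local Open Scope ring_scope.

(* Vectors of R^n are rows and matrices act on the right: the vector V x is    *)
(* x *m V^T, and the Jacobian 'J F x has the partial derivatives of F as rows. *)

Section EuclideanSpace.
Variable R : realType.

Definition dotp N (u v : 'rV[R]_N) : R := (u *m v^T) 0 0.

Definition sqnorm N (u : 'rV[R]_N) : R := dotp u u.

Definition partial n N (i : 'I_n) (F : 'rV[R]_n -> 'rV[R]_N) :
    'rV[R]_n -> 'rV[R]_N :=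
  fun x => 'D_(delta_mx 0 i) F x.

Definition partials n N (s : seq 'I_n) (F : 'rV[R]_n -> 'rV[R]_N) :
    'rV[R]_n -> 'rV[R]_N :=
  foldr (@partial n N) F s.

(* C^infinity on U, for U open. *)
Definition smooth_on n N (U : set 'rV[R]_n) (F : 'rV[R]_n -> 'rV[R]_N) : Prop :=
  forall (s : seq 'I_n) (x : 'rV[R]_n), U x -> differentiable (partials s F) x.

(* The library has no Lebesgue measure on R^n: this is the integral over       *)
(* [0,1]^n as an iterated Lebesgue integral. By Fubini it is the n-dimensional *)
(* one for continuous integrands, such as the integrand of [willmore].         *)
Fixpoint cube_integral (n : nat) : ('rV[R]_n -> R) -> R :=
  match n with
  | 0 => fun phi => phi 0
  | m.+1 => fun phi =>
      \int[lebesgue_measure]_(t in `[0, 1]%classic)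
        cube_integral (fun u : 'rV[R]_m => phi (row_mx (t%:M : 'rV[R]_1) u))
  end.

End EuclideanSpace.

Section FlatTorus.
Variables (R : realType) (n : nat).

Definition lattice (V : 'M[R]_n) : {pred 'rV[R]_n} :=
  [pred x | `[< exists k : 'rV[int]_n, x = map_mx intr k *m V^T >]].

Lemma lattice_zmod_closed (V : 'M[R]_n) : zmod_closed (lattice V).
Proof.
split=> [|x y].
  by apply/asboolP; exists 0; rewrite raddf0 mul0mx.
move=> /asboolP[k ->] /asboolP[l ->]; apply/asboolP.
by exists (k - l); rewrite raddfB mulmxBl.
Qed.

HB.instance Definition _ (V : 'M[R]_n) :=
  GRing.isZmodClosed.Build _ (lattice V) (lattice_zmod_closed V).

Definition torus (V : 'M[R]_n) : Type := {quot (lattice V)}.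

Definition torus_proj (V : 'M[R]_n) : 'rV[R]_n -> torus V :=
  \pi_({quot (lattice V)})%qT.

(* The projection R^n -> T_V is a local diffeomorphism, and an isometry for    *)
(* g_0; tensors on T_V are written in the coordinates of R^n, through lifts.   *)
Definition torus_lift (V : 'M[R]_n) T (f : torus V -> T) : 'rV[R]_n -> T :=
  f \o torus_proj V.

Definition flat_metric : 'rV[R]_n -> 'M[R]_n := fun=> 1%:M.

(* Integral, with respect to the measure dx of g_0, of the function on T_V     *)
(* whose lift is phi; V [0,1]^n is a fundamental domain.                       *)
Definition torus_integral (V : 'M[R]_n) (phi : 'rV[R]_n -> R) : R :=
  `|\det V| * cube_integral (fun u => phi (u *m V^T)).

End FlatTorus.

(* Smoothness of a map of tori, expressed in the charts given by local         *)
(* inverses of the projections.                                                *)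
Definition torus_smooth (R : realType) n (V W : 'M[R]_n)
    (h : torus V -> torus W) : Prop :=
  forall x : 'rV[R]_n, exists (U : set 'rV[R]_n) (g : 'rV[R]_n -> 'rV[R]_n),
    [/\ open U, U x, smooth_on U g &
        forall y, U y -> h (torus_proj V y) = torus_proj W (g y)].

Definition torus_diffeo (R : realType) n (V W : 'M[R]_n)
    (h : torus V -> torus W) : Prop :=
  exists h' : torus W -> torus V,
    [/\ cancel h h', cancel h' h, torus_smooth h & torus_smooth h'].

Section Immersion.
Variables (R : realType) (n N : nat) (V : 'M[R]_n).
Implicit Type f : torus V -> 'rV[R]_N.

Definition immersion f : Prop :=
  smooth_on setT (torus_lift f) /\
  forall x, injective ('d (torus_lift f) x).

(* Gram matrix of f^* g_{R^N}. *)
Definition induced_metric f (x : 'rV[R]_n) : 'M[R]_n :=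
  'J (torus_lift f) x *m ('J (torus_lift f) x)^T.

Definition inverse_metric f (x : 'rV[R]_n) : 'M[R]_n :=
  invmx (induced_metric f x).

Definition normal_part f (x : 'rV[R]_n) (w : 'rV[R]_N) : 'rV[R]_N :=
  w - w *m ('J (torus_lift f) x)^T *m inverse_metric f x *m 'J (torus_lift f) x.

Definition second_ff f (x : 'rV[R]_n) (i j : 'I_n) : 'rV[R]_N :=
  normal_part f x (partial i (partial j (torus_lift f)) x).

Definition sqnorm_second_ff f (x : 'rV[R]_n) : R :=
  \sum_i \sum_j \sum_k \sum_l
    inverse_metric f x i k * inverse_metric f x j l *
    dotp (second_ff f x i j) (second_ff f x k l).

Definition mean_curvature f (x : 'rV[R]_n) : 'rV[R]_N :=
  n%:R^-1 *: \sum_i \sum_j inverse_metric f x i j *: second_ff f x i j.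

Definition volume_density f (x : 'rV[R]_n) : R :=
  Num.sqrt (\det (induced_metric f x)).

Definition willmore f : R :=
  (n%:R / (n%:R - 1)) `^ (n%:R / 2) *
  torus_integral V (fun x =>
    (sqnorm_second_ff f x - n%:R * sqnorm (mean_curvature f x)) `^ (n%:R / 2)
    * volume_density f x).

End Immersion.

Section Moebius.
Variables (R : realType) (N : nat).
Local Notation X := (one_point_compactification 'rV[R]_N).

Definition similarity (a : R) (A : 'M[R]_N) (b : 'rV[R]_N) : X -> X :=
  fun p => if p is Some x then Some (a *: (x *m A) + b) else None.

Definition inversion (c : 'rV[R]_N) (r : R) : X -> X :=
  fun p => if p is Some x then
             if x == c then None
             else Some (c + (r ^+ 2 / sqnorm (x - c)) *: (x - c))
           else Some c.

Inductive moebius : (X -> X) -> Prop :=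
| moebius_similarity a A b :
    0 < a -> A *m A^T = 1%:M -> moebius (similarity a A b)
| moebius_inversion c r : 0 < r -> moebius (inversion c r)
| moebius_comp phi psi : moebius phi -> moebius psi -> moebius (phi \o psi).

(* F = phi o f; in particular phi sends no point of the image of f to oo. *)
Definition moebius_image (phi : X -> X) T (f F : T -> 'rV[R]_N) : Prop :=
  forall t, phi (Some (f t)) = Some (F t).

End Moebius.

Section Clifford.
Variables (R : realType) (n : nat).

(* mxvec lists the entries row by row: (cos_1, sin_1, ..., cos_n, sin_n). *)
Definition clifford (t : torus (1%:M : 'M[R]_n)) : 'rV[R]_(n * 2) :=
  let x : 'rV[R]_n := repr (t : {quot (lattice 1%:M)}) in
  (Num.sqrt n%:R)^-1 *:
    mxvec (\matrix_(i < n, k < 2)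
      (if k == 0 then cos (2 * pi * x 0 i) else sin (2 * pi * x 0 i))).

(* The standard inclusion R^m -> R^N, for m <= N. *)
Definition std_incl m N (u : 'rV[R]_m) : 'rV[R]_N := u *m pid_mx m.

Definition moebius_congruent_clifford N (V : 'M[R]_n)
    (f : torus V -> 'rV[R]_N) : Prop :=
  (n * 2 <= N)%N /\
  exists psi (h : torus V -> torus (1%:M : 'M[R]_n)),
    [/\ moebius psi, torus_diffeo h &
        moebius_image psi f (fun t => std_incl N (clifford (h t)))].

End Clifford.

(* Main.v *)
(** Write F = phi o f for the flat immersion.  The Willmore integrand is
    conformally invariant, and for a flat metric Gauss' equation turns it into
    |Lap F|^n, so that W(f) is the integral of |Lap F|^n, which by Jensen is
    bounded below in terms of the mean of |Lap F|^2.

    Lower bound.  Let xi_1, ..., xi_n be successive minima of the dual lattice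
    and q_1, ..., q_n their Gram-Schmidt basis.  A dual vector xi with
    <xi, q_i> <> 0 satisfies |xi| >= |xi_i|, hence
    |xi|^4 >= sum_i |xi_i|^2 <xi, q_i>^2, and by Fourier analysis the mean of
    |Lap F|^2 is at least 4 pi^2 sum_i |xi_i|^2 times the mean of |D_(q_i) F|^2,
    which is 1 by flatness.  Hadamard and AM-GM bound sum_i |xi_i|^2 by the
    covolume.

    Equality forces the xi_i to be an orthogonal basis of the dual lattice with
    equal lengths, and F to have only the frequencies 0 and +- xi_i; flatness
    then makes the coefficients of F an orthogonal frame of R^N.

    Conversely, let f be Moebius congruent to the Clifford torus through h.
    The angular forms of c o h form a closed coframe whose Gram matrix is mu
    times the identity.  The scalar curvature identity, integrated against a
    power of mu, shows that mu is constant, so h is affine; a determinant count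
    of lattice points gives W(f) <= (4 n pi^2)^(n/2). *)

From HB Require Import structures.
From mathcomp Require Import all_boot all_order all_algebra.
From mathcomp Require Import all_classical all_reals all_analysis.
From mathcomp Require Import ring lra zify.
Require Import Defs.

Set Implicit Arguments.
Unset Strict Implicit.
Unset Printing Implicit Defensive.

Import Order.TTheory GRing.Theory Num.Theory.
Import numFieldNormedType.Exports.
Import Quotient.

Local Open Scope classical_set_scope.
Local Open Scope ring_scope.

(** * Integration over the cube *)

(** The shortest dual vector alone cannot give the bound: on a long thin torus of fixed volume it is
    arbitrarily short. Flatness supplies one unit of energy in every direction, so the gap can be
    spent direction by direction, each q_i being charged with its own |xi_i|^2. This is why |Lap
    F|^2 is compared with a weighted quadratic form and not with a first eigenvalue.

    Fourier analysis rests on a positive kernel. Its coefficients are a finite list of nonnegative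
    weights depending only on a Lipschitz constant and the accuracy, so the same weights serve Lap F
    and all D_(q_i) F, and an inequality between symbols passes term by term to the energies, up to
    an error tending to 0.

    Integrals are iterated one variable at a time. Bounded Lipschitz functions are a class in which
    this stays linear and monotone, and which is stable under powers with exponent n/2 >= 1.

    In the converse h is an arbitrary diffeomorphism; all that is known about its derivative is that
    c o h is conformal, being reached from a flat map by Moebius transformations. The constancy of
    mu recovers the affine structure. *)

Section UnitIntegral.
Variable R : realType.
Implicit Types f g : R -> R.

Definition unit_integral f : R := \int[lebesgue_measure]_(t in `[0, 1]%classic) f t.

Lemma unit_integrable f : continuous f ->
  lebesgue_measure.-integrable `[(0 : R), 1]%classic (EFin \o f).
Proof.
move=> cf; apply: continuous_compact_integrable; first exact: segment_compact.
exact: continuous_subspaceT.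
Qed.

Lemma unit_integralD f g : continuous f -> continuous g ->
  unit_integral (fun t => f t + g t) = unit_integral f + unit_integral g.
Proof. by move=> cf cg; apply: RintegralD => //; exact: unit_integrable. Qed.

Lemma unit_integralZ (a : R) f : continuous f ->
  unit_integral (fun t => a * f t) = a * unit_integral f.
Proof. by move=> cf; apply: RintegralZl => //; exact: unit_integrable. Qed.

Lemma le_unit_integral f g : continuous f -> continuous g ->
  (forall t, f t <= g t) -> unit_integral f <= unit_integral g.
Proof.
by move=> cf cg fg; apply: le_Rintegral => //; exact: unit_integrable.
Qed.

Lemma unit_integral_cst (a : R) : unit_integral (fun=> a) = a.
Proof.
by rewrite /unit_integral Rintegral_cst//= lebesgue_measure_itv/= lte_fin ltr01 sube0 mulr1.
Qed.

Lemma unit_integral_derive f f' : continuous f' ->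
  (forall t : R, is_derive t 1 f (f' t)) -> unit_integral f' = f 1 - f 0.
Proof.
move=> cf' df; rewrite /unit_integral /Rintegral.
rewrite (@continuous_FTC2 _ f' f)//.
- exact: continuous_subspaceT.
- have cf : continuous f.
    by move=> t; apply/differentiable_continuous/derivable1_diffP; case: (df t).
  split=> [t _| |]; first by case: (df t).
  + exact/cvg_at_right_filter/cf.
  + exact/cvg_at_left_filter/cf.
- by move=> t _; rewrite derive1E; exact: derive_val.
Qed.

End UnitIntegral.

Section BoundedLipschitz.
Variable R : realType.

(** One constant serves for the bound and for the Lipschitz condition: fixing a variable or
    integrating it out preserves both with the same constant, so every inner integral is again a
    continuous integrand. *)
Definition bounded_lip (V : normedModType R) (C : R) (phi : V -> R) : Prop :=
  (forall x, `|phi x| <= C) /\ (forall x y, `|phi x - phi y| <= C * `|x - y|).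

Variable V : normedModType R.
Implicit Types (phi psi : V -> R) (C D : R).

Lemma bounded_lip_ge0 C phi : bounded_lip C phi -> 0 <= C.
Proof. by move=> [b _]; exact: le_trans (b 0). Qed.

Lemma bounded_lipW C D phi : C <= D -> bounded_lip C phi -> bounded_lip D phi.
Proof.
move=> CD [b l]; split=> [x|x y]; first exact: le_trans CD.
by apply: le_trans (l x y) _; rewrite ler_wpM2r.
Qed.

Lemma bounded_lipD C D phi psi : bounded_lip C phi -> bounded_lip D psi ->
  bounded_lip (C + D) (fun x => phi x + psi x).
Proof.
move=> [b l] [b' l']; split=> [x|x y].
  by apply: le_trans (ler_normD _ _) _; exact: lerD.
rewrite opprD addrACA mulrDl.
by apply: le_trans (ler_normD _ _) _; exact: lerD.
Qed.

Lemma bounded_lipZ C a phi : bounded_lip C phi ->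
  bounded_lip (`|a| * C) (fun x => a * phi x).
Proof.
move=> [b l]; split=> [x|x y]; first by rewrite normrM ler_wpM2l.
by rewrite -mulrBr normrM -mulrA ler_wpM2l.
Qed.

Lemma bounded_lipM C D phi psi : bounded_lip C phi -> bounded_lip D psi ->
  bounded_lip (2 * (C * D)) (fun x => phi x * psi x).
Proof.
move=> bl bl'; have C0 := bounded_lip_ge0 bl; have D0 := bounded_lip_ge0 bl'.
case: bl bl' => [b l] [b' l']; split=> [x|x y].
  rewrite normrM; have : `|phi x| * `|psi x| <= C * D by exact: ler_pM.
  have : 0 <= C * D by exact: mulr_ge0.
  by lra.
rewrite (_ : _ - _ = phi x * (psi x - psi y) + (phi x - phi y) * psi y); last by ring.
apply: le_trans (ler_normD _ _) _; rewrite !normrM.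
have h1 : `|phi x| * `|psi x - psi y| <= C * (D * `|x - y|) by exact: ler_pM.
have h2 : `|phi x - phi y| * `|psi y| <= C * `|x - y| * D by exact: ler_pM.
by nra.
Qed.

Lemma bounded_lip_cst (a : R) : bounded_lip `|a| (fun _ : V => a).
Proof.
by split=> // x y; rewrite subrr normr0 mulr_ge0.
Qed.

Lemma bounded_lip_continuous C phi : bounded_lip C phi -> continuous phi.
Proof.
move=> bl; have C0 := bounded_lip_ge0 bl; case: bl => _ l x.
apply/cvgrPdist_le => e e0; near=> y.
apply: le_trans (l x y) _.
have : `|x - y| <= e / (C + 1).
  near: y; apply: cvgr_dist_le; first exact: cvg_id.
  by rewrite divr_gt0// ltr_wpDl.
rewrite ler_pdivlMr ?ltr_wpDl// => h; have : 0 <= `|x - y| by [].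
by nra.
Unshelve. all: by end_near. Qed.

End BoundedLipschitz.

Section CubeIntegral.
Variable R : realType.

Lemma mx_norm_row_mx (m : nat) (t : 'rV[R]_1) (u : 'rV[R]_m) C :
  `|row_mx t u| <= C <-> `|t 0 0| <= C /\ `|u| <= C.
Proof.
rewrite [`|row_mx t u|]mx_normrE [`|u|]mx_normrE; split=> [/bigmax_leP/= [C0 h]|[tC]].
  split; first by have := h (0, lshift m 0) isT; rewrite /= row_mxEl.
  apply/bigmax_leP; split=> //= -[i j] _ /=.
  by have := h (i, rshift 1 j) isT; rewrite /= row_mxEr.
move=> /bigmax_leP/= [C0 h]; apply/bigmax_leP; split=> //= -[i j] _ /=.
case: (split_ordP j) => k ->; rewrite ?row_mxEl ?row_mxEr; first by rewrite !ord1.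
exact: (h (i, k)).
Qed.

Lemma row_mxB m (t t' : 'rV[R]_1) (u u' : 'rV[R]_m) :
  (row_mx t u : 'rV_m.+1) - row_mx t' u' = row_mx (t - t') (u - u').
Proof. by rewrite -add_row_mx -opp_row_mx. Qed.

Lemma bounded_lip_row_mx m C (phi : 'rV[R]_m.+1 -> R) : bounded_lip C phi ->
  (forall t : R, bounded_lip C (fun u : 'rV[R]_m => phi (row_mx (t%:M : 'rV_1) u))) /\
  (forall u, bounded_lip C (fun t : R => phi (row_mx (t%:M : 'rV_1) u))).
Proof.
move=> bl; have C0 := bounded_lip_ge0 bl; case: bl => b l.
split=> [t|u]; split=> // x y; apply: le_trans (l _ _) _; rewrite ler_wpM2l//;
  rewrite row_mxB; apply/mx_norm_row_mx.
  by rewrite subrr mxE normr0.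
by rewrite subrr normr0 !mxE eqxx.
Qed.

(** The three properties are proved together by induction on the dimension: in dimension m they make
    the integral a contraction for the sup norm, hence the slice integral is bounded Lipschitz in t,
    which allows one more integration. *)
Record cube_integral_spec n : Prop := CubeIntegralSpec {
  cube_spec_lin : forall a C D (phi psi : 'rV[R]_n -> R), bounded_lip C phi ->
    bounded_lip D psi -> cube_integral (fun x => a * phi x + psi x) =
    a * cube_integral phi + cube_integral psi;
  cube_spec_le : forall C D (phi psi : 'rV[R]_n -> R), bounded_lip C phi ->
    bounded_lip D psi -> (forall x, phi x <= psi x) ->
    cube_integral phi <= cube_integral psi;
  cube_spec_cst : forall a : R, cube_integral (fun _ : 'rV[R]_n => a) = a }.

Lemma cube_integral_norm_le_aux n : cube_integral_spec n ->
  forall C (D : R) (phi : 'rV[R]_n -> R), bounded_lip C phi ->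
  (forall x, `|phi x| <= D) -> `|cube_integral phi| <= D.
Proof.
move=> [lin le cst] C D phi bl b; rewrite ler_norml.
rewrite -{1}(cst D) -{2}(cst D) -mulN1r -(addr0 (-1 * _)) -{1}(cst 0).
rewrite -(lin _ _ _ _ _ (bounded_lip_cst _ D) (bounded_lip_cst _ 0)).
have bl1 := bounded_lip_cst 'rV[R]_n (-1 * D + 0).
apply/andP; split; [apply: (le _ _ _ _ bl1 bl)|apply: (le _ _ _ _ bl (bounded_lip_cst _ D))] => x.
  by have := b x; rewrite ler_norml => /andP[h _]; lra.
by have := b x; rewrite ler_norml => /andP[_ h].
Qed.

Lemma cube_slice_bounded_lip_aux m : cube_integral_spec m ->
  forall C (phi : 'rV[R]_m.+1 -> R), bounded_lip C phi ->
  bounded_lip C (fun t : R =>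
    cube_integral (fun u : 'rV[R]_m => phi (row_mx (t%:M : 'rV_1) u))).
Proof.
move=> H C phi bl; have [bs bt] := bounded_lip_row_mx bl.
split=> [t|s t]; first by apply: (cube_integral_norm_le_aux H (bs t)); case: (bs t).
rewrite addrC -mulN1r -(cube_spec_lin H _ (bs t) (bs s)).
apply: (cube_integral_norm_le_aux H
         (bounded_lipD (bounded_lipZ (-1) (bs t)) (bs s))) => x.
by rewrite mulN1r addrC; case: (bt x).
Qed.

Lemma cube_integralP n : cube_integral_spec n.
Proof.
elim: n => [|m IH]; first by split=> /= *; auto.
have co C phi (bl : bounded_lip C phi) :=
  bounded_lip_continuous (cube_slice_bounded_lip_aux IH bl).
split=> [a C D phi psi blC blD|C D phi psi blC blD le|a] /=.
- have [bC _] := bounded_lip_row_mx blC; have [bD _] := bounded_lip_row_mx blD.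
  rewrite -/(unit_integral _) -(unit_integralZ _ (co _ _ blC)) -unit_integralD; last 2 first.
  - move=> t; apply: cvgM; [exact: cvg_cst|exact: (co _ _ blC)].
  - exact: (co _ _ blD).
  by congr unit_integral; apply/funext => t; rewrite (cube_spec_lin IH _ (bC t) (bD t)).
- have [bC _] := bounded_lip_row_mx blC; have [bD _] := bounded_lip_row_mx blD.
  apply: le_unit_integral; [exact: (co _ _ blC)|exact: (co _ _ blD)|move=> t].
  by apply: (cube_spec_le IH (bC t) (bD t)) => u.
- rewrite -/(unit_integral _) -[RHS]unit_integral_cst; congr unit_integral.
  by apply/funext => t; rewrite (cube_spec_cst IH).
Qed.

Definition bl n (phi : 'rV[R]_n -> R) := exists C, bounded_lip C phi.

Lemma cube_integralD n (phi psi : 'rV[R]_n -> R) : bl phi -> bl psi ->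
  cube_integral (fun x => phi x + psi x) = cube_integral phi + cube_integral psi.
Proof.
move=> [C c] [D d]; rewrite -[X in X + _]mul1r -(cube_spec_lin (cube_integralP n) _ c d).
by congr cube_integral; apply/funext => x; rewrite mul1r.
Qed.

Lemma cube_integral_cst n (a : R) : cube_integral (fun _ : 'rV[R]_n => a) = a.
Proof. exact: cube_spec_cst (cube_integralP n) a. Qed.

Lemma cube_integralZ n a (phi : 'rV[R]_n -> R) : bl phi ->
  cube_integral (fun x => a * phi x) = a * cube_integral phi.
Proof.
move=> [C c]; rewrite -[RHS]addr0 -[X in _ + X](cube_integral_cst n).
rewrite -(cube_spec_lin (cube_integralP n) _ c (bounded_lip_cst _ 0)).
by congr cube_integral; apply/funext => x; rewrite addr0.
Qed.

Lemma le_cube_integral n (phi psi : 'rV[R]_n -> R) : bl phi -> bl psi ->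
  (forall x, phi x <= psi x) -> cube_integral phi <= cube_integral psi.
Proof. by move=> [C c] [D d]; exact: cube_spec_le (cube_integralP n) _ _ _ _ c d. Qed.

Lemma cube_integral_norm_le n (D : R) (phi : 'rV[R]_n -> R) : bl phi ->
  (forall x, `|phi x| <= D) -> `|cube_integral phi| <= D.
Proof. by move=> [C c]; exact: cube_integral_norm_le_aux (cube_integralP n) _ _ _ c. Qed.

Lemma cube_slice_bounded_lip m C (phi : 'rV[R]_m.+1 -> R) : bounded_lip C phi ->
  bounded_lip C (fun t : R =>
    cube_integral (fun u : 'rV[R]_m => phi (row_mx (t%:M : 'rV_1) u))).
Proof. exact: cube_slice_bounded_lip_aux (cube_integralP m) _ _. Qed.

Lemma blD n (phi psi : 'rV[R]_n -> R) : bl phi -> bl psi ->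
  bl (fun x => phi x + psi x).
Proof. by move=> [C c] [D d]; eexists; exact: bounded_lipD c d. Qed.

Lemma blM n (phi psi : 'rV[R]_n -> R) : bl phi -> bl psi ->
  bl (fun x => phi x * psi x).
Proof. by move=> [C c] [D d]; eexists; exact: bounded_lipM c d. Qed.

Lemma bl_cst n (a : R) : bl (fun _ : 'rV[R]_n => a).
Proof. by eexists; exact: bounded_lip_cst. Qed.

Lemma blZ n a (phi : 'rV[R]_n -> R) : bl phi -> bl (fun x => a * phi x).
Proof. by move=> [C c]; eexists; exact: bounded_lipZ c. Qed.

End CubeIntegral.

(** * Smooth periodic functions *)

Section SmoothFunctions.
Variables (R : realType) (n : nat).
Implicit Types (phi psi : 'rV[R]_n -> R) (v x : 'rV[R]_n).

(** Derivatives are taken along all directions, not only along the axes, so that the class is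
    visibly stable under linear changes of variables, where [v] becomes [v *m M]. *)
Fixpoint Ck (k : nat) phi : Prop :=
  (forall x, differentiable phi x) /\
  if k is k'.+1 then forall v, Ck k' (fun x => 'D_v phi x) else True.

Definition smooth phi := forall k, Ck k phi.

Lemma CkW k phi : Ck k.+1 phi -> Ck k phi.
Proof.
elim: k phi => [|k IH] phi [d h]; first by split.
by split=> // v; apply: IH; exact: h.
Qed.

Lemma Ck_differentiable k phi x : Ck k phi -> differentiable phi x.
Proof. by case: k => [|k] []. Qed.

Lemma smooth_differentiable phi x : smooth phi -> differentiable phi x.
Proof. by move=> /(_ 0%N) []. Qed.

Lemma smooth_derive phi v : smooth phi -> smooth (fun x => 'D_v phi x).
Proof. by move=> h k; have [_] := h k.+1; exact. Qed.

Lemma derive_addv phi x v w : differentiable phi x ->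
  'D_(v + w) phi x = 'D_v phi x + 'D_w phi x.
Proof. by move=> d; rewrite !deriveE// linearD. Qed.

Lemma derive_scalev phi x a v : differentiable phi x ->
  'D_(a *: v) phi x = a * 'D_v phi x.
Proof. by move=> d; rewrite !deriveE// linearZ. Qed.

Lemma derive_sumv phi x I (r : seq I) (w : I -> 'rV[R]_n) : differentiable phi x ->
  'D_(\sum_(i <- r) w i) phi x = \sum_(i <- r) 'D_(w i) phi x.
Proof. by move=> d; rewrite deriveE// linear_sum; apply: eq_bigr => i _; rewrite deriveE. Qed.

Lemma derive_coord phi x v : differentiable phi x ->
  'D_v phi x = \sum_i v 0 i * 'D_(delta_mx 0 i) phi x.
Proof.
move=> d; rewrite {1}(row_sum_delta v) derive_sumv//.
by apply: eq_bigr => i _; rewrite derive_scalev.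
Qed.

Lemma Ck_ext k phi psi : phi =1 psi -> Ck k phi -> Ck k psi.
Proof. by move=> /funext ->. Qed.

Lemma Ck_cst k (a : R) : Ck k (fun=> a).
Proof.
elim: k a => [|k IH] a; (split; first by move=> x; exact: differentiable_cst) => // v.
by apply: (Ck_ext _ (IH 0)) => x; rewrite derive_cst.
Qed.

Lemma derive_addf phi psi x v : differentiable phi x -> differentiable psi x ->
  'D_v (fun y => phi y + psi y) x = 'D_v phi x + 'D_v psi x.
Proof. by move=> d e; rewrite (deriveD (diff_derivable d) (diff_derivable e)). Qed.

Lemma derive_mulf phi psi x v : differentiable phi x -> differentiable psi x ->
  'D_v (fun y => phi y * psi y) x = 'D_v phi x * psi x + phi x * 'D_v psi x.
Proof.
move=> d e; rewrite (@deriveM _ _ phi psi x v (diff_derivable d) (diff_derivable e)).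
by rewrite addrC; congr (_ + _); rewrite /GRing.scale/= mulrC.
Qed.

Lemma derive_oppf phi x v : differentiable phi x ->
  'D_v (fun y => - phi y) x = - 'D_v phi x.
Proof. by move=> d; rewrite (deriveN (diff_derivable d)). Qed.

Lemma derive_invf phi x v : phi x != 0 -> differentiable phi x ->
  'D_v (fun y => (phi y)^-1) x = - ('D_v phi x * ((phi x)^-1 * (phi x)^-1)).
Proof.
move=> nz d; rewrite deriveV//; last exact: diff_derivable.
by rewrite [LHS]mulNr -exprVn expr2 mulrC.
Qed.

Lemma CkD k phi psi : Ck k phi -> Ck k psi -> Ck k (fun x => phi x + psi x).
Proof.
elim: k phi psi => [|k IH] phi psi [d h] [d' h'];
  (split; first by move=> x; exact: differentiableD) => // v.
by apply: (Ck_ext _ (IH _ _ (h v) (h' v))) => x; rewrite derive_addf.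
Qed.

Lemma CkN k phi : Ck k phi -> Ck k (fun x => - phi x).
Proof.
elim: k phi => [|k IH] phi [d h]; (split; first by move=> x; exact: differentiableN) => // v.
by apply: (Ck_ext _ (IH _ (h v))) => x; rewrite derive_oppf.
Qed.

Lemma CkM k phi psi : Ck k phi -> Ck k psi -> Ck k (fun x => phi x * psi x).
Proof.
elim: k phi psi => [|k IH] phi psi.
  by move=> [d _] [d' _]; split=> // x; exact: differentiableM.
move=> hp hq; split=> [x|v].
  exact: differentiableM (Ck_differentiable _ hp) (Ck_differentiable _ hq).
have := CkD (IH _ _ (hp.2 v) (CkW hq)) (IH _ _ (CkW hp) (hq.2 v)).
by apply: Ck_ext => x; rewrite derive_mulf//; [exact: Ck_differentiable hp|exact: Ck_differentiable hq].
Qed.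

Lemma CkV k phi : (forall x, phi x != 0) -> Ck k phi -> Ck k (fun x => (phi x)^-1).
Proof.
move=> nz; elim: k => [|k IH] hp.
  by split=> // x; apply: differentiableV => //; exact: Ck_differentiable hp.
split=> [x|v]; first by apply: differentiableV => //; exact: Ck_differentiable hp.
have hv := IH (CkW hp).
have := CkN (CkM (hp.2 v) (CkM hv hv)).
by apply: Ck_ext => x; rewrite derive_invf//; exact: Ck_differentiable hp.
Qed.

Lemma smooth_ext phi psi : phi =1 psi -> smooth phi -> smooth psi.
Proof. by move=> /funext ->. Qed.
Lemma smooth_cst (a : R) : smooth (fun=> a). Proof. by move=> k; exact: Ck_cst. Qed.
Lemma smoothD phi psi : smooth phi -> smooth psi -> smooth (fun x => phi x + psi x).
Proof. by move=> p q k; exact: CkD. Qed.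
Lemma smoothN phi : smooth phi -> smooth (fun x => - phi x).
Proof. by move=> p k; exact: CkN. Qed.
Lemma smoothB phi psi : smooth phi -> smooth psi -> smooth (fun x => phi x - psi x).
Proof. by move=> p q; apply: smoothD => //; exact: smoothN. Qed.
Lemma smoothM phi psi : smooth phi -> smooth psi -> smooth (fun x => phi x * psi x).
Proof. by move=> p q k; exact: CkM. Qed.
Lemma smoothZ a phi : smooth phi -> smooth (fun x => a * phi x).
Proof. by move=> p; apply: smoothM => //; exact: smooth_cst. Qed.
Lemma smoothV phi : (forall x, phi x != 0) -> smooth phi -> smooth (fun x => (phi x)^-1).
Proof. by move=> nz p k; exact: CkV. Qed.
Lemma smoothX phi m : smooth phi -> smooth (fun x => phi x ^+ m).
Proof.
move=> p; elim: m => [|m IH]; first exact: smooth_ext (smooth_cst 1).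
by apply: smooth_ext (smoothM p IH) => x; rewrite exprS.
Qed.
Lemma smooth_sum I (r : seq I) (F : I -> 'rV[R]_n -> R) :
  (forall i, smooth (F i)) -> smooth (fun x => \sum_(i <- r) F i x).
Proof.
move=> h; elim: r => [|i r IH].
  by apply: smooth_ext (smooth_cst 0) => x; rewrite big_nil.
by apply: smooth_ext (smoothD (h i) IH) => x; rewrite big_cons.
Qed.

Lemma derive_sumf I (r : seq I) (F : I -> 'rV[R]_n -> R) x v :
  (forall i, smooth (F i)) ->
  'D_v (fun y => \sum_(i <- r) F i y) x = \sum_(i <- r) 'D_v (F i) x.
Proof.
move=> h; elim: r => [|i r IH].
  rewrite big_nil -[RHS](derive_cst (0 : R) x v); congr ('D_v _ x).
  by apply/funext => y; rewrite big_nil.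
rewrite big_cons -IH -derive_addf; last 2 first.
- exact: smooth_differentiable.
- by apply: smooth_differentiable; exact: smooth_sum.
by congr ('D_v _ x); apply/funext => y; rewrite big_cons.
Qed.

Lemma derive_scalef a phi x v : differentiable phi x ->
  'D_v (fun y => a * phi y) x = a * 'D_v phi x.
Proof.
by move=> d; rewrite derive_mulf// derive_cst mul0r add0r.
Qed.

Lemma derive_affine m (M : 'M[R]_(m, n)) (b : 'rV[R]_n) phi y w :
  'D_w (fun z : 'rV[R]_m => phi (z *m M + b)) y = 'D_(w *m M) phi (y *m M + b).
Proof.
rewrite /derive; set d := (fun h : R => h^-1 *: _); set d' := (fun h : R => h^-1 *: _).
suff -> : d = d' by []; apply/funext => h; rewrite /d /d' /=.
by rewrite mulmxDl -scalemxAl addrA.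
Qed.

Lemma derive_line phi x v (s : R) :
  'D_1 (fun t : R => phi (x + t *: v)) s = 'D_v phi (x + s *: v).
Proof.
rewrite /derive; set d := (fun h : R => h^-1 *: _); set d' := (fun h : R => h^-1 *: _).
suff -> : d = d' by []; apply/funext => h; rewrite /d /d' /=.
by rewrite [h *: 1]mulr1 scalerDl addrCA.
Qed.

Lemma is_derive_line phi x v (s : R) : smooth phi ->
  is_derive s 1 (fun t : R => phi (x + t *: v)) ('D_v phi (x + s *: v)).
Proof.
move=> sm; rewrite -derive_line; apply: derivableP.
apply/derivable1_diffP; apply: (@differentiable_comp _ R^o _ _ (fun t : R^o => x + t *: v)).
  by apply: differentiableD; [exact: differentiable_cst|exact: (@differentiableZl _ _ _ (@id R) v)].
exact: smooth_differentiable.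
Qed.

Lemma smooth_MVT phi x v : smooth phi ->
  exists2 s : R, s \in `[0, 1] & phi (x + v) - phi x = 'D_v phi (x + s *: v).
Proof.
move=> sm.
have [] := @MVT_segment R (fun t => phi (x + t *: v)) (fun t => 'D_v phi (x + t *: v)) 0 1 ler01.
- by move=> s _; exact: is_derive_line.
- apply: continuous_subspaceT => t.
  apply/differentiable_continuous/derivable1_diffP.
  by case: (is_derive_line x v t sm).
- by move=> s s01; rewrite scale1r scale0r addr0 subr0 mulr1; exists s.
Qed.

End SmoothFunctions.

Section SmoothAffine.
Variable R : realType.

Lemma differentiable_rowP (V : normedModType R) n (F : V -> 'rV[R]_n) x :
  differentiable F x <-> forall j, differentiable (fun y => F y 0 j) x.
Proof.
split=> [d j|d].
  apply: (@differentiable_comp _ _ _ _ F (fun M : 'rV[R]_n => M 0 j)) => //.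
  exact: differentiable_coord.
have -> : F = \sum_j (fun y => F y 0 j *: delta_mx 0 j).
  by apply/funext => y; rewrite fct_sumE -row_sum_delta.
by apply: (differentiable_sum (f := fun j y => F y 0 j *: delta_mx 0 j)) => j; exact: differentiableZl.
Qed.

Lemma derive_row N (V : normedModType R) (F : V -> 'rV[R]_N) x v j :
  differentiable F x -> ('D_v F x) 0 j = 'D_v (fun y => F y 0 j) x.
Proof. by move=> d; rewrite derive_mx ?mxE//; exact: diff_derivable. Qed.

Lemma derive_coordE n (j : 'I_n) (x v : 'rV[R]_n) :
  'D_v (fun x : 'rV[R]_n => x 0 j) x = v 0 j.
Proof. by rewrite -[in RHS](derive_id x v) derive_row. Qed.

Lemma smooth_coord n (j : 'I_n) : smooth (fun x : 'rV[R]_n => x 0 j).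
Proof.
have d x : differentiable (fun x : 'rV[R]_n => x 0 j) x by exact: differentiable_coord.
case=> [|k]; split=> // v.
by apply: (Ck_ext _ (Ck_cst n k (v 0 j))) => x; rewrite derive_coordE.
Qed.

Lemma differentiable_affine m n (M : 'M[R]_(m, n)) (b : 'rV[R]_n) y :
  differentiable (fun z : 'rV[R]_m => z *m M + b) y.
Proof.
apply: differentiableD; last exact: differentiable_cst.
apply/differentiable_rowP => j.
apply: (@smooth_differentiable _ _ (fun z => (z *m M) 0 j)).
apply: (@smooth_ext _ _ (fun z => \sum_i M i j * z 0 i)).
  by move=> z; rewrite mxE; apply: eq_bigr => i _; rewrite mulrC.
by apply: smooth_sum => i; apply: smoothZ; exact: smooth_coord.
Qed.

Lemma smooth_affine m n (M : 'M[R]_(m, n)) (b : 'rV[R]_n) (phi : 'rV[R]_n -> R) :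
  smooth phi -> smooth (fun z : 'rV[R]_m => phi (z *m M + b)).
Proof.
have main k : forall psi, Ck k psi -> Ck k (fun z : 'rV[R]_m => psi (z *m M + b)).
  elim: k => [|k IH] psi hp; (split; first move=> x).
  - apply: (@differentiable_comp _ _ _ _ _ psi); first exact: differentiable_affine.
    exact: Ck_differentiable hp.
  - by [].
  - apply: (@differentiable_comp _ _ _ _ _ psi); first exact: differentiable_affine.
    exact: Ck_differentiable hp.
  - by move=> v; apply: (Ck_ext _ (IH _ (hp.2 (v *m M)))) => x; rewrite derive_affine.
by move=> sm k; exact: main.
Qed.

Lemma dotp_sum n (u v : 'rV[R]_n) : dotp u v = \sum_j u 0 j * v 0 j.
Proof. by rewrite /dotp mxE; apply: eq_bigr => j _; rewrite mxE. Qed.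

Lemma dotpC n (u v : 'rV[R]_n) : dotp u v = dotp v u.
Proof. by rewrite !dotp_sum; apply: eq_bigr => j _; rewrite mulrC. Qed.

Lemma dotpDl n (u v w : 'rV[R]_n) : dotp (u + v) w = dotp u w + dotp v w.
Proof. by rewrite /dotp mulmxDl mxE. Qed.

Lemma dotpZl n a (u w : 'rV[R]_n) : dotp (a *: u) w = a * dotp u w.
Proof. by rewrite /dotp -scalemxAl mxE. Qed.

Lemma dotpDr n (u v w : 'rV[R]_n) : dotp w (u + v) = dotp w u + dotp w v.
Proof. by rewrite dotpC dotpDl !(dotpC w). Qed.

Lemma dotpZr n a (u w : 'rV[R]_n) : dotp w (a *: u) = a * dotp w u.
Proof. by rewrite dotpC dotpZl dotpC. Qed.

Lemma dotpNl n (u w : 'rV[R]_n) : dotp (- u) w = - dotp u w.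
Proof. by rewrite -scaleN1r dotpZl mulN1r. Qed.

Lemma dotpNr n (u w : 'rV[R]_n) : dotp w (- u) = - dotp w u.
Proof. by rewrite dotpC dotpNl dotpC. Qed.

Lemma dotp0l n (w : 'rV[R]_n) : dotp 0 w = 0.
Proof. by rewrite /dotp mul0mx mxE. Qed.

Lemma dotp0r n (w : 'rV[R]_n) : dotp w 0 = 0.
Proof. by rewrite dotpC dotp0l. Qed.

Lemma dotp_suml n I (r : seq I) (F : I -> 'rV[R]_n) w :
  dotp (\sum_(i <- r) F i) w = \sum_(i <- r) dotp (F i) w.
Proof.
elim: r => [|i r IH]; first by rewrite !big_nil dotp0l.
by rewrite !big_cons dotpDl IH.
Qed.

Lemma dotp_sumr n I (r : seq I) (F : I -> 'rV[R]_n) w :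
  dotp w (\sum_(i <- r) F i) = \sum_(i <- r) dotp w (F i).
Proof. by rewrite dotpC dotp_suml; apply: eq_bigr => i _; rewrite dotpC. Qed.

Lemma sqnorm_ge0 n (u : 'rV[R]_n) : 0 <= sqnorm u.
Proof. by rewrite /sqnorm dotp_sum sumr_ge0// => j _; rewrite -expr2 sqr_ge0. Qed.

Lemma sqnorm_eq0 n (u : 'rV[R]_n) : (sqnorm u == 0) = (u == 0).
Proof.
apply/eqP/eqP => [|->]; last exact: dotp0l.
rewrite /sqnorm dotp_sum => /psumr_eq0P h; apply/rowP => j; rewrite mxE.
by apply/eqP; rewrite -sqrf_eq0 expr2; apply/eqP/h => // i _; rewrite -expr2 sqr_ge0.
Qed.

Lemma sqnorm_gt0 n (u : 'rV[R]_n) : (0 < sqnorm u) = (u != 0).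
Proof. by rewrite lt_neqAle sqnorm_ge0 andbT eq_sym sqnorm_eq0. Qed.

Lemma dotp_mulmx m n (u : 'rV[R]_m) (A : 'M[R]_(m, n)) v :
  dotp (u *m A) v = dotp u (v *m A^T).
Proof. by rewrite /dotp trmx_mul trmxK mulmxA. Qed.

End SmoothAffine.

Section Trigonometric.
Variables (R : realType) (n : nat).
Implicit Types (xi x v : 'rV[R]_n).

Lemma smooth_dotp xi : smooth (fun x => dotp xi x).
Proof.
apply: (@smooth_ext _ _ (fun x => \sum_j xi 0 j * x 0 j)).
  by move=> x; rewrite dotp_sum.
by apply: smooth_sum => j; apply: smoothZ; exact: smooth_coord.
Qed.

Lemma derive_dotp xi x v : 'D_v (fun x => dotp xi x) x = dotp xi v.
Proof.
have -> : (fun x => dotp xi x) = (fun x => \sum_j xi 0 j * x 0 j).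
  by apply/funext => y; rewrite dotp_sum.
rewrite derive_sumf; last by move=> j; apply: smoothZ; exact: smooth_coord.
rewrite dotp_sum; apply: eq_bigr => j _.
by rewrite derive_scalef ?derive_coordE//; exact: differentiable_coord.
Qed.

Lemma derive_compf (f : R -> R) (f' : R) (phi : 'rV[R]_n -> R) x v :
  is_derive (phi x) 1 f f' -> differentiable phi x ->
  'D_v (fun y => f (phi y)) x = f' * 'D_v phi x.
Proof.
move=> df dphi.
have df1 : differentiable f (phi x) by apply/derivable1_diffP; case: df.
rewrite deriveE; last exact: (@differentiable_comp _ _ _ _ phi f).
rewrite (@diff_comp _ _ _ _ phi f)//= deriv1E; last by case: df.
by rewrite derive1E (derive_val (is_derive := df)) -deriveE// mulrC.
Qed.

Lemma derive_cos_dotp xi x v :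
  'D_v (fun x => cos (dotp xi x)) x = - (dotp xi v * sin (dotp xi x)).
Proof.
rewrite (derive_compf (f' := - sin (dotp xi x))).
- by rewrite derive_dotp mulNr mulrC.
- exact: smooth_differentiable (smooth_dotp xi).
Qed.

Lemma derive_sin_dotp xi x v :
  'D_v (fun x => sin (dotp xi x)) x = dotp xi v * cos (dotp xi x).
Proof.
rewrite (derive_compf (f' := cos (dotp xi x))).
- by rewrite derive_dotp mulrC.
- exact: smooth_differentiable (smooth_dotp xi).
Qed.

Lemma smooth_cos_sin xi :
  smooth (fun x => cos (dotp xi x)) /\ smooth (fun x => sin (dotp xi x)).
Proof.
have dc x : differentiable (fun x => cos (dotp xi x)) x.
  apply: (@differentiable_comp _ _ _ _ (fun x => dotp xi x) cos).
    exact: smooth_differentiable (smooth_dotp xi).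
  exact/derivable1_diffP.
have ds x : differentiable (fun x => sin (dotp xi x)) x.
  apply: (@differentiable_comp _ _ _ _ (fun x => dotp xi x) sin).
    exact: smooth_differentiable (smooth_dotp xi).
  exact/derivable1_diffP.
have main k : Ck k (fun x => cos (dotp xi x)) /\ Ck k (fun x => sin (dotp xi x)).
  elim: k => [|k [IHc IHs]]; first by split; split.
  split; (split=> // v).
    apply: (Ck_ext _ (CkN (CkM (Ck_cst _ k (dotp xi v)) IHs))) => x.
    by rewrite derive_cos_dotp.
  apply: (Ck_ext _ (CkM (Ck_cst _ k (dotp xi v)) IHc)) => x.
  by rewrite derive_sin_dotp.
by split=> k; case: (main k).
Qed.

End Trigonometric.

Section Periodic.
Variable R : realType.

Definition periodic_for n (V : 'M[R]_n) (phi : 'rV[R]_n -> R) :=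
  forall x (k : 'rV[int]_n), phi (x + map_mx intr k *m V^T) = phi x.

Definition smooth_periodic n (V : 'M[R]_n) phi := smooth phi /\ periodic_for V phi.

Lemma coord_norm_le n (v : 'rV[R]_n) i : `|v 0 i| <= `|v|.
Proof.
rewrite [`|v|]mx_normrE.
exact: (le_bigmax _ (fun ij : 'I_1 * 'I_n => `|v ij.1 ij.2|) (0, i)).
Qed.

Lemma smooth_periodic_derive n (V : 'M[R]_n) phi v : smooth_periodic V phi ->
  smooth_periodic V (fun x => 'D_v phi x).
Proof.
move=> [s p]; split=> [|x k]; first exact: smooth_derive.
rewrite -[x in RHS]mulmx1 -{1}(mulmx1 x) -{1}(mulmx1 v).
have -> : 'D_(v *m 1%:M) phi (x *m 1%:M + map_mx intr k *m V^T) =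
  'D_v (fun z => phi (z *m 1%:M + map_mx intr k *m V^T)) x by rewrite derive_affine.
by rewrite mulmx1; congr ('D_v _ x); apply/funext => z; rewrite mulmx1 p.
Qed.

Lemma periodic_bounded n (phi : 'rV[R]_n -> R) : continuous phi ->
  periodic_for 1%:M phi -> exists C, forall x, `|phi x| <= C.
Proof.
move=> cphi p; pose K := [set v : 'rV[R]_n | forall i, `[0, 1]%classic (v ord0 i)].
have cK : compact K.
  apply: (@rV_compact R n (fun=> `[0, 1]%classic)) => _; exact: segment_compact.
have K0 : K !=set0 by exists 0 => i /=; rewrite mxE in_itv/= lexx ler01.
have cn : {within K, continuous (fun x => `|phi x|)}.
  by apply: continuous_subspaceT => x; apply: (continuous_comp (cphi x)); exact: norm_continuous.
have [c _ hc] := EVT_max_rV K0 cK cn.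
exists `|phi c| => x; pose k := map_mx (@Num.floor R) x.
rewrite -(p x (- k)); apply: hc; rewrite inE => i /=.
rewrite trmx1 mulmx1 !mxE rmorphN/= in_itv/= subr_ge0 ge_floor/= lerBlDr addrC.
by move: (floorD1_gt (x 0 i)) => /ltW; rewrite intrD.
Qed.

(** Periodicity moves every point into the compact unit cube, so the function and its partial
    derivatives are bounded. For the max norm the sum of the bounds on the partials is a Lipschitz
    constant. *)
Lemma smooth_periodic_bl n (phi : 'rV[R]_n -> R) : smooth_periodic 1%:M phi -> bl phi.
Proof.
move=> sp; have [sm p] := sp.
have bnd (psi : 'rV[R]_n -> R) : smooth_periodic 1%:M psi -> exists C : R, forall x, `|psi x| <= C.
  move=> [s q]; apply: periodic_bounded => // x.
  exact/differentiable_continuous/smooth_differentiable.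
have [C0 h0] := bnd phi sp.
have /choice[C hC] : forall i : 'I_n, exists C : R, forall x, `|'D_(delta_mx 0 i) phi x| <= C.
  by move=> i; apply: bnd; exact: smooth_periodic_derive.
have C_ge0 i : 0 <= C i by exact: le_trans (hC i 0).
have C0_ge0 : 0 <= C0 by exact: le_trans (h0 0).
exists (C0 + \sum_i C i); split=> [x|x y].
  by apply: le_trans (h0 x) _; rewrite lerDl sumr_ge0.
have [s _] := smooth_MVT y (x - y) sm; rewrite subrKC => ->.
rewrite derive_coord; last exact: smooth_differentiable.
apply: le_trans (ler_norm_sum _ _ _) _.
rewrite mulrDl; apply: ler_wpDl; first by rewrite mulr_ge0.
rewrite mulr_suml; apply: ler_sum => i _; rewrite normrM mulrC.
by apply: ler_pM => //; exact: coord_norm_le.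
Qed.

Lemma intr_row_mx m (a : 'rV[int]_1) (b : 'rV[int]_m) :
  map_mx intr (row_mx a b : 'rV_m.+1) = (row_mx (map_mx intr a) (map_mx intr b) : 'rV[R]_m.+1).
Proof.
apply/rowP => j; rewrite mxE; case: (@split_ordP 1 m j) => k ->.
  by rewrite (row_mxEl a b) (row_mxEl (map_mx intr a) (map_mx intr b)) mxE.
by rewrite (row_mxEr a b) (row_mxEr (map_mx intr a) (map_mx intr b)) mxE.
Qed.

Lemma row_mxD m (t t' : 'rV[R]_1) (u u' : 'rV[R]_m) :
  (row_mx t u : 'rV_m.+1) + row_mx t' u' = row_mx (t + t') (u + u').
Proof. by rewrite -add_row_mx. Qed.

Lemma row_mxZ m a (t : 'rV[R]_1) (u : 'rV[R]_m) :
  a *: (row_mx t u : 'rV_m.+1) = row_mx (a *: t) (a *: u).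
Proof. by rewrite -scale_row_mx. Qed.

Lemma smooth_periodic_slice m (phi : 'rV[R]_m.+1 -> R) (t : R) :
  smooth_periodic 1%:M phi ->
  smooth_periodic 1%:M (fun u : 'rV[R]_m => phi (row_mx (t%:M : 'rV_1) u)).
Proof.
have E u : row_mx (t%:M : 'rV[R]_1) u = u *m (row_mx 0 (1%:M) : 'M[R]_(m, 1 + m)) + row_mx t%:M 0.
  by rewrite mul_mx_row mulmx0 mulmx1 add_row_mx add0r addr0.
move=> [s p]; split.
  have := @smooth_affine _ m m.+1 (row_mx 0 (1%:M) : 'M[R]_(m, 1 + m)) (row_mx t%:M 0) _ s.
  by apply: smooth_ext => u; rewrite (E u).
move=> u k; rewrite trmx1 mulmx1.
rewrite -[RHS](p _ (row_mx 0 k : 'rV_(1 + m))) trmx1 mulmx1; congr phi.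
by rewrite intr_row_mx raddf0 row_mxD addr0.
Qed.

Lemma derive_slice m (phi : 'rV[R]_m.+1 -> R) (t : R) (u v : 'rV[R]_m) :
  'D_v (fun u : 'rV[R]_m => phi (row_mx (t%:M : 'rV_1) u)) u =
  'D_(row_mx 0 v : 'rV_(1 + m)) phi (row_mx t%:M u).
Proof.
have E u' : row_mx (t%:M : 'rV[R]_1) u' = u' *m (row_mx 0 (1%:M) : 'M[R]_(m, 1 + m)) + row_mx t%:M 0.
  by rewrite mul_mx_row mulmx0 mulmx1 add_row_mx add0r addr0.
have -> : (fun u : 'rV[R]_m => phi (row_mx (t%:M : 'rV_1) u)) =
  (fun u => phi (u *m (row_mx 0 (1%:M) : 'M[R]_(m, 1 + m)) + row_mx t%:M 0 : 'rV_m.+1)).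
  by apply/funext => w; rewrite (E w).
by rewrite derive_affine -(E u); congr ('D_ _ _ _); rewrite mul_mx_row mulmx0 mulmx1.
Qed.

(* t |-> cube_integral (phi (t, .)) is differentiable because the remainder of *)
(* phi is uniformly quadratic.                                                 *)
Lemma cube_integral_derive n (phi : 'rV[R]_n -> R) v : smooth_periodic 1%:M phi ->
  cube_integral (fun x => 'D_v phi x) = 0.
Proof.
elim: n phi v => [|m IH] phi v sp.
  by rewrite /= (_ : v = 0) ?derive0//; apply/rowP => -[].
(* The direction splits into a multiple of [e] and the rest [w]. The part along [w] integrates to 0
   on each slice by induction; the part along [e] is the derivative of the slice integral [P], which
   takes equal values at 0 and 1 by periodicity. *)
pose e := row_mx 1 0 : 'rV[R]_(1 + m); pose w := row_mx 0 (rsubmx (v : 'rV_(1 + m))) : 'rV[R]_(1 + m).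
have dv x : 'D_v phi x = v 0 0 * 'D_e phi x + 'D_w phi x.
  have d := smooth_differentiable x sp.1.
  rewrite -derive_scalev// -derive_addv//; congr ('D_ _ _ _); apply/rowP => j.
  rewrite /e /w row_mxZ scaler0 row_mxD addr0 add0r.
  case: (@split_ordP 1 m j) => k -> {j}.
    rewrite (row_mxEl (v 0 0 *: 1 : 'rV[R]_1)) !ord1 !mxE eqxx mulr1.
    by congr (v _ _); apply/val_inj.
  by rewrite (row_mxEr (v 0 0 *: 1 : 'rV[R]_1)) mxE.
have spe := smooth_periodic_derive e sp; have spw := smooth_periodic_derive w sp.
have -> : (fun x => 'D_v phi x) = (fun x => v 0 0 * 'D_e phi x + 'D_w phi x) by apply/funext.
rewrite cube_integralD; [|exact/blZ/smooth_periodic_bl|exact: smooth_periodic_bl].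
rewrite cube_integralZ; last exact: smooth_periodic_bl.
have -> : cube_integral (fun x => 'D_w phi x) = 0.
  rewrite /= -/(unit_integral _) -[RHS]unit_integral_cst; congr unit_integral.
  apply/funext => t; rewrite -[RHS](IH _ (rsubmx (v : 'rV_(1 + m))) (smooth_periodic_slice t sp)).
  by congr cube_integral; apply/funext => u; rewrite derive_slice.
have [C bC] := smooth_periodic_bl sp; have [D bD] := smooth_periodic_bl spe.
have [De bDe] := smooth_periodic_bl (smooth_periodic_derive e spe).
pose P (t : R) := cube_integral (fun u : 'rV[R]_m => phi (row_mx (t%:M : 'rV_1) u)).
pose Q (t : R) := cube_integral (fun u : 'rV[R]_m => 'D_e phi (row_mx (t%:M : 'rV_1) u)).
have rowD (s h : R) (u : 'rV[R]_m) :
    row_mx ((s + h)%:M : 'rV[R]_1) u = (row_mx s%:M u : 'rV_m.+1) + h *: e.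
  rewrite /e row_mxZ scaler0 row_mxD addr0; congr row_mx.
  by apply/rowP => j; rewrite !mxE !ord1 eqxx mulr1.
have bslice (psi : 'rV[R]_m.+1 -> R) t : smooth_periodic 1%:M psi ->
    bl (fun u : 'rV[R]_m => psi (row_mx (t%:M : 'rV_1) u)).
  by move=> q; apply/smooth_periodic_bl/smooth_periodic_slice.
have b1 t := bslice _ t sp; have b2 t := bslice _ t spe.
have quad (t h : R) : `|P (t + h) - P t - h * Q t| <= De * h ^+ 2.
  have -> : P (t + h) - P t - h * Q t = cube_integral (fun u : 'rV[R]_m =>
     (phi (row_mx ((t + h)%:M : 'rV_1) u) + -1 * phi (row_mx (t%:M : 'rV_1) u))
     + (- h) * 'D_e phi (row_mx (t%:M : 'rV_1) u)).
    rewrite (cube_integralD (blD (b1 _) (blZ _ (b1 _))) (blZ _ (b2 _))).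
    by rewrite (cube_integralD (b1 _) (blZ _ (b1 _))) !cube_integralZ// mulN1r mulNr.
  apply: cube_integral_norm_le.
    exact: blD (blD (b1 _) (blZ _ (b1 _))) (blZ _ (b2 _)).
  move=> u; rewrite rowD mulN1r.
  have [s s01 ->] := smooth_MVT (row_mx t%:M u : 'rV_m.+1) (h *: e) sp.1.
  have d y := smooth_differentiable y sp.1; rewrite derive_scalev//.
  rewrite mulNr -mulrBr.
  have [s' _ ->] := smooth_MVT (row_mx t%:M u : 'rV_m.+1) (s *: (h *: e)) spe.1.
  rewrite scalerA derive_scalev; last exact: smooth_differentiable spe.1.
  set z := _ + s' *: _; have K := bDe.1 z; move: K; set DD := 'D_e _ z => K.
  move: s01; rewrite in_itv/= => /andP[s0 s1].
  rewrite (_ : h * (s * h * DD) = h ^+ 2 * (s * DD)); last by ring.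
  rewrite normrM (ger0_norm (sqr_ge0 h)) mulrC ler_wpM2r ?sqr_ge0//.
  by rewrite normrM ger0_norm//; have := normr_ge0 DD; nra.
have dP (t : R) : is_derive t 1 P (Q t).
  have cv : h^-1 *: ((P \o shift t) (h *: (1 : R)) - P t) @[h --> 0^'] --> Q t.
    apply/cvgrPdist_le => eps eps0.
    have De0 : 0 <= De := bounded_lip_ge0 bDe.
    near=> h; have h0 : h != 0 by near: h; exact: nbhs_dnbhs_neq.
    have hs : `|h| <= eps / (De + 1).
      by near: h; apply: dnbhs0_le; rewrite divr_gt0// ltr_wpDl.
    rewrite /= [h *: 1]mulr1 (addrC h t) distrC.
    have -> : h^-1 *: (P (t + h) - P t) - Q t = h^-1 * (P (t + h) - P t - h * Q t).
      by move: (P _) (P t) (Q t) => a b c; rewrite /GRing.scale/=; field.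
    rewrite normrM normfV mulrC ler_pdivrMr ?normr_gt0//.
    apply: le_trans (quad t h) _.
    have h2 : h ^+ 2 = `|h| * `|h| by rewrite -expr2 real_normK ?num_real.
    rewrite h2 mulrA ler_wpM2r//.
    move: hs; rewrite ler_pdivlMr ?ltr_wpDl// => hs.
    by have := normr_ge0 h; nra.
  by apply: DeriveDef; [apply/cvg_ex; exists (Q t)|exact: cvg_lim cv].
have cQ : continuous Q := bounded_lip_continuous (cube_slice_bounded_lip bD).
have -> : cube_integral (fun x => 'D_e phi x) = P 1 - P 0 by exact: unit_integral_derive.
suff -> : P 1 = P 0 by rewrite subrr mulr0 addr0.
congr cube_integral; apply/funext => u.
have := sp.2 (row_mx (0%:M : 'rV_1) u) (row_mx 1 0 : 'rV_(1 + m)).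
rewrite trmx1 mulmx1 intr_row_mx row_mxD => <-; congr phi.
by apply: (congr2 (@row_mx R 1 1 m)); apply/rowP => j; rewrite !mxE ?ord1 ?eqxx ?add0r ?addr0.
Unshelve. all: by end_near. Qed.

End Periodic.

(** * Fourier approximation and uniqueness *)

Section TrigKernel.
Variable R : realType.

Lemma cosDint (x : R) (k : int) : cos (x + 2 * pi * k%:~R) = cos x.
Proof.
have N (y : R) m : cos (y + 2 * pi * m%:R) = cos y.
  rewrite -[RHS](periodicn (@cosD2pi R) m y) -mulrnA -[pi *+ _]mulr_natr natrM.
  by congr (cos (_ + _)); ring.
case: k => m; first exact: N.
rewrite NegzE mulrNz mulrN -[LHS](N _ m.+1); congr cos; rewrite -pmulrn; ring.
Qed.

Lemma sinDint (x : R) (k : int) : sin (x + 2 * pi * k%:~R) = sin x.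
Proof. by rewrite -!cosBpihalf addrAC cosDint. Qed.

Lemma cos_sub_le (x y : R) : `|cos x - cos y| <= `|x - y|.
Proof.
wlog xy : x y / x <= y => [h|].
  by case/orP: (le_total x y) => /h//; rewrite distrC (distrC y).
have [|c _] := @MVT_segment R cos (fun x => - sin x) x y xy (fun z _ => is_derive_cos z).
  by apply: continuous_subspaceT => z; exact: continuous_cos.
by rewrite distrC => ->; rewrite normrM normrN (distrC x) -[leRHS]mul1r ler_wpM2r// sin_max.
Qed.

(** Write sin y as 2 cos(y/2) sin(y/2), and sin(y/2) as cos(c) y/2 by the mean value theorem. Both
    cosines are at least 1/2, their arguments being at most pi/4. *)
Lemma sin_ge_quarter (y : R) : 0 <= y <= pi / 2 -> y / 4 <= sin y.
Proof.
move=> /andP[y0 yp].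
have p0 := pi_gt0 R.
have cq (c : R) : 0 <= c <= pi / 4 -> 2^-1 <= cos c.
  move=> /andP[c0 c1]; have cc : 0 <= cos c by apply: cos_ge0_pihalf; apply/andP; split; lra.
  have c2 : 0 <= cos (c *+ 2) by apply: cos_ge0_pihalf; rewrite -mulr_natr; apply/andP; split; lra.
  move: c2; rewrite cos_mulr2n -mulr_natr; nra.
have h : cos (y / 2) >= 2^-1 by apply: cq; apply/andP; split; lra.
have s : sin y = 2 * (cos (y / 2) * sin (y / 2)).
  by rewrite -[in LHS](_ : (y / 2) *+ 2 = y) ?sin_mulr2n -mulr_natr; [ring|field].
have y20 : 0 <= y / 2 by rewrite divr_ge0.
have [|c] := @MVT_segment R sin cos 0 (y / 2) y20 (fun z _ => is_derive_sin z).
  by apply: continuous_subspaceT => z; exact: continuous_sin.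
rewrite in_itv/= => /andP[c0 c1] e.
have hc : 2^-1 <= cos c by apply: cq; apply/andP; split; lra.
have hh : 4^-1 <= cos (y / 2) * cos c by nra.
by move: e; rewrite sin0 !subr0 => e; rewrite s e; clear -hh y0; nra.
Qed.

Lemma sin2_shift (a : R) (k : int) : sin (pi * (a - k%:~R)) ^+ 2 = sin (pi * a) ^+ 2.
Proof.
have h (z : R) : sin z ^+ 2 = (1 - cos (z *+ 2)) / 2.
  by rewrite cos_mulr2n sin2cos2 -mulr_natr; field.
rewrite !h -(cosDint ((pi * (a - k%:~R)) *+ 2) k).
by congr ((1 - cos _) / 2); ring.
Qed.

(** The distance to the nearest integer is traded for a sine because the square of sin (pi t) can be
    integrated exactly against the kernel. *)
Lemma near_int (a : R) : exists k : int, `|a - k%:~R| <= 2 * `|sin (pi * a)|.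
Proof.
pose k := Num.floor (a + 2^-1); exists k.
have h1 : k%:~R <= a + 2^-1 by exact: ge_floor.
have h2 : a + 2^-1 < k%:~R + 1 by have := floorD1_gt (a + 2^-1); rewrite intrD.
have -> : `|sin (pi * a)| = `|sin (pi * `|a - k%:~R|)|.
  apply: (@pexpIrn _ 2) => //; rewrite !real_normK ?num_real// -(sin2_shift a k).
  by case: (ler0P (a - k%:~R)) => _; rewrite ?mulrN ?sinN ?sqrrN.
set b := `|_|; have b0 : 0 <= b by exact: normr_ge0.
have b1 : b <= 2^-1 by rewrite /b ler_norml; apply/andP; split; lra.
have p2 := pi_ge2 R.
have b2 : pi * b <= pi / 2 by rewrite ler_wpM2l// pi_ge0.
have s : pi * b / 4 <= sin (pi * b) by apply: sin_ge_quarter; rewrite mulr_ge0 ?pi_ge0.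
have b3 : 2 * b <= pi * b by rewrite ler_wpM2r.
by have := ler_norm (sin (pi * b)); lra.
Qed.

End TrigKernel.

Section Kernel.
Variable R : realType.

Lemma is_derive_cos_shift (a t : R) :
  is_derive t 1 (fun t => cos (pi * (a - t))) (pi * sin (pi * (a - t))).
Proof.
have h : is_derive t 1 (fun t => pi * (a - t)) (- pi).
  have -> : (fun t : R => pi * (a - t)) = (cst (pi * a)) + (- pi) \*: id.
    by apply/funext => y; rewrite fctE /= /GRing.scale/=; ring.
  by apply: is_derive_eq; rewrite add0r /GRing.scale/= mulr1.
by apply: (is_derive_eq (is_derive1_comp (is_derive_cos _) h)); ring.
Qed.

Lemma is_derive_sin_shift (a t : R) :
  is_derive t 1 (fun t => sin (pi * (a - t))) (- pi * cos (pi * (a - t))).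
Proof.
have h : is_derive t 1 (fun t => pi * (a - t)) (- pi).
  have -> : (fun t : R => pi * (a - t)) = (cst (pi * a)) + (- pi) \*: id.
    by apply/funext => y; rewrite fctE /= /GRing.scale/=; ring.
  by apply: is_derive_eq; rewrite add0r /GRing.scale/= mulr1.
by apply: (is_derive_eq (is_derive1_comp (is_derive_sin _) h)); ring.
Qed.

Lemma continuous_cos_shift (a : R) : continuous (fun t => cos (pi * (a - t))).
Proof.
by move=> t; apply/differentiable_continuous/derivable1_diffP; case: (is_derive_cos_shift a t).
Qed.

Lemma continuous_exp (f : R -> R) N : continuous f -> continuous (fun t => f t ^+ N).
Proof. by move=> cf t; exact: (@continuous_comp _ _ _ f (fun x : R => x ^+ N) t (cf t) (@exprn_continuous _ N _)). Qed.

Definition cos_moment N (a : R) := unit_integral (fun t => cos (pi * (a - t)) ^+ N.*2).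

(* Wallis: integrate the derivative of cos^(2N+1) sin over a period *)
Lemma cos_momentS N a : (2 * N%:R + 2) * cos_moment N.+1 a = (2 * N%:R + 1) * cos_moment N a.
Proof.
pose f (t : R) := cos (pi * (a - t)) ^+ N.*2.+1 * sin (pi * (a - t)).
pose g (t : R) := (2 * N%:R + 1) * cos (pi * (a - t)) ^+ N.*2 +
                  (- (2 * N%:R + 2)) * cos (pi * (a - t)) ^+ N.+1.*2.
have cc M : continuous (fun t => cos (pi * (a - t)) ^+ M).
  by apply: continuous_exp; exact: continuous_cos_shift.
have cz (b : R) M : continuous (fun t => b * cos (pi * (a - t)) ^+ M).
  by move=> t; apply: cvgM; [exact: cvg_cst|exact: cc].
have cg : continuous g by move=> t; apply: cvgD; exact: cz.
have df (t : R) : is_derive t 1 f (pi * g t).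
  have -> : f = (fun t => cos (pi * (a - t))) ^+ N.*2.+1 * (fun t => sin (pi * (a - t))).
    by apply/funext => y; rewrite /f fctE/= exprfctE.
  have h := is_deriveM (is_deriveX N.*2.+1 (is_derive_cos_shift a t)) (is_derive_sin_shift a t).
  apply: (is_derive_eq h); rewrite /g /GRing.scale/= !exprfctE doubleS !exprS.
  have := sin2cos2 (pi * (a - t)); rewrite expr2 => e.
  set c := cos _ in e *; set s := sin _ in e *; set cN := c ^+ _.
  have -> : c * cN * (- pi * c) + s * (N.*2.+1%:R * cN * (pi * s)) =
     pi * (N.*2.+1%:R * cN * (s * s) - c * (c * cN)) by ring.
  rewrite e -muln2 -natr1 natrM; ring.
have h : unit_integral (fun t => pi * g t) = f 1 - f 0.
  by apply: unit_integral_derive => // t; apply: cvgM; [exact: cvg_cst|exact: cg].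
have f10 : f 1 = f 0.
  rewrite /f (_ : pi * (a - 0) = pi * (a - 1) + pi); last by ring.
  by rewrite sinDpi cosDpi exprS [in RHS]exprS -muln2 mulnC exprM [in RHS]exprM sqrrN; ring.
move: h; rewrite f10 subrr unit_integralZ// /g unit_integralD//.
rewrite !unit_integralZ// -!/(cos_moment _ a) => /eqP.
by rewrite mulf_eq0 gt_eqF ?pi_gt0//= mulNr subr_eq0 => /eqP.
Qed.

(** By the recursion, whose coefficients do not involve [a], starting from the common value 1 at N =
    0. *)
Lemma cos_moment_shift N a : cos_moment N a = cos_moment N 0.
Proof.
elim: N => [|N IH].
  by congr unit_integral; apply/funext => t; rewrite !expr0.
apply: (@mulfI _ (2 * N%:R + 2)); last by rewrite !cos_momentS IH.
by rewrite gt_eqF// ltr_wpDl// mulr_ge0.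
Qed.

Lemma cos_moment_gt0 N a : 0 < cos_moment N a.
Proof.
elim: N => [|N IH].
  rewrite /cos_moment (_ : (fun _ => _) = cst 1) ?unit_integral_cst//.
have h : 0 < (2 * N%:R + 2 : R) by rewrite ltr_wpDl// mulr_ge0.
rewrite -(pmulr_rgt0 _ h) cos_momentS mulr_gt0// ltr_wpDl// mulr_ge0//.
Qed.

Lemma bounded_lip_cos_shift (a : R) : bounded_lip (pi : R) (fun t : R => cos (pi * (a - t))).
Proof.
have p2 := pi_ge2 R.
split=> [t|s t]; first by apply: le_trans (cos_max _) _; lra.
apply: le_trans (cos_sub_le _ _) _.
rewrite (_ : _ - _ = pi * (t - s)); last by ring.
by rewrite normrM gtr0_norm ?pi_gt0// distrC.
Qed.

Definition bl1 (h : R -> R) := exists C, bounded_lip C h.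

Lemma bl1_cos N a b : bl1 (fun t : R => b * cos (pi * (a - t)) ^+ N).
Proof.
suff [C h] : bl1 (fun t : R => cos (pi * (a - t)) ^+ N).
  by eexists; exact: bounded_lipZ h.
elim: N => [|N [C h]]; first by exists `|1|; exact: bounded_lip_cst.
exists (2 * (pi * C)).
have -> : (fun t : R => cos (pi * (a - t)) ^+ N.+1) =
  (fun t => cos (pi * (a - t)) * cos (pi * (a - t)) ^+ N).
  by apply/funext => t; rewrite exprS.
exact: bounded_lipM (bounded_lip_cos_shift a) h.
Qed.

Lemma bl_coord n (j : 'I_n) (h : R -> R) : bl1 h -> bl (fun u : 'rV[R]_n => h (u 0 j)).
Proof.
move=> [C bl]; exists C; have C0 := bounded_lip_ge0 bl; case: bl => b l.
split=> [x|x y]; first exact: b.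
apply: le_trans (l _ _) _; rewrite ler_wpM2l//.
by have := coord_norm_le (x - y) j; rewrite !mxE.
Qed.

Lemma bl_prod n (I : Type) (r : seq I) (F : I -> 'rV[R]_n -> R) :
  (forall i, bl (F i)) -> bl (fun u => \prod_(i <- r) F i u).
Proof.
move=> h; elim: r => [|i r IH].
  rewrite (_ : (fun _ => _) = cst 1); first exact: bl_cst.
  by apply/funext => u; rewrite big_nil.
have := blM (h i) IH; congr bl; apply/funext => u.
by rewrite big_cons.
Qed.

Lemma cube_integral_prod n (h : 'I_n -> R -> R) : (forall i, bl1 (h i)) ->
  cube_integral (fun u : 'rV[R]_n => \prod_i h i (u 0 i)) = \prod_i unit_integral (h i).
Proof.
elim: n h => [|m IH] h hb; first by rewrite /= !big_ord0.
rewrite big_ord_recl /= mulrC -/(unit_integral _).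
have [C b0] := hb ord0; rewrite -unit_integralZ; last exact: bounded_lip_continuous b0.
congr unit_integral; apply/funext => t.
rewrite mulrC -(IH (fun i => h (lift ord0 i))) => [|i]; last exact: hb.
rewrite -cube_integralZ; last by apply: bl_prod => i; exact: bl_coord.
congr cube_integral; apply/funext => u; rewrite big_ord_recl; congr (h _ _ * _).
  have -> : @ord0 m = lshift m (@ord0 0) by exact/val_inj.
  by rewrite (row_mxEl (t%:M : 'rV_1)) mxE eqxx.
apply: eq_bigr => i _; have -> : lift ord0 i = rshift 1 i by exact/val_inj.
by rewrite (row_mxEr (t%:M : 'rV_1)).
Qed.

(** Product of normalised de la Vallee Poussin kernels: nonnegative, of integral 1, periodic, and
    concentrating at the integer points as N grows. *)
Definition kernel n N (s : 'rV[R]_n) : R :=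
  \prod_i ((cos_moment N 0)^-1 * cos (pi * s 0 i) ^+ N.*2).

Lemma kernel_ge0 n N (s : 'rV[R]_n) : 0 <= kernel N s.
Proof.
apply: prodr_ge0 => i _; apply: mulr_ge0.
  by rewrite invr_ge0 ltW// cos_moment_gt0.
by rewrite -muln2 exprM sqr_ge0.
Qed.

Lemma bl_kernel n N (x : 'rV[R]_n) : bl (fun u => kernel N (x - u)).
Proof.
rewrite /kernel; apply: bl_prod => i.
have := bl_coord i (bl1_cos N.*2 (x 0 i) (cos_moment N 0)^-1).
by congr bl; apply/funext => u; rewrite !mxE.
Qed.

Lemma kernel_integral n N (x : 'rV[R]_n) : cube_integral (fun u => kernel N (x - u)) = 1.
Proof.
pose h i (t : R) := (cos_moment N 0)^-1 * cos (pi * (x 0 i - t)) ^+ N.*2.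
have -> : (fun u => kernel N (x - u)) = (fun u => \prod_i h i (u 0 i)).
  by apply/funext => u; apply: eq_bigr => i _; rewrite /h !mxE.
rewrite cube_integral_prod => [|i]; last exact: bl1_cos.
apply: big1 => i _; rewrite /h unit_integralZ; last first.
  by apply: continuous_exp; exact: continuous_cos_shift.
by rewrite -/(cos_moment _ _) cos_moment_shift mulVf// gt_eqF// cos_moment_gt0.
Qed.

(** Replacing sin^2 by 1 - cos^2 raises one exponent from 2N to 2N + 2, so the value is 1 minus the
    ratio (2N + 1)/(2N + 2) of consecutive moments. It measures how fast the kernel concentrates. *)
Lemma kernel_sin2 n N (x : 'rV[R]_n) j :
  bl (fun u : 'rV[R]_n => sin (pi * (x 0 j - u 0 j)) ^+ 2 * kernel N (x - u)) /\
  cube_integral (fun u : 'rV[R]_n => sin (pi * (x 0 j - u 0 j)) ^+ 2 * kernel N (x - u)) =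
  (2 * N%:R + 2)^-1.
Proof.
pose h M i (t : R) := (cos_moment N 0)^-1 * cos (pi * (x 0 i - t)) ^+ M.*2.
pose h' (i : 'I_n) : R -> R := if i == j then h N.+1 i else h N i.
have hb M i : bl1 (h M i) by exact: bl1_cos.
have h'b (i : 'I_n) : bl1 (h' i) by rewrite /h'; case: ifP.
have e (u : 'rV[R]_n) : sin (pi * (x 0 j - u 0 j)) ^+ 2 * kernel N (x - u) =
    kernel N (x - u) + -1 * \prod_i h' i (u 0 i).
  have -> : kernel N (x - u) = \prod_i h N i (u 0 i).
    by apply: eq_bigr => i _; rewrite /h !mxE.
  rewrite (bigD1 j)//= [X in _ = _ + -1 * X](bigD1 j)//=.
  rewrite [X in _ = _ + -1 * (_ * X)](eq_bigr (fun i => h N i (u 0 i))); last first.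
    by move=> i /negPf ij; rewrite /h' ij.
  by rewrite /h' eqxx /h sin2cos2 doubleS !exprS; ring.
have bl1' := bl_kernel N x.
have bl2' : bl (fun u : 'rV[R]_n => -1 * \prod_i h' i (u 0 i)).
  by apply: blZ; apply: bl_prod => i; exact: bl_coord.
have -> : (fun u : 'rV[R]_n => sin (pi * (x 0 j - u 0 j)) ^+ 2 * kernel N (x - u)) =
    (fun u => kernel N (x - u) + -1 * \prod_i h' i (u 0 i)) by apply/funext.
split; first exact: blD.
rewrite cube_integralD// cube_integralZ; last by apply: bl_prod => i; exact: bl_coord.
rewrite kernel_integral cube_integral_prod// (bigD1 j)//= big1 => [|i /negPf ij]; last first.
  rewrite /h' ij /h unit_integralZ; last by apply: continuous_exp; exact: continuous_cos_shift.
  by rewrite -/(cos_moment _ _) cos_moment_shift mulVf// gt_eqF// cos_moment_gt0.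
rewrite /h' eqxx /h unit_integralZ; last by apply: continuous_exp; exact: continuous_cos_shift.
rewrite -/(cos_moment N.+1 _) cos_moment_shift.
have N0 : 0 <= N%:R :> R by [].
have c0 := cos_moment_gt0 N 0; have e' := cos_momentS N 0.
have -> : cos_moment N.+1 0 = (2 * N%:R + 1) / (2 * N%:R + 2) * cos_moment N 0.
  by rewrite mulrAC -e' mulrAC divff ?mul1r// gt_eqF//; lra.
by field; rewrite !gt_eqF//; lra.
Qed.

(* Nonnegative combinations of the characters cos (2 pi <k, .>). The weights  *)
(* are written |.| so that no side condition is needed.                       *)
Definition character_sum n (K : 'rV[R]_n -> R) :=
  exists s : seq (R * 'rV[int]_n), forall x,
    K x = \sum_(p <- s) `|p.1| * cos (2 * pi * dotp (map_mx intr p.2) x).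

Lemma character_sumM n (K L : 'rV[R]_n -> R) : character_sum K -> character_sum L ->
  character_sum (fun x => K x * L x).
Proof.
move=> [s hs] [t ht].
exists ([seq (p.1 * q.1 / 2, p.2 + q.2) | p <- s, q <- t] ++
        [seq (p.1 * q.1 / 2, p.2 - q.2) | p <- s, q <- t]) => x.
rewrite hs ht big_cat /= !big_allpairs_dep /= -big_split /= mulr_suml; apply: eq_bigr => p _.
rewrite -big_split mulr_sumr; apply: eq_bigr => q _ /=.
rewrite raddfD raddfB dotpDl dotpDl dotpNl !mulrDr mulrN cosD cosB.
by rewrite !normrM [`|2^-1|]ger0_norm//; field.
Qed.

Lemma character_sumZ n (K : 'rV[R]_n -> R) c : 0 <= c -> character_sum K ->
  character_sum (fun x => c * K x).
Proof.
move=> c0 [s hs]; exists [seq (c * p.1, p.2) | p <- s] => x.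
rewrite hs mulr_sumr big_map; apply: eq_bigr => p _ /=.
by rewrite normrM (ger0_norm c0) mulrA.
Qed.

Lemma character_sum_cst1 n : character_sum (fun _ : 'rV[R]_n => 1).
Proof.
exists [:: (1, 0)] => x; rewrite big_seq1 raddf0 dotp0l mulr0 cos0 normr1 mulr1//.
Qed.

(** Only even powers occur, and cos^2 (pi t) = (1 + cos (2 pi t))/2 has integer frequencies and
    nonnegative coefficients; products preserve both. *)
Lemma character_sum_kernel n N : character_sum (@kernel n N).
Proof.
have prodC (I : Type) (r : seq I) (F : I -> 'rV[R]_n -> R) :
    (forall i, character_sum (F i)) -> character_sum (fun x => \prod_(i <- r) F i x).
  move=> h; elim: r => [|i r IH].
    have := character_sum_cst1 n; congr character_sum; apply/funext => x.
    by rewrite big_nil.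
  have := character_sumM (h i) IH; congr character_sum; apply/funext => x.
  by rewrite big_cons.
apply: (prodC _ _ (fun i s => (cos_moment N 0)^-1 * cos (pi * s 0 i) ^+ N.*2)) => i.
apply: character_sumZ; first by rewrite invr_ge0 ltW// cos_moment_gt0.
have c1 : character_sum (fun x : 'rV[R]_n => cos (pi * x 0 i) ^+ 2).
  exists [:: (2^-1, 0); (2^-1, delta_mx 0 i)] => x.
  rewrite big_cons big_seq1 /= raddf0 dotp0l mulr0 cos0 map_delta_mx.
  rewrite [`|2^-1|]ger0_norm// (_ : dotp (delta_mx 0 i) x = x 0 i); last first.
    by rewrite /dotp -rowE !mxE.
  rewrite (_ : 2 * pi * x 0 i = (pi * x 0 i) *+ 2); last by ring.
  by rewrite cos_mulr2n; field.
have := prodC _ (nseq N tt) (fun _ x => cos (pi * x 0 i) ^+ 2) (fun=> c1).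
congr character_sum; apply/funext => x.
by rewrite big_const_seq count_predT size_nseq iter_mulr_1 -exprM mul2n.
Qed.

End Kernel.

Section Approximation.
Variable R : realType.

Lemma bl_sum n (I : Type) (r : seq I) (F : I -> 'rV[R]_n -> R) :
  (forall i, bl (F i)) -> bl (fun u => \sum_(i <- r) F i u).
Proof.
move=> h; elim: r => [|i r IH].
  have := bl_cst n (0 : R); congr bl; apply/funext => u.
  by rewrite big_nil.
have := blD (h i) IH; congr bl; apply/funext => u.
by rewrite big_cons.
Qed.

Lemma cube_integral_sum n (I : Type) (r : seq I) (F : I -> 'rV[R]_n -> R) :
  (forall i, bl (F i)) -> cube_integral (fun u => \sum_(i <- r) F i u) =
  \sum_(i <- r) cube_integral (F i).
Proof.
move=> h; elim: r => [|i r IH].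
  rewrite big_nil -[RHS](cube_integral_cst n); congr cube_integral.
  by apply/funext => u; rewrite big_nil.
rewrite big_cons -IH -cube_integralD//; last exact: bl_sum.
by congr cube_integral; apply/funext => u; rewrite big_cons.
Qed.

Lemma cube_integral_norm_le2 n (g h : 'rV[R]_n -> R) : bl g -> bl h ->
  (forall x, `|g x| <= h x) -> `|cube_integral g| <= cube_integral h.
Proof.
move=> bg bh gh; rewrite ler_norml -mulN1r -cube_integralZ//.
apply/andP; split; apply: le_cube_integral => //; try exact: blZ.
  by move=> x; have := gh x; rewrite ler_norml mulN1r => /andP[].
by move=> x; have := gh x; rewrite ler_norml => /andP[].
Qed.

(** Before the Lipschitz bound is applied, [u] is moved by the integer vector nearest to [x - u];
    the max norm is at most the sum over the coordinates. *)
Lemma periodic_sin_lip n L (phi : 'rV[R]_n -> R) : smooth_periodic 1%:M phi ->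
  bounded_lip L phi -> forall x u,
  `|phi u - phi x| <= 2 * L * \sum_j `|sin (pi * (x 0 j - u 0 j))|.
Proof.
move=> sp b x u; have L0 := bounded_lip_ge0 b; case: b => _ l.
have /choice[k hk] : forall j, exists k : int,
   `|x 0 j - u 0 j - k%:~R| <= 2 * `|sin (pi * (x 0 j - u 0 j))|.
  by move=> j; exact: near_int.
rewrite -(sp.2 u (\row_j k j)) trmx1 mulmx1.
apply: le_trans (l _ _) _; rewrite [2 * L]mulrC -mulrA ler_wpM2l//.
rewrite [leLHS]mx_normrE; apply/bigmax_leP; split=> [|[i j] _ /=].
  by rewrite mulr_ge0// sumr_ge0.
rewrite !mxE ord1 distrC opprD addrA mulr_sumr.
by apply: le_trans (hk j) _; rewrite (bigD1 j)//= lerDl sumr_ge0.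
Qed.

Lemma kernel_approx n (L eps : R) : 0 < eps -> exists N,
  forall (phi : 'rV[R]_n -> R) x, smooth_periodic 1%:M phi -> bounded_lip L phi ->
  `|phi x - cube_integral (fun u => phi u * kernel N (x - u))| <= eps.
Proof.
move=> eps0; have n0 : 0 <= n%:R :> R by [].
have [L0|L0] := ltP L 0.
  by exists 0%N => phi x _ /bounded_lip_ge0; rewrite leNgt L0.
have a0 : 0 <= L * n%:R by exact: mulr_ge0.
have [a aE] : {a | a = L * n%:R} by exists (L * n%:R).
(* With a = L n the error will be a d + (a/d)/(2N + 2). This [d] makes the first term at most eps/2,
   and N > a/(d eps) does the same for the second. *)
have [d [d0 e]] : exists d, 0 < d /\ d * (2 * a + 1) = eps.
  exists (eps / (2 * a + 1)); split; first by rewrite divr_gt0//; lra.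
  by field; rewrite gt_eqF//; lra.
rewrite -aE in a0.
pose N := Num.bound (a / (d * eps)).
have hN : a / (d * eps) < N%:R.
  by rewrite /N; apply: archi_boundP; rewrite divr_ge0// mulr_ge0// ltW.
exists N => phi x sp b.
have bphi : bl phi by exists L.
have bK := bl_kernel N x.
(* Since 2 |s| <= d + s^2/d, the bound of [periodic_sin_lip] can be replaced by one that is
   quadratic in the sines and is integrated by [kernel_sin2]. *)
pose h (u : 'rV[R]_n) := \sum_j (L * d * kernel N (x - u) +
   L / d * (sin (pi * (x 0 j - u 0 j)) ^+ 2 * kernel N (x - u))).
have bj j : bl (fun u : 'rV[R]_n => L * d * kernel N (x - u) +
   L / d * (sin (pi * (x 0 j - u 0 j)) ^+ 2 * kernel N (x - u))).
  by apply: blD; apply: blZ => //; exact: (kernel_sin2 N x j).1.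
have bh : bl h by apply: bl_sum.
rewrite -[phi x in X in X <= _]mulr1 -(kernel_integral N x) -cube_integralZ//.
rewrite -mulN1r -cube_integralZ; last exact: blM.
rewrite -cube_integralD; [|exact: blZ|by apply: blZ; exact: blM].
have E u : phi x * kernel N (x - u) + -1 * (phi u * kernel N (x - u)) =
  - ((phi u - phi x) * kernel N (x - u)) by ring.
apply: (@le_trans _ _ (cube_integral h)).
  apply: cube_integral_norm_le2 => //.
    by apply: blD; apply: blZ => //; exact: blM.
  move=> u; rewrite E normrN normrM (ger0_norm (kernel_ge0 _ _)).
  have K0 := kernel_ge0 N (x - u).
  apply: le_trans (ler_wpM2r K0 (periodic_sin_lip sp b x u)) _.
  rewrite mulr_sumr mulr_suml /h; apply: ler_sum => j _.
  set s := sin _; set K := kernel N _ in K0 *.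
  rewrite (_ : L * d * K + _ = (L * d + L / d * s ^+ 2) * K); last by ring.
  rewrite ler_wpM2r// -[s ^+ 2]real_normK ?num_real//.
  move: (normr_ge0 s); set t := `|s| => t0.
  have -> : L * d + L / d * t ^+ 2 = L * (d ^+ 2 + t ^+ 2) / d by field; rewrite gt_eqF.
  rewrite ler_pdivlMr//; have : 0 <= L * (d - t) ^+ 2 by rewrite mulr_ge0 ?sqr_ge0.
  by lra.
rewrite /h cube_integral_sum//.
rewrite (eq_bigr (fun=> L * d + L / d * (2 * N%:R + 2)^-1)) => [|j _]; last first.
  rewrite cube_integralD; [|exact: blZ|by apply: blZ; exact: (kernel_sin2 N x j).1].
  rewrite cube_integralZ// cube_integralZ; last exact: (kernel_sin2 N x j).1.
  by rewrite kernel_integral (kernel_sin2 N x j).2 mulr1.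
rewrite sumr_const card_ord -[_ *+ n]mulr_natr.
have -> : (L * d + L / d * (2 * N%:R + 2)^-1) * n%:R = a * d + a / d / (2 * N%:R + 2).
  by rewrite aE; ring.
have N0 : 0 <= N%:R :> R by [].
have h1 : a * d <= eps / 2.
  by lra.
have h2 : a / d / (2 * N%:R + 2) <= eps / 2.
  rewrite ler_pdivrMr; last by lra.
  move: hN; rewrite ltr_pdivrMr ?mulr_gt0// => hN.
  rewrite ler_pdivrMr//.
  have : 0 <= d * eps by rewrite mulr_ge0 ?ltW.
  by lra.
by lra.
Qed.

End Approximation.

(* These constants, and dd below, are sealed: failing unification problems     *)
(* would otherwise unfold them down to limits and integrals.                   *)
HB.lock Definition avg (R : realType) n (V : 'M[R]_n) (phi : 'rV[R]_n -> R) : R :=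
  cube_integral (fun u => phi (u *m V^T)).

HB.lock Definition freq (R : realType) n (V : 'M[R]_n) (l : 'rV[int]_n) : 'rV[R]_n :=
  (2 * pi) *: (map_mx intr l *m invmx V).

HB.lock Definition cos_coef (R : realType) n (V : 'M[R]_n) l (phi : 'rV[R]_n -> R) :=
  avg V (fun x => phi x * cos (dotp (freq V l) x)).

HB.lock Definition sin_coef (R : realType) n (V : 'M[R]_n) l (phi : 'rV[R]_n -> R) :=
  avg V (fun x => phi x * sin (dotp (freq V l) x)).

(** * Means and Fourier coefficients on the torus *)

Section Average.
Variables (R : realType) (n : nat) (V : 'M[R]_n).
Hypothesis hV : V \in unitmx.
Implicit Types phi psi : 'rV[R]_n -> R.
Local Notation spV := (smooth_periodic V).
Local Notation avg := (avg V).
Local Notation freq := (freq V).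
Local Notation cos_coef := (cos_coef V).
Local Notation sin_coef := (sin_coef V).

Lemma dotp_freq l u : dotp (freq l) (u *m V^T) = 2 * pi * dotp (map_mx intr l) u.
Proof. by rewrite freq.unlock dotpZl dotpC dotp_mulmx trmxK dotpC -mulmxA /dotp mulmxA mulmxKV// mulmxA. Qed.

Lemma freq_lattice l (k : 'rV[int]_n) :
  dotp (freq l) (map_mx intr k *m V^T) = 2 * pi * (\sum_j l 0 j * k 0 j)%:~R.
Proof.
rewrite dotp_freq dotp_sum rmorph_sum; congr (_ * _); apply: eq_bigr => j _.
by rewrite !mxE rmorphM.
Qed.

Lemma smooth_periodic_cos l : spV (fun x => cos (dotp (freq l) x)).
Proof.
split=> [|x k]; first exact: (smooth_cos_sin _).1.
by rewrite dotpDr freq_lattice cosDint.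
Qed.

Lemma smooth_periodic_sin l : spV (fun x => sin (dotp (freq l) x)).
Proof.
split=> [|x k]; first exact: (smooth_cos_sin _).2.
by rewrite dotpDr freq_lattice sinDint.
Qed.

Lemma smooth_periodicD phi psi : spV phi -> spV psi ->
  spV (fun x => phi x + psi x).
Proof.
by move=> [s p] [s' p']; split=> [|x k]; [exact: smoothD|rewrite p p'].
Qed.

Lemma smooth_periodicM phi psi : spV phi -> spV psi ->
  spV (fun x => phi x * psi x).
Proof.
by move=> [s p] [s' p']; split=> [|x k]; [exact: smoothM|rewrite p p'].
Qed.

Lemma smooth_periodic_cst a : spV (fun=> a).
Proof. by split=> // ; exact: smooth_cst. Qed.

Lemma smooth_periodicZ a phi : spV phi ->
  spV (fun x => a * phi x).
Proof. by apply: smooth_periodicM; exact: smooth_periodic_cst. Qed.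

Lemma smooth_periodicN phi : spV phi -> spV (fun x => - phi x).
Proof. by move=> [s p]; split=> [|x k]; [exact: smoothN|rewrite p]. Qed.

Lemma smooth_periodicB phi psi : spV phi -> spV psi ->
  spV (fun x => phi x - psi x).
Proof. by move=> p q; apply: smooth_periodicD => //; exact: smooth_periodicN. Qed.

Lemma smooth_periodic_sum I (r : seq I) (F : I -> 'rV[R]_n -> R) :
  (forall i, spV (F i)) -> spV (fun x => \sum_(i <- r) F i x).
Proof.
move=> h; split=> [|x k]; first by apply: smooth_sum => i; exact: (h i).1.
by apply: eq_bigr => i _; exact: (h i).2.
Qed.

Lemma smooth_periodicX phi m : spV phi ->
  spV (fun x => phi x ^+ m).
Proof. by move=> [s p]; split=> [|x k]; [exact: smoothX|rewrite p]. Qed.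

Lemma smooth_periodic_pull phi : spV phi ->
  smooth_periodic 1%:M (fun u => phi (u *m V^T)).
Proof.
move=> [s p]; split=> [|u k]; last by rewrite mulmxDl trmx1 mulmx1 p.
by have := smooth_affine V^T 0 s; apply: smooth_ext => u; rewrite addr0.
Qed.

Lemma bl_pull phi : spV phi -> bl (fun u => phi (u *m V^T)).
Proof. by move=> sp; apply/smooth_periodic_bl/smooth_periodic_pull. Qed.

Lemma avgD phi psi : spV phi -> spV psi ->
  avg (fun x => phi x + psi x) = avg phi + avg psi.
Proof. by rewrite avg.unlock => p q; apply: (cube_integralD (bl_pull p) (bl_pull q)). Qed.

Lemma avgZ a phi : spV phi -> avg (fun x => a * phi x) = a * avg phi.
Proof. by rewrite avg.unlock => p; apply: (cube_integralZ _ (bl_pull p)). Qed.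

Lemma avgN phi : spV phi -> avg (fun x => - phi x) = - avg phi.
Proof.
by move=> p; rewrite -mulN1r -avgZ//; congr avg; apply/funext => x; rewrite mulN1r.
Qed.

Lemma avgB phi psi : spV phi -> spV psi ->
  avg (fun x => phi x - psi x) = avg phi - avg psi.
Proof. by move=> p q; rewrite avgD ?avgN//; exact: smooth_periodicN. Qed.

Lemma avg_cst a : avg (fun=> a) = a.
Proof. by rewrite avg.unlock; exact: cube_integral_cst. Qed.

Lemma avg_sum I (r : seq I) (F : I -> 'rV[R]_n -> R) :
  (forall i, spV (F i)) ->
  avg (fun x => \sum_(i <- r) F i x) = \sum_(i <- r) avg (F i).
Proof.
rewrite avg.unlock => h; rewrite (cube_integral_sum _ (fun i => bl_pull (h i))).
by [].
Qed.

Lemma le_avg phi psi : spV phi -> spV psi ->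
  (forall x, phi x <= psi x) -> avg phi <= avg psi.
Proof. by rewrite avg.unlock => p q h; apply: (le_cube_integral (bl_pull p) (bl_pull q)). Qed.

Lemma avg_norm_le D phi : spV phi -> (forall x, `|phi x| <= D) ->
  `|avg phi| <= D.
Proof. by rewrite avg.unlock => p h; apply: (cube_integral_norm_le (bl_pull p)). Qed.

Lemma avg_derive phi v : spV phi -> avg (fun x => 'D_v phi x) = 0.
Proof.
move=> sp; rewrite avg.unlock -[RHS](cube_integral_derive (v *m invmx V^T) (smooth_periodic_pull sp)).
congr cube_integral; apply/funext => u.
have -> : (fun u => phi (u *m V^T)) = (fun u => phi (u *m V^T + 0)).
  by apply/funext => w; rewrite addr0.
by rewrite derive_affine addr0 mulmxKV// unitmx_tr.
Qed.

(** Convolution with the kernel multiplies the modes by the nonnegative weights |p.1|. The list [s]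
    depends only on [L] and [eps], hence can be shared by several functions. *)
Theorem fourier_approx (L eps : R) : 0 < eps ->
  exists s : seq (R * 'rV[int]_n), forall phi x,
  spV phi -> bounded_lip L (fun u => phi (u *m V^T)) ->
  `|phi x - \sum_(p <- s) `|p.1| * (cos_coef p.2 phi * cos (dotp (freq p.2) x) +
     sin_coef p.2 phi * sin (dotp (freq p.2) x))| <= eps.
Proof.
move=> e0; have [N hN] := kernel_approx n L e0.
have [s hs] := character_sum_kernel R n N; exists s => phi x sp b.
have := hN _ (x *m invmx V^T) (smooth_periodic_pull sp) b.
under eq_bigr do rewrite cos_coef.unlock sin_coef.unlock avg.unlock.
rewrite mulmxKV ?unitmx_tr//; apply: le_trans; rewrite le_eqVlt; apply/orP; left.
apply/eqP; congr (`|_ - _|).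
have bc l := bl_pull (smooth_periodicM sp (smooth_periodic_cos l)).
have bs l := bl_pull (smooth_periodicM sp (smooth_periodic_sin l)).
have -> : (fun u => phi (u *m V^T) * kernel N (x *m invmx V^T - u)) =
  (fun u => \sum_(p <- s) (`|p.1| * cos (dotp (freq p.2) x) *
      (phi (u *m V^T) * cos (dotp (freq p.2) (u *m V^T))) +
     `|p.1| * sin (dotp (freq p.2) x) *
      (phi (u *m V^T) * sin (dotp (freq p.2) (u *m V^T))))).
  apply/funext => u; rewrite hs mulr_sumr; apply: eq_bigr => p _.
  rewrite -dotp_freq mulmxBl mulmxKV ?unitmx_tr// dotpDr dotpNr cosB; ring.
rewrite cube_integral_sum => [|p]; last by apply: blD; exact: blZ.
apply: eq_bigr => p _; rewrite cube_integralD; [|exact: blZ|exact: blZ].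
rewrite !cube_integralZ// mulrDr; congr (_ + _); rewrite -mulrA; congr (_ * _);
  by rewrite mulrC.
Qed.

Lemma fourier_unique phi : spV phi ->
  (forall l, cos_coef l phi = 0 /\ sin_coef l phi = 0) -> forall x, phi x = 0.
Proof.
move=> sp h x; have [L b] := bl_pull sp; apply/eqP; rewrite -normr_le0.
apply/ler_addgt0Pr => e e0; rewrite add0r.
have [s /(_ _ x sp b)] := fourier_approx L e0.
by rewrite big1 ?subr0// => p _; case: (h p.2) => -> ->; rewrite !mul0r addr0 mulr0.
Qed.

(** A nonnegative function dominates its products with cos and sin in absolute value, so a vanishing
    mean kills all Fourier coefficients, and uniqueness applies. *)
Lemma avg_eq0 phi : spV phi -> (forall x, 0 <= phi x) -> avg phi = 0 ->
  forall x, phi x = 0.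
Proof.
move=> sp p0 a0; apply: fourier_unique => // l; rewrite cos_coef.unlock sin_coef.unlock.
have sc := smooth_periodicM sp (smooth_periodic_cos l).
have ss := smooth_periodicM sp (smooth_periodic_sin l).
have sN := smooth_periodicN sp.
have aN : avg (fun x => - phi x) = 0 by rewrite avgN// a0 oppr0.
split; apply/eqP; rewrite eq_le -{1}a0 -{1}aN; apply/andP; split;
  apply: le_avg => // x; have := p0 x.
- by have := cos_le1 (dotp (freq l) x); nra.
- by have := cos_geN1 (dotp (freq l) x); nra.
- by have := sin_le1 (dotp (freq l) x); nra.
- by have := sin_geN1 (dotp (freq l) x); nra.
Qed.

Lemma cos_coefB l phi psi : spV phi -> spV psi ->
  cos_coef l (fun x => phi x - psi x) = cos_coef l phi - cos_coef l psi.
Proof.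
move=> p q; have c := smooth_periodic_cos l.
rewrite cos_coef.unlock -avgB; [|exact: smooth_periodicM..].
by congr avg; apply/funext => x; rewrite mulrBl.
Qed.

Lemma sin_coefB l phi psi : spV phi -> spV psi ->
  sin_coef l (fun x => phi x - psi x) = sin_coef l phi - sin_coef l psi.
Proof.
move=> p q; have c := smooth_periodic_sin l.
rewrite sin_coef.unlock -avgB; [|exact: smooth_periodicM..].
by congr avg; apply/funext => x; rewrite mulrBl.
Qed.

End Average.

HB.lock Definition dd (R : realType) n (v : 'rV[R]_n) (phi : 'rV[R]_n -> R) : 'rV[R]_n -> R :=
  fun x => 'D_v phi x.

Section DirectionalDerivative.
Variables (R : realType) (n : nat).
Implicit Types (phi psi : 'rV[R]_n -> R) (v w x : 'rV[R]_n).

Lemma ddE v phi : dd v phi = (fun x => 'D_v phi x).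
Proof. by rewrite dd.unlock. Qed.

Lemma smooth_dd v phi : smooth phi -> smooth (dd v phi).
Proof. by rewrite ddE; exact: smooth_derive. Qed.

Lemma dd_cst v (a : R) x : dd v (fun=> a) x = 0.
Proof. by rewrite ddE derive_cst. Qed.

Lemma ddD v phi psi x : smooth phi -> smooth psi ->
  dd v (fun y => phi y + psi y) x = dd v phi x + dd v psi x.
Proof. by move=> p q; rewrite !ddE derive_addf//; exact: smooth_differentiable. Qed.

Lemma ddN v phi x : smooth phi -> dd v (fun y => - phi y) x = - dd v phi x.
Proof. by move=> p; rewrite !ddE derive_oppf//; exact: smooth_differentiable. Qed.

Lemma ddB v phi psi x : smooth phi -> smooth psi ->
  dd v (fun y => phi y - psi y) x = dd v phi x - dd v psi x.
Proof. by move=> p q; rewrite ddD ?ddN//; exact: smoothN. Qed.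

Lemma ddM v phi psi x : smooth phi -> smooth psi ->
  dd v (fun y => phi y * psi y) x = dd v phi x * psi x + phi x * dd v psi x.
Proof. by move=> p q; rewrite !ddE derive_mulf//; exact: smooth_differentiable. Qed.

Lemma ddZ v a phi x : smooth phi -> dd v (fun y => a * phi y) x = a * dd v phi x.
Proof. by move=> p; rewrite !ddE derive_scalef//; exact: smooth_differentiable. Qed.

Lemma ddV v phi x : (forall y, phi y != 0) -> smooth phi ->
  dd v (fun y => (phi y)^-1) x = - (dd v phi x * ((phi x)^-1 * (phi x)^-1)).
Proof. by move=> nz p; rewrite !ddE derive_invf//; exact: smooth_differentiable. Qed.

Lemma dd_sum v I (r : seq I) (F : I -> 'rV[R]_n -> R) x : (forall i, smooth (F i)) ->
  dd v (fun y => \sum_(i <- r) F i y) x = \sum_(i <- r) dd v (F i) x.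
Proof. by move=> h; rewrite ddE derive_sumf//; apply: eq_bigr => i _; rewrite ddE. Qed.

Lemma ddX v phi m x : smooth phi ->
  dd v (fun y => phi y ^+ m.+1) x = m.+1%:R * phi x ^+ m * dd v phi x.
Proof.
move=> p; elim: m => [|m IH].
  have -> : (fun y => phi y ^+ 1) = phi by apply/funext => y; rewrite expr1.
  by rewrite expr0 !mul1r.
have -> : (fun y => phi y ^+ m.+2) = (fun y => phi y * phi y ^+ m.+1).
  by apply/funext => y; rewrite exprS.
rewrite ddM//; last exact: smoothX.
by rewrite IH -[m.+2%:R]natr1 exprS; ring.
Qed.

Lemma dd_coord v phi x : smooth phi ->
  dd v phi x = \sum_i v 0 i * dd (delta_mx 0 i) phi x.
Proof.
move=> p; rewrite ddE derive_coord; last exact: smooth_differentiable.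
by apply: eq_bigr => i _; rewrite ddE.
Qed.

Lemma dd_cos xi v x : dd v (fun x => cos (dotp xi x)) x = - (dotp xi v * sin (dotp xi x)).
Proof. by rewrite ddE derive_cos_dotp. Qed.

Lemma dd_sin xi v x : dd v (fun x => sin (dotp xi x)) x = dotp xi v * cos (dotp xi x).
Proof. by rewrite ddE derive_sin_dotp. Qed.

Lemma dd_eq0_cst phi : smooth phi -> (forall i x, dd (delta_mx 0 i) phi x = 0) ->
  forall x, phi x = phi 0.
Proof.
move=> p h x; have [s _] := smooth_MVT 0 x p; rewrite add0r => e.
apply/eqP; rewrite -subr_eq0 e -[X in X == 0]/((fun x0 => 'D_x phi x0) (0 + s *: x)).
by rewrite -ddE dd_coord// big1// => i _; rewrite h mulr0.
Qed.

Variable V : 'M[R]_n.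
Hypothesis hV : V \in unitmx.
Local Notation sp := (smooth_periodic V).

Lemma smooth_periodic_dd v phi : smooth_periodic V phi -> smooth_periodic V (dd v phi).
Proof. by rewrite ddE; exact: smooth_periodic_derive. Qed.

Lemma avg_dd_parts v phi psi : sp phi -> sp psi ->
  avg V (fun x => dd v phi x * psi x) = - avg V (fun x => phi x * dd v psi x).
Proof.
move=> p q; have dp := smooth_periodicM (smooth_periodic_dd v p) q.
have pd := smooth_periodicM p (smooth_periodic_dd v q).
apply/eqP; rewrite -subr_eq0 opprK -(avgD dp pd).
apply/eqP; rewrite -[RHS](avg_derive hV v (smooth_periodicM p q)) -ddE.
by congr (avg V _); apply/funext => x; rewrite ddM; [|exact: p.1|exact: q.1].
Qed.

Lemma cos_coef_dd l v phi : sp phi ->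
  cos_coef V l (dd v phi) = dotp (freq V l) v * sin_coef V l phi.
Proof.
move=> p; have s := smooth_periodic_sin hV l.
rewrite cos_coef.unlock sin_coef.unlock (avg_dd_parts v p (smooth_periodic_cos hV l)).
have h := smooth_periodicM p s; rewrite -(avgZ _ h) -(avgN (smooth_periodicM p _)).
  by congr (avg V _); apply/funext => x; rewrite dd_cos; move: (phi x) (sin _) (dotp _ v) => a b d; ring.
exact/smooth_periodic_dd/smooth_periodic_cos.
Qed.

Lemma sin_coef_dd l v phi : sp phi ->
  sin_coef V l (dd v phi) = - (dotp (freq V l) v * cos_coef V l phi).
Proof.
move=> p; have c := smooth_periodic_cos hV l.
rewrite cos_coef.unlock sin_coef.unlock (avg_dd_parts v p (smooth_periodic_sin hV l)).
have h := smooth_periodicM p c; rewrite -(avgZ _ h); congr (- avg V _).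
by apply/funext => x; rewrite dd_sin; move: (phi x) (cos _) (dotp _ v) => a b d; ring.
Qed.

(* Schwarz's theorem: for periodic functions both sides have the same Fourier *)
(* coefficients.                                                              *)
Lemma ddC v w phi x : sp phi -> dd v (dd w phi) x = dd w (dd v phi) x.
Proof.
move=> p; have sD u := smooth_periodic_dd u p.
have sDD u u' := smooth_periodic_dd u' (sD u).
apply/eqP; rewrite -subr_eq0; apply/eqP.
apply: (fourier_unique hV (smooth_periodicB (sDD w v) (sDD v w))) => l.
rewrite (cos_coefB hV l (sDD w v) (sDD v w)) (sin_coefB hV l (sDD w v) (sDD v w)).
rewrite (cos_coef_dd l v (sD w)) (cos_coef_dd l w (sD v)).
rewrite (sin_coef_dd l v (sD w)) (sin_coef_dd l w (sD v)).
rewrite (cos_coef_dd l v p) (cos_coef_dd l w p) (sin_coef_dd l v p) (sin_coef_dd l w p).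
by move: (cos_coef V l phi) (sin_coef V l phi) => a b; split; ring.
Qed.

End DirectionalDerivative.

(** * Successive minima of the dual lattice *)

Section DualLattice.
Variables (R : realType) (n : nat) (V : 'M[R]_n).
Hypothesis hV : V \in unitmx.

Definition dual (l : 'rV[int]_n) : 'rV[R]_n := map_mx intr l *m invmx V.

(** The dual lattice is discrete: [l] is recovered as [dual l *m V], so a bound on the length bounds
    the integer entries of [l], and the minimum is taken over finitely many candidates. *)
Lemma dual_min (P : pred 'rV[int]_n) l0 : P l0 ->
  exists2 l, P l & forall l', P l' -> sqnorm (dual l) <= sqnorm (dual l').
Proof.
move=> P0; pose B := sqnorm (dual l0); have B0 : 0 <= B := sqnorm_ge0 _.
(* The factor B + 1 bounds every |t| with t^2 <= B. *)
pose S := (B + 1) * \sum_i \sum_j `|V i j|.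
have S0 : 0 <= S by rewrite mulr_ge0 ?addr_ge0// sumr_ge0// => i _; rewrite sumr_ge0.
pose M := Num.bound S; have SM : S < M%:R by exact: archi_boundP.
have bound (l : 'rV[int]_n) (j : 'I_n) : sqnorm (dual l) <= B -> (`|l ord0 j| <= M)%N.
  move=> lB; rewrite -ltnS -(ltr_nat R); apply: (@le_lt_trans _ _ S); last first.
    by apply: lt_trans SM _; rewrite ltr_nat.
  have -> : (`|l ord0 j|%N)%:R = `|(dual l *m V) 0 j|.
    by rewrite /dual mulmxKV// mxE -intr_norm -abszE.
  rewrite mxE; apply: le_trans (ler_norm_sum _ _ _) _.
  rewrite /S mulr_sumr; apply: ler_sum => i _; rewrite normrM.
  apply: ler_pM => //; last by rewrite (bigD1 j)//= lerDl sumr_ge0.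
  have : dual l 0 i ^+ 2 <= B.
    apply: le_trans lB; rewrite /sqnorm dotp_sum (bigD1 i)//= -expr2 lerDl.
    by apply: sumr_ge0 => k _; rewrite -expr2 sqr_ge0.
  rewrite -[_ ^+ 2]real_normK ?num_real// => h.
  have := normr_ge0 (dual l 0 i); set t := `|_| in h *; nra.
pose c (f : {ffun 'I_n -> 'I_(M.*2.+1)}) : 'rV[int]_n := \row_j ((f j)%:Z - M%:Z).
have cP l : sqnorm (dual l) <= B -> exists f, l = c f.
  move=> lB; exists [ffun j => inord (absz (l 0 j + M%:Z))]; apply/rowP => j.
  have := bound l j lB; rewrite mxE ffunE (_ : l 0 j = l ord0 j)//.
  move: (l ord0 j) => z h.
  by rewrite inordK; lia.
have [f0 e0] := cP l0 (lexx _); rewrite e0 in P0.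
have [f Pf fmin] := @Order.TotalTheory.arg_minP _ _ _ f0 (fun f => P (c f)) (fun f => sqnorm (dual (c f))) P0.
exists (c f) => // l' Pl'.
have [lB|/ltW Bl] := leP (sqnorm (dual l')) B.
  by have [f' e'] := cP _ lB; rewrite e' in Pl' *; exact: fmin.
by apply: le_trans Bl; rewrite /B e0; exact: fmin.
Qed.

(** Component orthogonal to the rows of [Q], when these are orthonormal. *)
Definition residue k (Q : 'M[R]_(k, n)) (x : 'rV[R]_n) := x - x *m Q^T *m Q.

(* The rows of L are successive minima and Q is their Gram-Schmidt basis. *)
Record partial_minima k (L : 'M[int]_(k, n)) (Q : 'M[R]_(k, n)) : Prop := PartialMinima {
  pm_orth : Q *m Q^T = 1%:M;
  pm_span : map_mx intr L *m invmx V = map_mx intr L *m invmx V *m Q^T *m Q;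
  pm_trig : is_trig_mx (map_mx intr L *m invmx V *m Q^T);
  pm_diag : forall i, (map_mx intr L *m invmx V *m Q^T) i i != 0;
  pm_min : forall l i, dotp (dual l) (row i Q) != 0 ->
     sqnorm (dual (row i L)) <= sqnorm (dual l) }.

Lemma dotp_row (x : 'rV[R]_n) k (Q : 'M[R]_(k, n)) i : dotp x (row i Q) = (x *m Q^T) 0 i.
Proof. by rewrite dotp_sum mxE; apply: eq_bigr => j _; rewrite !mxE. Qed.

Lemma partial_minimaS k (L : 'M[int]_(k, n)) (Q : 'M[R]_(k, n)) : (k < n)%N ->
  partial_minima L Q -> exists (L' : 'M[int]_(k + 1, n)) (Q' : 'M[R]_(k + 1, n)),
  partial_minima L' Q'.
Proof.
move=> kn [orth span trig dia mn].
(* Otherwise the span of the k rows of [Q] contains the dual lattice, so Q^T Q = 1, and comparing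
   traces gives k = n. *)
have [l0 hl0] : exists l, residue Q (dual l) != 0.
  apply: contrapT => /forallNP h.
  have {}h l : residue Q (dual l) = 0 by apply/eqP; apply: contrapT => /negP; exact: h.
  have W i : row i (invmx V) = row i (invmx V) *m Q^T *m Q.
    have := h (delta_mx 0 i); rewrite /residue /dual map_delta_mx -rowE => /eqP.
    by rewrite subr_eq0 => /eqP.
  have {}W : invmx V = invmx V *m Q^T *m Q by apply/row_matrixP => i; rewrite !row_mul -W.
  have e : Q^T *m Q = 1%:M by rewrite -[LHS](mulKVmx hV) [invmx V *m _]mulmxA -W mulmxV.
  have : \tr (Q *m Q^T) = \tr (Q^T *m Q) by exact: mxtrace_mulC.
  rewrite orth e !mxtrace1 => /eqP; rewrite eqr_nat => /eqP kn'.
  by rewrite kn' ltnn in kn.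
(* The next minimum is a shortest dual vector outside the span of [Q], and [q] is its normalised
   residue. *)
have [l hl lmin] := dual_min (P := fun l => residue Q (dual l) != 0) hl0.
set xi := dual l in hl lmin *; set r := residue Q xi in hl.
have rQ : r *m Q^T = 0 by rewrite /r /residue mulmxBl -!mulmxA orth mulmx1 subrr.
have r0 : 0 < sqnorm r by rewrite sqnorm_gt0.
pose a := (Num.sqrt (sqnorm r))^-1; pose q := a *: r.
have a0 : 0 < a by rewrite invr_gt0 sqrtr_gt0.
have a2 : a ^+ 2 * sqnorm r = 1.
  by rewrite exprVn sqr_sqrtr ?ltW// mulVf// gt_eqF.
have qQ : q *m Q^T = 0 by rewrite -scalemxAl rQ scaler0.
have Qq : Q *m q^T = 0 by apply: trmx_inj; rewrite trmx_mul trmxK qQ trmx0.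
have xir : xi *m r^T = (sqnorm r)%:M.
  have -> : xi = r + xi *m Q^T *m Q by rewrite /r /residue subrK.
  rewrite mulmxDl -!mulmxA (_ : Q *m r^T = 0) ?mulmx0 ?addr0; last first.
    by apply: trmx_inj; rewrite trmx_mul trmxK rQ trmx0.
  by rewrite [LHS]mx11_scalar.
have xiq : xi *m q^T = (a * sqnorm r)%:M by rewrite linearZ/= -scalemxAr xir scale_scalar_mx.
have X'E : map_mx intr (col_mx L l) *m invmx V = col_mx (map_mx intr L *m invmx V) xi.
  by rewrite map_col_mx mul_col_mx.
have T'E : map_mx intr (col_mx L l) *m invmx V *m (col_mx Q q)^T =
    block_mx (map_mx intr L *m invmx V *m Q^T) 0 (xi *m Q^T) (a * sqnorm r)%:M.
  rewrite X'E tr_col_mx mul_col_row xiq; congr block_mx.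
  by rewrite span -!mulmxA Qq !mulmx0.
exists (col_mx L l), (col_mx Q q); split.
- rewrite tr_col_mx mul_col_row orth Qq qQ (_ : q *m q^T = 1%:M) -?scalar_mx_block//.
  rewrite /q linearZ/= -scalemxAl -scalemxAr scalerA -expr2 [_ *m _]mx11_scalar.
  by rewrite scale_scalar_mx a2.
- rewrite T'E X'E mul_block_col mul0mx addr0 -span; congr col_mx.
  by rewrite mul_scalar_mx /q scalerA mulrAC -expr2 a2 scale1r /r /residue addrC subrK.
- by rewrite T'E is_trig_block_mx// trig /= eqxx mx11_is_trig.
- rewrite T'E => i; case: (split_ordP i) => j ->; first by rewrite block_mxEul.
  by rewrite block_mxEdr mxE !ord1 eqxx mulr1n mulf_neq0// gt_eqF.
- move=> l' i; case: (split_ordP i) => j ->.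
    by rewrite !rowKu; exact: mn.
  (* A dual vector not orthogonal to [q] lies outside the span of [Q], so it competed in the choice
     of [l]. *)
  rewrite !rowKd !ord1 !row_id => h; apply: lmin; apply: contra h => /eqP h.
  have -> : dual l' = dual l' *m Q^T *m Q by apply/eqP; rewrite -subr_eq0; apply/eqP.
  by rewrite /dotp -!mulmxA Qq !mulmx0 mxE.
Qed.

Lemma successive_minima : exists (L : 'M[int]_n) (Q : 'M[R]_n), partial_minima L Q.
Proof.
suff h k : (k <= n)%N -> exists (L : 'M[int]_(k, n)) (Q : 'M[R]_(k, n)), partial_minima L Q.
  exact: h.
elim: k => [_|k IH kn].
  exists 0, 0; split; try by [apply/matrixP => -[]|case|move=> l []].
  - by apply/is_trig_mxP => -[].
have [L [Q h]] := IH (ltnW kn).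
have [L' [Q' h']] := partial_minimaS kn h.
by rewrite -addn1; exists L', Q'.
Qed.

End DualLattice.

Section Certificate.
Variables (R : realType) (n : nat) (V : 'M[R]_n).
Hypothesis hV : V \in unitmx.

Lemma prod_eq_le (I : finType) (a b : I -> R) : (forall i, 0 <= a i <= b i) ->
  0 < \prod_i a i -> \prod_i b i = \prod_i a i -> forall i, a i = b i.
Proof.
move=> h p e i; have [h0 h1] := andP (h i).
have pa : 0 <= \prod_(j | j != i) a j.
  by apply: prodr_ge0 => j _; case/andP: (h j).
have pb : \prod_(j | j != i) a j <= \prod_(j | j != i) b j.
  by apply: ler_prod => j _.
rewrite (bigD1 i)//= in p; rewrite (bigD1 i)//= [RHS](bigD1 i)//= in e.
have {}pa : 0 < \prod_(j | j != i) a j.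
  by rewrite lt_neqAle pa andbT eq_sym; apply: contraTneq p => ->; rewrite mulr0 ltxx.
by apply/eqP; rewrite eq_le h1 /= -(ler_pM2r pa) -e ler_wpM2l// (le_trans h0).
Qed.

Lemma sqnorm_orth (Q : 'M[R]_n) x : Q *m Q^T = 1%:M ->
  sqnorm x = \sum_i dotp x (row i Q) ^+ 2.
Proof.
move=> h; have h' := mulmx1C h.
rewrite /sqnorm -[X in dotp X _]mulmx1 -h' mulmxA dotp_mulmx dotp_sum.
by apply: eq_bigr => i _; rewrite expr2 !dotp_row.
Qed.

(** The chain is (det V)^-2 <= (det T)^2 = prod T_ii^2 <= prod lam_i <= (mean of lam)^n, with [T]
    the triangular matrix of the minima in the basis [Q]. The minima may fail to generate the dual
    lattice; they generate a sublattice of index |det L| >= 1, whence the first inequality. Equality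
    throughout gives index 1, a diagonal [T] and equal [lam]. *)
Lemma lattice_certificate : (0 < n)%N -> exists (Q : 'M[R]_n) (lam : 'I_n -> R),
  [/\ Q *m Q^T = 1%:M, forall i, 0 < lam i,
      forall l, \sum_i lam i * dotp (dual V l) (row i Q) ^+ 2 <= sqnorm (dual V l) ^+ 2,
      (\det V)^-1 ^+ 2 <= ((\sum_i lam i) / n%:R) ^+ n &
      ((\sum_i lam i) / n%:R) ^+ n = (\det V)^-1 ^+ 2 ->
      exists (c : R) (L : 'M[int]_n), [/\ 0 < c, forall i, lam i = c,
        (`|\det L| = 1)%N &
        (map_mx intr L *m invmx V) *m (map_mx intr L *m invmx V)^T = c%:M]].
Proof.
move=> n0; have [L [Q [orth span trig dia mn]]] := successive_minima hV.
set X := map_mx intr L *m invmx V in span trig dia; set T := X *m Q^T in span trig dia.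
pose lam i := sqnorm (row i X); exists Q, lam.
have lamE i : lam i = sqnorm (dual V (row i L)) by rewrite /lam /X row_mul /dual map_row.
have TX i j : dotp (row i X) (row j Q) = T i j by rewrite dotp_row -row_mul mxE.
have lamT i : lam i = \sum_j T i j ^+ 2.
  by rewrite /lam (sqnorm_orth _ orth); apply: eq_bigr => j _; rewrite TX.
have Tlam i : 0 <= T i i ^+ 2 <= lam i.
  rewrite sqr_ge0 lamT (bigD1 i)//= lerDl sumr_ge0// => j _; exact: sqr_ge0.
have T2 i : 0 < T i i ^+ 2 by rewrite lt_neqAle sqr_ge0 eq_sym sqrf_eq0 dia.
have lam0 i : 0 < lam i by apply: lt_le_trans (T2 i) _; case/andP: (Tlam i).
have detT : \det T = \prod_i T i i by exact: det_trig.
have pT : \prod_i T i i ^+ 2 = \det T ^+ 2 by rewrite detT -prodrXl.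
have dQ : \det Q ^+ 2 = 1.
  by rewrite expr2 -{2}(det_tr Q) -det_mulmx orth det1.
have detTX : \det T ^+ 2 = (\det L)%:~R ^+ 2 * (\det V)^-1 ^+ 2.
  by rewrite /T /X !det_mulmx det_tr det_inv det_map_mx !exprMn dQ mulr1.
have T0 : 0 < \det T ^+ 2 by rewrite -pT; apply: prodr_gt0.
have L0 : \det L != 0.
  by apply: contraTneq T0 => e; rewrite detTX e expr0n mul0r ltxx.
have V0 : 0 < (\det V)^-1 ^+ 2.
  by rewrite lt_neqAle sqr_ge0 eq_sym sqrf_eq0 invr_eq0 -unitfE -unitmxE hV.
have L1 : 1 <= (\det L)%:~R ^+ 2 :> R.
  by rewrite -[_ ^+ 2]rmorphXn ler1z; move: L0; move: (\det L) => z; rewrite expr2; lia.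
have h1 : (\det V)^-1 ^+ 2 <= \det T ^+ 2 by rewrite detTX ler_peMl// ltW.
have h2 : \det T ^+ 2 <= \prod_i lam i by rewrite -pT; apply: ler_prod => i _.
have [h3 h4] := @leif_AGM _ _ predT lam (fun i _ => ltW (lam0 i)).
rewrite card_ord in h3 h4.
have {}h3 : \prod_i lam i <= ((\sum_i lam i) / n%:R) ^+ n by exact: h3.
have {}h4 : (\prod_i lam i == ((\sum_i lam i) / n%:R) ^+ n) =
  [forall i in predT, forall j in predT, lam i == lam j] by exact: h4.
split=> //.
- move=> l; rewrite expr2 {2}(sqnorm_orth _ orth) mulr_sumr; apply: ler_sum => i _.
  have [->|d0] := eqVneq (dotp (dual V l) (row i Q)) 0; first by rewrite expr0n !mulr0.
  by rewrite ler_wpM2r ?sqr_ge0// lamE; exact: mn.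
- exact: le_trans (le_trans h1 h2) h3.
- move=> e; have e1 : \prod_i lam i = ((\sum_i lam i) / n%:R) ^+ n.
    by apply/le_anti; rewrite h3 e (le_trans h1 h2).
  have e2 : \prod_i lam i = \prod_i T i i ^+ 2.
    by rewrite pT; apply/le_anti; rewrite h2 e1 e h1.
  have TE := prod_eq_le Tlam (prodr_gt0 _ (fun i _ => T2 i)) e2.
  have le i j : lam i = lam j.
    move: h4; rewrite e1 eqxx => /esym/forall_inP/(_ i isT)/forall_inP/(_ j isT)/eqP.
    exact.
  have [i0 _] : exists i : 'I_n, true by exists (Ordinal n0).
  exists (lam i0), L; split=> // [|].
    have : \det T ^+ 2 = (\det V)^-1 ^+ 2 by rewrite -pT -e2 e1 e.
    rewrite detTX -[RHS]mul1r => /(mulIf (lt0r_neq0 V0)) /eqP.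
    rewrite -[_ ^+ 2]rmorphXn -[X in _ == X]/(1%:~R) eqr_int => /eqP; clear; move: (\det L) => z.
    by rewrite expr2; lia.
  have Tij i j : i != j -> T i j = 0.
    move=> ij; have : \sum_(j | j != i) T i j ^+ 2 = 0.
      by have := lamT i; rewrite (bigD1 i)//= TE => /eqP; rewrite eq_sym -subr_eq0 addrAC subrr add0r => /eqP.
    move=> /psumr_eq0P s; apply/eqP; rewrite -sqrf_eq0; apply/eqP/s => [k _|]; first exact: sqr_ge0.
    by rewrite eq_sym.
  have -> : X *m X^T = T *m T^T.
    by rewrite span trmx_mul -mulmxA (mulmxA Q) orth mul1mx.
  apply/matrixP => i j; rewrite !mxE (bigD1 i)//= big1 => [|k ki]; last first.
    by rewrite Tij ?mul0r// eq_sym.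
  rewrite addr0 [T^T _ _]mxE; have [<-|ij] := eqVneq i j; last by rewrite (Tij j i) ?mulr0// eq_sym.
  by rewrite -expr2 TE mulr1n.
Qed.

End Certificate.

(** * The spectral gap *)

Section Spectral.
Variables (R : realType) (n : nat) (V : 'M[R]_n).
Hypothesis hV : V \in unitmx.
Implicit Types phi psi : 'rV[R]_n -> R.
Notation sp := (smooth_periodic V).

Definition lapl phi : 'rV[R]_n -> R :=
  fun x => \sum_i dd (delta_mx 0 i) (dd (delta_mx 0 i) phi) x.

Lemma smooth_periodic_lapl phi : sp phi -> sp (lapl phi).
Proof.
by move=> p; apply: smooth_periodic_sum => i; apply: smooth_periodic_dd; exact: smooth_periodic_dd.
Qed.

Lemma cos_coef_sum l I (r : seq I) (F : I -> 'rV[R]_n -> R) : (forall i, sp (F i)) ->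
  cos_coef V l (fun x => \sum_(i <- r) F i x) = \sum_(i <- r) cos_coef V l (F i).
Proof.
move=> h; rewrite cos_coef.unlock -avg_sum => [|i].
  by congr (avg V _); apply/funext => x; rewrite mulr_suml.
by apply: smooth_periodicM => //; exact: smooth_periodic_cos.
Qed.

Lemma sin_coef_sum l I (r : seq I) (F : I -> 'rV[R]_n -> R) : (forall i, sp (F i)) ->
  sin_coef V l (fun x => \sum_(i <- r) F i x) = \sum_(i <- r) sin_coef V l (F i).
Proof.
move=> h; rewrite sin_coef.unlock -avg_sum => [|i].
  by congr (avg V _); apply/funext => x; rewrite mulr_suml.
by apply: smooth_periodicM => //; exact: smooth_periodic_sin.
Qed.

Lemma dotp_delta (xi : 'rV[R]_n) i : dotp xi (delta_mx 0 i) = xi 0 i.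
Proof. by rewrite dotpC /dotp -rowE !mxE. Qed.

Lemma cos_coef_lapl l phi : sp phi ->
  cos_coef V l (lapl phi) = - (sqnorm (freq V l) * cos_coef V l phi).
Proof.
move=> p; have p1 i := smooth_periodic_dd (delta_mx 0 i) p.
rewrite /lapl cos_coef_sum => [|i]; last exact: smooth_periodic_dd.
rewrite /sqnorm dotp_sum mulr_suml -sumrN; apply: eq_bigr => i _.
rewrite (cos_coef_dd hV l _ (p1 i)) (sin_coef_dd hV l _ p) dotp_delta.
by move: (cos_coef V l phi) => a; ring.
Qed.

Lemma sin_coef_lapl l phi : sp phi ->
  sin_coef V l (lapl phi) = - (sqnorm (freq V l) * sin_coef V l phi).
Proof.
move=> p; have p1 i := smooth_periodic_dd (delta_mx 0 i) p.
rewrite /lapl sin_coef_sum => [|i]; last exact: smooth_periodic_dd.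
rewrite /sqnorm dotp_sum mulr_suml -sumrN; apply: eq_bigr => i _.
rewrite (sin_coef_dd hV l _ (p1 i)) (cos_coef_dd hV l _ p) dotp_delta.
by move: (sin_coef V l phi) => a; ring.
Qed.

Definition coef2 l phi := cos_coef V l phi ^+ 2 + sin_coef V l phi ^+ 2.

(** Multiply the Fourier approximation by [phi], which is bounded by [L], and take the mean. Again
    [s] is common to all functions with constant [L]. *)
Lemma parseval_approx (L eps : R) : 0 < eps ->
  exists s : seq (R * 'rV[int]_n), forall phi, sp phi ->
  bounded_lip L (fun u => phi (u *m V^T)) ->
  `|avg V (fun x => phi x ^+ 2) - \sum_(p <- s) `|p.1| * coef2 p.2 phi| <= eps.
Proof.
move=> e0; have [L0|L0] := ltP L 0.
  by exists [::] => phi _ /bounded_lip_ge0; rewrite leNgt L0.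
have e1 : 0 < eps / (L + 1) by rewrite divr_gt0// ltr_wpDl.
have [s hs] := fourier_approx hV L e1; exists s => phi p b.
pose T x := \sum_(p <- s) `|p.1| * (cos_coef V p.2 phi * cos (dotp (freq V p.2) x) +
     sin_coef V p.2 phi * sin (dotp (freq V p.2) x)).
have pc l := smooth_periodicM p (smooth_periodic_cos hV l).
have ps l := smooth_periodicM p (smooth_periodic_sin hV l).
have spt q : sp (fun x => `|q.1| * (cos_coef V q.2 phi * (phi x * cos (dotp (freq V q.2) x)) +
     sin_coef V q.2 phi * (phi x * sin (dotp (freq V q.2) x)))).
  by apply: smooth_periodicZ; apply: smooth_periodicD; apply: smooth_periodicZ.
have phiT : (fun x => phi x * T x) = (fun x => \sum_(q <- s)
   `|q.1| * (cos_coef V q.2 phi * (phi x * cos (dotp (freq V q.2) x)) +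
     sin_coef V q.2 phi * (phi x * sin (dotp (freq V q.2) x)))).
  apply/funext => x; rewrite /T mulr_sumr; apply: eq_bigr => q _.
  move: (cos_coef V _ _) (sin_coef V _ _) (cos _) (sin _) => a a' c c'.
  by ring.
have spT : sp (fun x => phi x * T x) by rewrite phiT; apply: smooth_periodic_sum.
have -> : \sum_(p <- s) `|p.1| * coef2 p.2 phi = avg V (fun x => phi x * T x).
  rewrite phiT avg_sum//; apply: eq_bigr => q _.
  rewrite avgZ; last by apply: smooth_periodicD; apply: smooth_periodicZ.
  rewrite avgD; [|exact: smooth_periodicZ|exact: smooth_periodicZ].
  rewrite (avgZ _ (pc _)) (avgZ _ (ps _)) /coef2 !expr2.
  by rewrite {2}cos_coef.unlock {2}sin_coef.unlock.
rewrite -avgB//; last exact: smooth_periodicX.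
apply: avg_norm_le => //; first by apply: smooth_periodicB => //; exact: smooth_periodicX.
move=> x; rewrite expr2 -mulrBr normrM.
have h1 : `|phi x| <= L.
  by have := b.1 (x *m invmx V^T); rewrite mulmxKV// unitmx_tr.
have h2 := hs phi x p b; rewrite -/(T x) in h2.
apply: le_trans (ler_pM (normr_ge0 _) (normr_ge0 _) h1 h2) _.
rewrite mulrA ler_pdivrMr ?ltr_wpDl// mulrC ler_wpM2l ?ltW//; lra.
Qed.

Variables (Q : 'M[R]_n) (lam : 'I_n -> R).
Hypothesis lam0 : forall i, 0 < lam i.
Hypothesis cert : forall l,
  \sum_i lam i * dotp (dual V l) (row i Q) ^+ 2 <= sqnorm (dual V l) ^+ 2.

(* Its symbol |freq l|^4 - 4 pi^2 sum_i lam_i <freq l, q_i>^2 is nonnegative by *)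
(* cert.                                                                        *)
Definition gap_form phi psi := avg V (fun x => lapl phi x * lapl psi x) -
  4 * pi ^+ 2 * \sum_i lam i * avg V (fun x => dd (row i Q) phi x * dd (row i Q) psi x).

Lemma coef2_lapl l phi : sp phi -> coef2 l (lapl phi) = sqnorm (freq V l) ^+ 2 * coef2 l phi.
Proof.
move=> p; rewrite /coef2 (cos_coef_lapl l p) (sin_coef_lapl l p).
by move: (cos_coef V l phi) (sin_coef V l phi) => a b; ring.
Qed.

Lemma coef2_dd l v phi : sp phi -> coef2 l (dd v phi) = dotp (freq V l) v ^+ 2 * coef2 l phi.
Proof.
move=> p; rewrite /coef2 (cos_coef_dd hV l v p) (sin_coef_dd hV l v p).
by move: (cos_coef V l phi) (sin_coef V l phi) => a b; ring.
Qed.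

Lemma cert_freq l : 4 * pi ^+ 2 * \sum_i lam i * dotp (freq V l) (row i Q) ^+ 2 <=
  sqnorm (freq V l) ^+ 2.
Proof.
have e : freq V l = (2 * pi) *: dual V l by rewrite freq.unlock.
rewrite e /sqnorm dotpZl dotpZr.
have -> : 4 * pi ^+ 2 * \sum_i lam i * dotp ((2 * pi) *: dual V l) (row i Q) ^+ 2 =
  (2 * pi) ^+ 4 * \sum_i lam i * dotp (dual V l) (row i Q) ^+ 2.
  rewrite !mulr_sumr; apply: eq_bigr => i _; rewrite dotpZl.
  by move: (dotp _ _) => a; ring.
have := cert l; rewrite /sqnorm; move: (dotp _ _) (\sum_i _) => a b h.
have -> : (2 * pi * (2 * pi * a)) ^+ 2 = (2 * pi) ^+ 4 * a ^+ 2 by ring.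
by rewrite ler_wpM2l// exprn_ge0// mulr_ge0// pi_ge0.
Qed.

(** [L] is a common constant for the Laplacian and for all derivatives along [Q], so
    [parseval_approx] gives them the same weights and [cert_freq] applies frequency by frequency.
    The error is at most e times [K], with e arbitrary. *)
Theorem gap_form_ge0 phi : sp phi -> 0 <= gap_form phi phi.
Proof.
move=> p; pose S := \sum_i lam i; have S0 : 0 <= S by apply: sumr_ge0 => i _; exact: ltW.
have pq i := smooth_periodic_dd (row i Q) p.
have pl := smooth_periodic_lapl p.
have [L0 b0] := bl_pull pl.
have /choice[Li bi] : forall i, exists C, bounded_lip C (fun u => dd (row i Q) phi (u *m V^T)).
  by move=> i; exact: bl_pull (pq i).
have Li0 i := bounded_lip_ge0 (bi i); have L00 := bounded_lip_ge0 b0.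
pose L := L0 + \sum_i Li i.
have bL : bounded_lip L (fun u => lapl phi (u *m V^T)).
  by apply: bounded_lipW b0; rewrite lerDl sumr_ge0.
have bLi i : bounded_lip L (fun u => dd (row i Q) phi (u *m V^T)).
  apply: bounded_lipW (bi i); rewrite /L (bigD1 i)//= addrCA lerDl addr_ge0//.
  exact: sumr_ge0.
have p2 : 0 <= 4 * pi ^+ 2 :> R by rewrite mulr_ge0// sqr_ge0.
pose K := 1 + 4 * pi ^+ 2 * S; have K0 : 0 < K.
  by rewrite /K; have k := mulr_ge0 p2 S0; lra.
suff h e : 0 < e -> - e * K <= gap_form phi phi.
  apply/ler_addgt0Pr => e e0; have := h (e / K) (divr_gt0 e0 K0).
  by rewrite mulNr divfK ?gt_eqF//; lra.
move=> e0; have [s hs] := parseval_approx L e0.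
have := hs _ pl bL; rewrite ler_norml => /andP[h1 _].
have hi i : avg V (fun x => dd (row i Q) phi x ^+ 2) <=
    \sum_(q <- s) `|q.1| * coef2 q.2 (dd (row i Q) phi) + e.
  by have := hs _ (pq i) (bLi i); rewrite ler_norml => /andP[_]; rewrite lerBlDr addrC.
have -> : gap_form phi phi = avg V (fun x => lapl phi x ^+ 2) -
   4 * pi ^+ 2 * \sum_i lam i * avg V (fun x => dd (row i Q) phi x ^+ 2).
  by [].
have h3 : \sum_i lam i * avg V (fun x => dd (row i Q) phi x ^+ 2) <=
   \sum_(q <- s) `|q.1| * (\sum_i lam i * dotp (freq V q.2) (row i Q) ^+ 2) * coef2 q.2 phi
   + S * e.
  have -> : \sum_(q <- s) `|q.1| * (\sum_i lam i * dotp (freq V q.2) (row i Q) ^+ 2) * coef2 q.2 phi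
     = \sum_i lam i * \sum_(q <- s) `|q.1| * coef2 q.2 (dd (row i Q) phi).
    under [RHS]eq_bigr do rewrite mulr_sumr.
    rewrite [RHS]exchange_big /=; apply: eq_bigr => q _.
    rewrite mulr_sumr mulr_suml; apply: eq_bigr => i _; rewrite (coef2_dd _ _ p).
    by move: (coef2 _ _) (dotp _ _) => a b; ring.
  rewrite /S mulr_suml -big_split /=; apply: ler_sum => i _.
  by rewrite -mulrDr ler_wpM2l// ltW.
have h4 : 4 * pi ^+ 2 *
   (\sum_(q <- s) `|q.1| * (\sum_i lam i * dotp (freq V q.2) (row i Q) ^+ 2) * coef2 q.2 phi)
   <= \sum_(q <- s) `|q.1| * coef2 q.2 (lapl phi).
  rewrite mulr_sumr; apply: ler_sum => q _; rewrite (coef2_lapl _ p).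
  have c0 : 0 <= coef2 q.2 phi by rewrite /coef2 addr_ge0 ?sqr_ge0.
  have := cert_freq q.2; move: (coef2 q.2 phi) c0 (sqnorm _) (\sum_i _) => c c0 N M h.
  have -> : 4 * pi ^+ 2 * (`|q.1| * M * c) = (4 * pi ^+ 2 * M) * (`|q.1| * c) by ring.
  by rewrite [leRHS]mulrCA ler_wpM2r//; exact: mulr_ge0.
move: h1 h3 h4; rewrite /K.
move: (avg V _) (\sum_i lam i * avg V _) (\sum_(q <- s) _) (\sum_(q <- s) _) => a b c d h1 h3 h4.
have := ler_wpM2l p2 h3; lra.
Qed.

Lemma lapl_lin phi psi t x : sp phi -> sp psi ->
  lapl (fun x => phi x + t * psi x) x = lapl phi x + t * lapl psi x.
Proof.
move=> [p _] [q _]; rewrite /lapl mulr_sumr -big_split; apply: eq_bigr => i _ /=.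
have -> : dd (delta_mx 0 i) (fun x => phi x + t * psi x) =
    (fun x => dd (delta_mx 0 i) phi x + t * dd (delta_mx 0 i) psi x).
  by apply/funext => y; rewrite ddD ?ddZ//; exact: smoothZ.
by rewrite ddD ?ddZ//; try exact: smooth_dd; apply: smoothZ; exact: smooth_dd.
Qed.

Lemma avg_sqr_lin phi psi t : sp phi -> sp psi ->
  avg V (fun x => (phi x + t * psi x) * (phi x + t * psi x)) =
  avg V (fun x => phi x * phi x) + 2 * t * avg V (fun x => phi x * psi x) +
  t ^+ 2 * avg V (fun x => psi x * psi x).
Proof.
move=> p q; have p2 := smooth_periodicM p p; have pq := smooth_periodicM p q.
have q2 := smooth_periodicM q q.
rewrite -(avgZ (2 * t) pq) -(avgZ (t ^+ 2) q2).
rewrite -(avgD p2 (smooth_periodicZ _ pq)).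
rewrite -(avgD (smooth_periodicD p2 (smooth_periodicZ _ pq)) (smooth_periodicZ _ q2)).
by congr (avg V _); apply/funext => x; move: (phi x) (psi x) => a b; ring.
Qed.

Lemma gap_form_lin phi psi t : sp phi -> sp psi ->
  gap_form (fun x => phi x + t * psi x) (fun x => phi x + t * psi x) =
  gap_form phi phi + 2 * t * gap_form phi psi + t ^+ 2 * gap_form psi psi.
Proof.
move=> p q; rewrite /gap_form.
have -> : lapl (fun x => phi x + t * psi x) = (fun x => lapl phi x + t * lapl psi x).
  by apply/funext => x; exact: lapl_lin.
rewrite (avg_sqr_lin _ (smooth_periodic_lapl p) (smooth_periodic_lapl q)).
have -> : \sum_i lam i * avg V (fun x => dd (row i Q) (fun x => phi x + t * psi x) x *
            dd (row i Q) (fun x => phi x + t * psi x) x) =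
   \sum_i lam i * avg V (fun x => dd (row i Q) phi x * dd (row i Q) phi x) +
   2 * t * (\sum_i lam i * avg V (fun x => dd (row i Q) phi x * dd (row i Q) psi x)) +
   t ^+ 2 * \sum_i lam i * avg V (fun x => dd (row i Q) psi x * dd (row i Q) psi x).
  rewrite !mulr_sumr -!big_split; apply: eq_bigr => i _ /=.
  have -> : dd (row i Q) (fun x => phi x + t * psi x) =
      (fun x => dd (row i Q) phi x + t * dd (row i Q) psi x).
    apply/funext => x; rewrite ddD ?ddZ//; [exact: q.1|exact: p.1|].
    by apply: smoothZ; exact: q.1.
  rewrite (avg_sqr_lin _ (smooth_periodic_dd _ p) (smooth_periodic_dd _ q)).
  by move: (avg V _) (avg V _) (avg V _) => a b c; ring.
move: (avg V _) (avg V _) (avg V _) (\sum_i _) (\sum_i _) (\sum_i _) => a b c a' b' c'.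
by ring.
Qed.

(** The equality case of Cauchy-Schwarz for a nonnegative form: 2 t b + t^2 c stays nonnegative for
    all t, which forces b = 0. *)
Lemma gap_form_eq0 phi psi : sp phi -> sp psi -> gap_form phi phi = 0 ->
  gap_form phi psi = 0.
Proof.
move=> p q e; have h t := gap_form_ge0 (smooth_periodicD p (smooth_periodicZ t q)).
have {}h t : 0 <= 2 * t * gap_form phi psi + t ^+ 2 * gap_form psi psi.
  by have := h t; rewrite gap_form_lin// e add0r.
have c0 := gap_form_ge0 q; move: h c0.
move: (gap_form phi psi) (gap_form psi psi) => b c h c0.
have c1 : 0 < c + 1 by lra.
(* The minimiser would be -b/c; c + 1 is used because c may be 0. *)
have := h (- b / (c + 1)).
have -> : 2 * (- b / (c + 1)) * b + (- b / (c + 1)) ^+ 2 * c =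
   - (b ^+ 2 * (c + 2)) / (c + 1) ^+ 2 by field; rewrite gt_eqF.
rewrite pmulr_lge0 ?invr_gt0 ?exprn_gt0// oppr_ge0.
rewrite pmulr_lle0; last by lra.
by move=> b2; apply/eqP; rewrite -sqrf_eq0 eq_le b2 sqr_ge0.
Qed.

Definition gap l := sqnorm (freq V l) ^+ 2 -
  4 * pi ^+ 2 * \sum_i lam i * dotp (freq V l) (row i Q) ^+ 2.

(** Integration by parts moves all derivatives onto the eigenfunction [psi], where the form acts as
    multiplication by its symbol at [xi]. *)
Lemma gap_form_eigen xi phi psi : sp phi -> sp psi ->
  (forall v x, dd v (dd v psi) x = - (dotp xi v ^+ 2 * psi x)) ->
  gap_form phi psi =
  (sqnorm xi ^+ 2 - 4 * pi ^+ 2 * \sum_i lam i * dotp xi (row i Q) ^+ 2) *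
  avg V (fun x => phi x * psi x).
Proof.
move=> p q eig; have q1 v : sp (dd v psi) := smooth_periodic_dd v q.
have pq := smooth_periodicM p q; have pl := smooth_periodic_lapl p.
have parts v : avg V (fun x => dd v phi x * dd v psi x) =
    dotp xi v ^+ 2 * avg V (fun x => phi x * psi x).
  rewrite (avg_dd_parts hV v p (q1 v)).
  have -> : (fun x => phi x * dd v (dd v psi) x) = (fun x => - dotp xi v ^+ 2 * (phi x * psi x)).
    by apply/funext => x; rewrite eig; move: (phi x) (psi x) (dotp _ _) => a b d; ring.
  by rewrite (avgZ _ pq) mulNr opprK.
have sE : sqnorm xi = \sum_i dotp xi (delta_mx 0 i) ^+ 2.
  by rewrite /sqnorm dotp_sum; apply: eq_bigr => i _; rewrite dotp_delta expr2.
have lE : avg V (fun x => lapl phi x * psi x) = - sqnorm xi * avg V (fun x => phi x * psi x).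
  have -> : (fun x => lapl phi x * psi x) =
      (fun x => \sum_i dd (delta_mx 0 i) (dd (delta_mx 0 i) phi) x * psi x).
    by apply/funext => x; rewrite /lapl mulr_suml.
  have p1 i : sp (dd (delta_mx 0 i) phi) := smooth_periodic_dd _ p.
  rewrite avg_sum => [|i]; last by apply: smooth_periodicM => //; exact: smooth_periodic_dd.
  rewrite sE -sumrN mulr_suml; apply: eq_bigr => i _.
  by rewrite (avg_dd_parts hV _ (p1 i) q) parts mulNr.
rewrite /gap_form; have -> : (fun x => lapl phi x * lapl psi x) =
    (fun x => - sqnorm xi * (lapl phi x * psi x)).
  apply/funext => x; have -> : lapl psi x = - sqnorm xi * psi x.
    by rewrite sE -sumrN mulr_suml; apply: eq_bigr => i _; rewrite eig mulNr.
  by rewrite mulrCA.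
rewrite (avgZ _ (smooth_periodicM pl q)) lE mulrBl -[X in _ = _ - X]mulrA mulr_suml.
congr (_ - _ * _); last by apply: eq_bigr => i _; rewrite parts mulrA.
by move: (sqnorm xi) (avg _ _) => a b; ring.
Qed.

(** [phi] lies in the kernel of the form; it is tested against the cosine and the sine of frequency
    [l]. *)
Lemma gap_form_coef phi l : sp phi -> gap_form phi phi = 0 -> gap l != 0 ->
  cos_coef V l phi = 0 /\ sin_coef V l phi = 0.
Proof.
move=> p e g; have [sC sS] := smooth_cos_sin (freq V l).
have dc v : dd v (fun x => cos (dotp (freq V l) x)) =
    (fun x => - dotp (freq V l) v * sin (dotp (freq V l) x)).
  by apply/funext => x; rewrite dd_cos mulNr.
have ds v : dd v (fun x => sin (dotp (freq V l) x)) =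
    (fun x => dotp (freq V l) v * cos (dotp (freq V l) x)).
  by apply/funext => x; rewrite dd_sin.
have pc := smooth_periodic_cos hV l; have ps := smooth_periodic_sin hV l.
have ec v x : dd v (dd v (fun x => cos (dotp (freq V l) x))) x =
    - (dotp (freq V l) v ^+ 2 * cos (dotp (freq V l) x)).
  by rewrite dc ddZ// ds; move: (dotp _ v) (cos _) => a b; ring.
have es v x : dd v (dd v (fun x => sin (dotp (freq V l) x))) x =
    - (dotp (freq V l) v ^+ 2 * sin (dotp (freq V l) x)).
  by rewrite ds ddZ// dc; move: (dotp _ v) (sin _) => a b; ring.
have hc := gap_form_eigen p pc ec; have hs := gap_form_eigen p ps es.
rewrite (gap_form_eq0 p pc e) in hc; rewrite (gap_form_eq0 p ps e) in hs.
rewrite cos_coef.unlock sin_coef.unlock.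
by split; apply/eqP; [move: hc|move: hs] => /esym/eqP; rewrite mulf_eq0 (negPf g).
Qed.

End Spectral.

(** * Conformal invariance of the Willmore functional *)

Section VectorCalculus.
Variables (R : realType) (n : nat).
Implicit Types (v x : 'rV[R]_n).

Definition vsmooth N (G : 'rV[R]_n -> 'rV[R]_N) := forall j, smooth (fun x => G x 0 j).

Definition vd N v (G : 'rV[R]_n -> 'rV[R]_N) x : 'rV[R]_N :=
  \row_j dd v (fun y => G y 0 j) x.

Local Notation e_ i := (delta_mx 0 i : 'rV[R]_n).

Lemma vdE N v (G : 'rV[R]_n -> 'rV[R]_N) j :
  (fun x => vd v G x 0 j) = dd v (fun y => G y 0 j).
Proof. by apply/funext => x; rewrite mxE. Qed.

Lemma vsmooth_vd N v (G : 'rV[R]_n -> 'rV[R]_N) : vsmooth G -> vsmooth (vd v G).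
Proof. by move=> h j; rewrite vdE; exact: smooth_dd. Qed.

Lemma vsmoothD N (G K : 'rV[R]_n -> 'rV[R]_N) : vsmooth G -> vsmooth K ->
  vsmooth (fun x => G x + K x).
Proof. by move=> g k j; apply: smooth_ext (smoothD (g j) (k j)) => x; rewrite mxE. Qed.

Lemma vsmooth_cst N (b : 'rV[R]_N) : vsmooth (fun=> b).
Proof. by move=> j; exact: smooth_cst. Qed.

Lemma vsmoothZ N (phi : 'rV[R]_n -> R) (G : 'rV[R]_n -> 'rV[R]_N) : smooth phi -> vsmooth G ->
  vsmooth (fun x => phi x *: G x).
Proof. by move=> p g j; apply: smooth_ext (smoothM p (g j)) => x; rewrite mxE. Qed.

Lemma vsmooth_mulmx N M (G : 'rV[R]_n -> 'rV[R]_N) (A : 'M[R]_(N, M)) : vsmooth G ->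
  vsmooth (fun x => G x *m A).
Proof.
move=> g j; apply: (@smooth_ext _ _ (fun x => \sum_i A i j * G x 0 i)) => [x|].
  by rewrite mxE; apply: eq_bigr => i _; rewrite mulrC.
by apply: smooth_sum => i; exact: smoothZ.
Qed.

Lemma smooth_dotpf N (G K : 'rV[R]_n -> 'rV[R]_N) : vsmooth G -> vsmooth K ->
  smooth (fun x => dotp (G x) (K x)).
Proof.
move=> g k; apply: (@smooth_ext _ _ (fun x => \sum_j G x 0 j * K x 0 j)) => [x|].
  by rewrite dotp_sum.
by apply: smooth_sum => j; exact: smoothM.
Qed.

Lemma dd_dotpf N v (G K : 'rV[R]_n -> 'rV[R]_N) x : vsmooth G -> vsmooth K ->
  dd v (fun x => dotp (G x) (K x)) x = dotp (vd v G x) (K x) + dotp (G x) (vd v K x).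
Proof.
move=> g k; have -> : (fun x => dotp (G x) (K x)) = (fun x => \sum_j G x 0 j * K x 0 j).
  by apply/funext => y; rewrite dotp_sum.
rewrite dd_sum => [|j]; last exact: smoothM.
rewrite !dotp_sum -big_split; apply: eq_bigr => j _ /=.
by rewrite ddM// !mxE.
Qed.

Lemma vdD N v (G K : 'rV[R]_n -> 'rV[R]_N) x : vsmooth G -> vsmooth K ->
  vd v (fun x => G x + K x) x = vd v G x + vd v K x.
Proof.
move=> g k; apply/rowP => j; rewrite !mxE -ddD//; congr (dd v _ x).
by apply/funext => y; rewrite mxE.
Qed.

Lemma vd_cst N v (b : 'rV[R]_N) x : vd v (fun=> b) x = 0.
Proof. by apply/rowP => j; rewrite !mxE dd_cst. Qed.

Lemma vdZ N v (phi : 'rV[R]_n -> R) (G : 'rV[R]_n -> 'rV[R]_N) x : smooth phi -> vsmooth G ->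
  vd v (fun x => phi x *: G x) x = dd v phi x *: G x + phi x *: vd v G x.
Proof.
move=> p g; apply/rowP => j; rewrite !mxE -ddM//; congr (dd v _ x).
by apply/funext => y; rewrite mxE.
Qed.

Lemma vd_mulmx N M v (G : 'rV[R]_n -> 'rV[R]_N) (A : 'M[R]_(N, M)) x : vsmooth G ->
  vd v (fun x => G x *m A) x = vd v G x *m A.
Proof.
move=> g; apply/rowP => j; rewrite !mxE.
have -> : (fun y => (G y *m A) 0 j) = (fun y => \sum_i A i j * G y 0 i).
  by apply/funext => y; rewrite mxE; apply: eq_bigr => i _; rewrite mulrC.
rewrite dd_sum => [|i]; last exact: smoothZ.
by apply: eq_bigr => i _; rewrite ddZ// mxE mulrC.
Qed.

Lemma vd_derive N v (G : 'rV[R]_n -> 'rV[R]_N) x : vsmooth G -> 'D_v G x = vd v G x.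
Proof.
move=> g; apply/rowP => j; rewrite mxE derive_row ?ddE//.
by apply/differentiable_rowP => i; exact: smooth_differentiable.
Qed.

Lemma vsmooth_differentiable N (G : 'rV[R]_n -> 'rV[R]_N) x : vsmooth G -> differentiable G x.
Proof. by move=> g; apply/differentiable_rowP => i; exact: smooth_differentiable. Qed.

(** Coordinate partials determine all directional derivatives by linearity; the induction on the
    order carries an arbitrary list [s] of partials already taken. *)
Lemma smooth_onP N (G : 'rV[R]_n -> 'rV[R]_N) : smooth_on setT G <-> vsmooth G.
Proof.
split=> [h j k|h s].
  suff : forall s, Ck k (fun x => partials s G x 0 j) by move=> /(_ [::]).
  elim: k => [|k IH] s; (split; first by move=> x; move: (h s x I) => /differentiable_rowP/(_ j)).
    by [].
  move=> v; have := IH; have := h s; clear; move=> hs IH.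
  have sm i : Ck k (fun x => v 0 i * partials (i :: s) G x 0 j).
    by apply: CkM; [exact: Ck_cst|exact: IH].
  have : Ck k (fun x => \sum_i v 0 i * partials (i :: s) G x 0 j).
    elim: (index_enum _) => [|i r IHr].
      by apply: Ck_ext (Ck_cst _ _ 0) => x; rewrite big_nil.
    by apply: Ck_ext (CkD (sm i) IHr) => x; rewrite big_cons.
  apply: Ck_ext => x; rewrite derive_coord; last first.
    by move: (hs x I) => /differentiable_rowP/(_ j).
  apply: eq_bigr => i _ /=; rewrite /partial derive_row//.
  exact: hs.
suff H : vsmooth (partials s G) by move=> x _; exact: vsmooth_differentiable.
elim: s => [|i s IH]//= j.
have -> : (fun x => partial i (partials s G) x 0 j) = (fun x => vd (e_ i) (partials s G) x 0 j).
  by apply/funext => x; rewrite /partial vd_derive.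
exact: vsmooth_vd.
Qed.

Lemma jacobianE N (G : 'rV[R]_n -> 'rV[R]_N) x i : vsmooth G ->
  row i ('J G x) = vd (e_ i) G x.
Proof.
move=> g; rewrite -vd_derive// deriveEjacobian ?rowE//.
exact: vsmooth_differentiable.
Qed.

Lemma gram_jacobian N (G : 'rV[R]_n -> 'rV[R]_N) x i k : vsmooth G ->
  ('J G x *m ('J G x)^T) i k = dotp (vd (e_ i) G x) (vd (e_ k) G x).
Proof.
move=> g; rewrite -!jacobianE// mxE dotp_sum; apply: eq_bigr => j _.
by rewrite !mxE.
Qed.

Lemma partialE N (G : 'rV[R]_n -> 'rV[R]_N) i : vsmooth G -> partial i G = vd (e_ i) G.
Proof. by move=> g; apply/funext => x; rewrite /partial vd_derive. Qed.

Variable V : 'M[R]_n.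
Hypothesis hV : V \in unitmx.

Definition vsp N (G : 'rV[R]_n -> 'rV[R]_N) :=
  forall j, smooth_periodic V (fun x => G x 0 j).

Lemma vsp_smooth N (G : 'rV[R]_n -> 'rV[R]_N) : vsp G -> vsmooth G.
Proof. by move=> h j; case: (h j). Qed.

Lemma vsp_vd N v (G : 'rV[R]_n -> 'rV[R]_N) : vsp G -> vsp (vd v G).
Proof. by move=> h j; rewrite vdE; exact: smooth_periodic_dd. Qed.

Lemma vsp_sum N I (r : seq I) (G : I -> 'rV[R]_n -> 'rV[R]_N) :
  (forall i, vsp (G i)) -> vsp (fun x => \sum_(i <- r) G i x).
Proof.
move=> h j; have -> : (fun x => (\sum_(i <- r) G i x) 0 j) =
    (fun x => \sum_(i <- r) G i x 0 j) by apply/funext => x; rewrite summxE.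
by apply: smooth_periodic_sum => i; exact: h.
Qed.

Lemma vsp_dotp N (G K : 'rV[R]_n -> 'rV[R]_N) : vsp G -> vsp K ->
  smooth_periodic V (fun x => dotp (G x) (K x)).
Proof.
move=> g k; have -> : (fun x => dotp (G x) (K x)) = (fun x => \sum_j G x 0 j * K x 0 j).
  by apply/funext => y; rewrite dotp_sum.
by apply: smooth_periodic_sum => j; exact: smooth_periodicM.
Qed.

Lemma vdC N v w (G : 'rV[R]_n -> 'rV[R]_N) x : vsp G ->
  vd v (vd w G) x = vd w (vd v G) x.
Proof. by move=> g; apply/rowP => j; rewrite !mxE !vdE (ddC hV). Qed.

(* Gauss equation: up to terms antisymmetric in (k, l), the curvature integrand *)
(* of a closed frame is a double divergence of its Gram matrix.                 *)
Lemma gauss_identity N (al : 'I_n -> 'rV[R]_n -> 'rV[R]_N) x : (forall k, vsp (al k)) ->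
  (forall k l y, vd (e_ k) (al l) y = vd (e_ l) (al k) y) ->
  \sum_k \sum_l (dotp (vd (e_ k) (al k) x) (vd (e_ l) (al l) x) -
                 sqnorm (vd (e_ k) (al l) x)) =
  \sum_k \sum_l (dd (e_ k) (dd (e_ l) (fun y => dotp (al k y) (al l y))) x -
                 dd (e_ k) (dd (e_ k) (fun y => dotp (al l y) (al l y))) x).
Proof.
move=> sp cl; have s k := vsp_smooth (sp k).
have s1 v k : vsmooth (vd v (al k)) by exact: vsmooth_vd.
have cl' k l : vd (e_ k) (al l) = vd (e_ l) (al k) by apply/funext => y; exact: cl.
pose A k l := dotp (al k x) (vd (e_ l) (vd (e_ l) (al k)) x).
have expand k l : dd (e_ k) (dd (e_ l) (fun y => dotp (al k y) (al l y))) x -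
    dd (e_ k) (dd (e_ k) (fun y => dotp (al l y) (al l y))) x =
  (dotp (vd (e_ k) (al k) x) (vd (e_ l) (al l) x) - sqnorm (vd (e_ k) (al l) x)) +
  (A k l - A l k).
  have d1 v i j : dd v (fun y => dotp (al i y) (al j y)) =
     (fun y => dotp (vd v (al i) y) (al j y) + dotp (al i y) (vd v (al j) y)).
    by apply/funext => y; exact: dd_dotpf.
  have d2 w v i j : dd w (dd v (fun y => dotp (al i y) (al j y))) x =
     dotp (vd w (vd v (al i)) x) (al j x) + dotp (vd v (al i) x) (vd w (al j) x) +
     (dotp (vd w (al i) x) (vd v (al j) x) + dotp (al i x) (vd w (vd v (al j)) x)).
    rewrite d1 ddD ?dd_dotpf//; exact: smooth_dotpf.
  have e1 : vd (e_ k) (vd (e_ l) (al k)) x = vd (e_ k) (vd (e_ k) (al l)) x.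
    by rewrite (cl' l k).
  have e2 : vd (e_ k) (vd (e_ l) (al l)) x = vd (e_ l) (vd (e_ l) (al k)) x.
    by rewrite (vdC _ _ _ (sp l)) (cl' k l).
  rewrite !d2 /A /sqnorm e1 e2 (cl l k) (dotpC (vd (e_ k) (vd _ _) x)).
  move: (dotp _ _) (dotp _ _) (dotp _ _) (dotp _ _) => a b c d.
  by ring.
under [RHS]eq_bigr do under eq_bigr do rewrite expand.
under [RHS]eq_bigr do rewrite big_split.
rewrite big_split /= -[LHS]addr0; congr (_ + _); symmetry.
under eq_bigr do rewrite sumrB.
by rewrite sumrB [X in _ - X]exchange_big subrr.
Qed.

End VectorCalculus.

(** * Convexity of powers and Jensen's inequality *)

Section PowerFunction.
Variable R : realType.

(** Convexity of the s-th power in tangent form. For a > 0 and s > 1 it is Young's inequality for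
    b/a and 1, with exponents s and s/(s - 1). *)
Lemma powR_tangent (a b s : R) : 0 <= a -> 0 <= b -> 1 <= s ->
  a `^ s + s * a `^ (s - 1) * (b - a) <= b `^ s.
Proof.
move=> a0 b0 s1; have [->|s1'] := eqVneq s 1.
  by rewrite subrr powRr0 !powRr1//; lra.
have {}s1 : 1 < s by rewrite lt_neqAle eq_sym s1'.
have s0 : 0 < s by lra.
have [a00|a00] := eqVneq a 0.
  rewrite a00 !powR0 ?mulr0 ?mul0r ?addr0 ?powR_ge0//; first by rewrite subr_eq0.
  by rewrite gt_eqF.
have ap : 0 < a by rewrite lt_neqAle eq_sym a00.
have q0 : 0 < s / (s - 1) by rewrite divr_gt0//; lra.
have pq : s^-1 + (s / (s - 1))^-1 = 1 by rewrite invf_div; field; rewrite gt_eqF.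
have ba : 0 <= b / a by rewrite divr_ge0.
have := conjugate_powR ba ler01 s0 q0 pq.
rewrite powR1 mulr1 mul1r invf_div => h.
have bE : b `^ s = (b / a) `^ s * a `^ s by rewrite -powRM// divfK.
have aE : a `^ s = a * a `^ (s - 1) by rewrite mulr_powRB1.
have pa : 0 <= a `^ s := powR_ge0 _ _.
have h2 : 1 + s * (b / a - 1) <= (b / a) `^ s.
  have : s * (b / a) <= s * ((b / a) `^ s / s + (s - 1) / s) by rewrite ler_pM2l.
  have -> : s * ((b / a) `^ s / s + (s - 1) / s) = (b / a) `^ s + (s - 1).
    by move: (_ `^ s) => c; field; rewrite gt_eqF.
  by lra.
rewrite bE; apply: le_trans (ler_wpM2r pa h2).
rewrite aE le_eqVlt; apply/orP; left; apply/eqP.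
by move: (a `^ _) => c; field.
Qed.

(** The tangent inequality bounds the increment of the power by s phi^(s - 1) times that of [phi]; s
    >= 1 keeps this factor bounded where [phi] vanishes. *)
Lemma bl_powR n (phi : 'rV[R]_n -> R) s : 1 <= s -> bl phi -> (forall x, 0 <= phi x) ->
  bl (fun x => phi x `^ s).
Proof.
move=> s1 [C b] p0; have C0 := bounded_lip_ge0 b; case: b => b l.
have s0 : 0 <= s by lra.
have pC x : phi x <= C by apply: le_trans (b x); exact: ler_norm.
have mono (t : R) x : 0 <= t -> phi x `^ t <= C `^ t.
  by move=> t0; apply: ge0_ler_powR => //; rewrite nnegrE.
have K0 (t : R) : 0 <= C `^ t by exact: powR_ge0.
exists (C `^ s + s * C `^ (s - 1) * C); split=> [x|x y].
  rewrite ger0_norm ?powR_ge0//; apply: le_trans (mono s x s0) _.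
  by rewrite lerDl !mulr_ge0.
wlog xy : x y / phi y <= phi x => [h|].
  by case/orP: (le_total (phi y) (phi x)) => /h//; rewrite distrC (distrC y).
have h := powR_tangent (p0 x) (p0 y) s1.
have m : phi y `^ s <= phi x `^ s by apply: ge0_ler_powR => //; rewrite nnegrE.
rewrite ger0_norm ?subr_ge0//.
apply: (@le_trans _ _ (s * phi x `^ (s - 1) * (phi x - phi y))); first by lra.
rewrite mulrDl; apply: ler_wpDl; first by rewrite mulr_ge0.
rewrite -!mulrA ler_wpM2l//; apply: ler_pM; rewrite ?powR_ge0 ?subr_ge0//.
  by apply: mono; lra.
by apply: le_trans (l x y); exact: ler_norm.
Qed.

(** Integrate the tangent inequality at the mean value. *)
Lemma cube_integral_jensen n (phi : 'rV[R]_n -> R) s : 1 <= s -> bl phi ->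
  (forall x, 0 <= phi x) ->
  cube_integral phi `^ s <= cube_integral (fun x => phi x `^ s).
Proof.
move=> s1 b p0; set a := cube_integral phi.
have a0 : 0 <= a.
  by rewrite -(cube_integral_cst n (0 : R)); apply: le_cube_integral => //; exact: bl_cst.
set c := s * a `^ (s - 1).
have -> : a `^ s = cube_integral (fun x => (a `^ s - c * a) + c * phi x).
  rewrite cube_integralD; [|exact: bl_cst|exact: blZ].
  by rewrite cube_integral_cst cube_integralZ// -/a subrK.
apply: le_cube_integral; [by apply: blD; [exact: bl_cst|exact: blZ]|exact: bl_powR|move=> x].
by have := powR_tangent a0 (p0 x) s1; rewrite -/c; lra.
Qed.

End PowerFunction.

Section TorusProjection.
Variables (R : realType) (n : nat) (V : 'M[R]_n).

Lemma torus_projP (x y : 'rV[R]_n) :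
  torus_proj V x = torus_proj V y <-> exists k : 'rV[int]_n, x = y + map_mx intr k *m V^T.
Proof.
split=> [/eqP|[k ->]].
  rewrite /torus_proj -idealrBE => /asboolP[k e]; exists k.
  by rewrite -e addrC subrK.
apply/eqP; rewrite /torus_proj -idealrBE; apply/asboolP; exists k.
by rewrite addrAC subrr add0r.
Qed.

Lemma torus_proj_repr (t : torus V) : torus_proj V (repr (t : {quot (lattice V)})) = t.
Proof. exact: reprK. Qed.

Lemma torus_lift_vsp N (f : torus V -> 'rV[R]_N) :
  vsmooth (torus_lift f) -> vsp V (torus_lift f).
Proof.
move=> h j; split=> // x k; rewrite /torus_lift /=; congr (f _ _ _).
by apply/torus_projP; exists k.
Qed.

End TorusProjection.

(** * Second derivatives of a flat immersion *)

Section FlatImmersion.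
Variables (R : realType) (n N : nat) (V : 'M[R]_n).
Hypothesis hV : V \in unitmx.
Variable G : 'rV[R]_n -> 'rV[R]_N.
Hypothesis sG : vsp V G.
Local Notation e_ i := (delta_mx 0 i : 'rV[R]_n).
Hypothesis flat : forall x i k, dotp (vd (e_ i) G x) (vd (e_ k) G x) = (i == k)%:R.

Definition hess (i j : 'I_n) x := vd (e_ i) (vd (e_ j) G) x.
Definition vlapl x := \sum_i hess i i x.

Let sG1 v : vsmooth (vd v G). Proof. exact/vsmooth_vd/(vsp_smooth sG). Qed.

Lemma hessC i j x : hess i j x = hess j i x.
Proof. exact: (vdC hV _ _ _ sG). Qed.

(** The array T i j k is symmetric in i, j and, the Gram matrix being constant, antisymmetric in j,
    k; such an array vanishes. *)
Lemma flat_normal i j k x : dotp (hess i j x) (vd (e_ k) G x) = 0.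
Proof.
pose T i j k := dotp (hess i j x) (vd (e_ k) G x).
have Ts i' j' k' : T i' j' k' = T j' i' k' by rewrite /T hessC.
have Ta i' j' k' : T i' j' k' = - T i' k' j'.
  have := dd_dotpf (e_ i') x (sG1 (e_ j')) (sG1 (e_ k')).
  have -> : (fun y => dotp (vd (e_ j') G y) (vd (e_ k') G y)) = (fun=> (j' == k')%:R).
    by apply/funext => y; exact: flat.
  rewrite dd_cst -/(hess i' j' x) -/(hess i' k' x) (dotpC (vd _ G x)).
  by rewrite -/(T i' j' k') -/(T i' k' j') => /esym/eqP; rewrite addr_eq0 => /eqP.
have : T i j k = - T i j k.
  by rewrite {1}Ta Ts Ta opprK Ts Ta Ts.
by rewrite -/(T i j k); move: (T i j k) => t; lra.
Qed.

(** The Gauss identity for a constant Gram matrix: its double divergence vanishes. *)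
Lemma flat_gauss x : \sum_i \sum_j sqnorm (hess i j x) = sqnorm (vlapl x).
Proof.
have := gauss_identity hV x (fun k => vsp_vd (e_ k) sG)
   (fun k l y => vdC hV (e_ k) (e_ l) y sG).
rewrite [RHS]big1 => [|k _]; last first.
  apply: big1 => l _.
  have z v i j : dd v (fun y => dotp (vd (e_ i) G y) (vd (e_ j) G y)) = (fun=> 0).
    have -> : (fun y => dotp (vd (e_ i) G y) (vd (e_ j) G y)) = (fun=> (i == j)%:R).
      by apply/funext => y; exact: flat.
    by apply/funext => y; rewrite dd_cst.
  by rewrite !z !dd_cst subrr.
under eq_bigr do rewrite sumrB.
rewrite sumrB => /eqP; rewrite subr_eq0 => /eqP h; rewrite -[LHS]h.
rewrite /sqnorm /vlapl dotp_suml; apply: eq_bigr => i _.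
by rewrite dotp_sumr.
Qed.

End FlatImmersion.

(** * Conformal invariance of the integrand *)

Section ConformalInvariance.
Variables (R : realType) (n N : nat) (V : 'M[R]_n).
Variable f : torus V -> 'rV[R]_N.

Lemma dotp_conformal M (O : 'M[R]_(N, M)) rho (u v : 'rV[R]_N) : O *m O^T = rho%:M ->
  dotp (u *m O) (v *m O) = rho * dotp u v.
Proof.
by move=> h; rewrite dotp_mulmx -mulmxA h mul_mx_scalar dotpZr.
Qed.

(** [O] stands for the differential of an ambient conformal map and [rho] for its factor. Such a map
    changes second derivatives by a multiple of the metric, [z], and by tangential terms, [c]. The
    normal projection removes [c], and S - n |H|^2 is the squared norm of the trace-free part, which
    does not see [z]. What is left scales by rho^-1, and the volume by rho^(n/2). *)
Lemma conformal_pointwise x (P : 'M[R]_(n, N)) (O : 'M[R]_N) rho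
    (F : 'I_n -> 'I_n -> 'rV[R]_N) z (c : 'I_n -> 'I_n -> 'rV[R]_n) :
  (0 < n)%N -> 0 < rho -> O *m O^T = rho%:M -> P *m P^T = 1%:M ->
  'J (torus_lift f) x = P *m O -> (forall i j, F i j *m P^T = 0) ->
  (forall i j, partial i (partial j (torus_lift f)) x =
     (F i j + (i == j)%:R *: z + c i j *m P) *m O) ->
  sqnorm_second_ff f x - n%:R * sqnorm (mean_curvature f x) =
    rho^-1 * (\sum_i \sum_j sqnorm (F i j) - n%:R^-1 * sqnorm (\sum_i F i i)) /\
  volume_density f x = Num.sqrt (rho ^+ n).
Proof.
move=> n0 rho0 hO hP hJ FP h2.
have rn0 : rho != 0 by rewrite gt_eqF.
have gE : induced_metric f x = rho%:M.
  rewrite /induced_metric hJ trmx_mul mulmxA -(mulmxA P) hO mul_mx_scalar.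
  by rewrite -scalemxAl hP scalemx1.
have iE : inverse_metric f x = rho^-1%:M by rewrite /inverse_metric gE invmx_scalar.
have ijE i j : inverse_metric f x i j = rho^-1 * (i == j)%:R by rewrite iE mxE mulr_natr.
have [z' z'E] : {z' | z' = z - z *m P^T *m P} by exists (z - z *m P^T *m P).
have nP (u : 'rV[R]_N) : normal_part f x (u *m O) = (u - u *m P^T *m P) *m O.
  have e : u *m O *m (P *m O)^T = rho *: (u *m P^T).
    by rewrite trmx_mul mulmxA -(mulmxA u) hO mul_mx_scalar -scalemxAl.
  rewrite /normal_part iE hJ e mul_mx_scalar scalerA mulVf// scale1r.
  by rewrite mulmxA -mulmxBl.
have IIE i j : second_ff f x i j = (F i j + (i == j)%:R *: z') *m O.
  rewrite /second_ff h2 nP; congr (_ *m O).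
  rewrite !mulmxDl FP mul0mx add0r -!scalemxAl -[c i j *m P *m P^T]mulmxA hP mulmx1.
  by rewrite z'E scalerBr; move: (_ *: _) (_ *: _) (c i j *m P) => a b d;
    rewrite opprD addrACA subrr addr0 addrA.
split; last by rewrite /volume_density gE det_scalar.
have dI i j k l : dotp (second_ff f x i j) (second_ff f x k l) =
   rho * dotp (F i j + (i == j)%:R *: z') (F k l + (k == l)%:R *: z').
  by rewrite !IIE (dotp_conformal _ _ hO).
have S1 : sqnorm_second_ff f x =
   rho^-1 * \sum_i \sum_j sqnorm (F i j + (i == j)%:R *: z').
  rewrite /sqnorm_second_ff mulr_sumr; apply: eq_bigr => i _.
  rewrite mulr_sumr; apply: eq_bigr => j _.
  rewrite (bigD1 i)//= [X in _ + X]big1 => [|k ki]; last first.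
    by apply: big1 => l _; rewrite ijE eq_sym (negPf ki) mulr0 !mul0r.
  rewrite addr0 (bigD1 j)//= [X in _ + X]big1 => [|l lj]; last first.
    by rewrite !ijE [j == l]eq_sym (negPf lj) !mulr0 !mul0r.
  rewrite addr0 !ijE !eqxx !mulr1 dI /sqnorm; move: (dotp _ _) => a.
  by field.
have S2 : \sum_i \sum_j sqnorm (F i j + (i == j)%:R *: z') =
   \sum_i \sum_j sqnorm (F i j) + 2 * dotp (\sum_i F i i) z' + n%:R * sqnorm z'.
  have e i j : sqnorm (F i j + (i == j)%:R *: z') =
     sqnorm (F i j) + (i == j)%:R * (2 * dotp (F i j) z' + sqnorm z').
    rewrite /sqnorm dotpDl !dotpDr !dotpZl !dotpZr (dotpC z' (F i j)).
    by case: (i == j) => /=; [ring|rewrite !mul0r !addr0].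
  under eq_bigr do under eq_bigr do rewrite e.
  under eq_bigr do rewrite big_split.
  rewrite big_split /= -addrA; congr (_ + _).
  rewrite (eq_bigr (fun i => 2 * dotp (F i i) z' + sqnorm z')) => [|i _]; last first.
    rewrite (bigD1 i)//= big1 => [|j ji]; last by rewrite eq_sym (negPf ji) mul0r.
    by rewrite eqxx mul1r addr0.
  rewrite big_split /= sumr_const card_ord -[_ *+ n]mulr_natl; congr (_ + _).
  by rewrite dotp_suml mulr_sumr.
have S3 : mean_curvature f x = (n%:R^-1 * rho^-1) *: ((\sum_i F i i + n%:R *: z') *m O).
  rewrite /mean_curvature -scalerA; congr (_ *: _).
  rewrite (eq_bigr (fun i => rho^-1 *: ((F i i + z') *m O))) => [|i _]; last first.
    rewrite (bigD1 i)//= big1 => [|j ji]; last first.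
      by rewrite ijE eq_sym (negPf ji) mulr0 scale0r.
    by rewrite ijE IIE eqxx mulr1 addr0 scale1r.
  rewrite -scaler_sumr -mulmx_suml big_split /= sumr_const card_ord.
  by rewrite scaler_nat.
rewrite S1 S2 S3 /sqnorm dotpZl dotpZr (dotp_conformal _ _ hO).
rewrite dotpDl !dotpDr !dotpZl !dotpZr (dotpC z' (\sum_i F i i)).
have nn0 : n%:R != 0 :> R by rewrite pnatr_eq0 -lt0n.
move: (dotp _ _) (dotp _ _) (dotp _ _) (\sum_i \sum_j _) => a b d s.
by field; rewrite rn0 nn0.
Qed.

End ConformalInvariance.

(** * Normal form of Moebius transformations *)

Section NormalForm.
Variables (R : realType) (N : nat).
Local Notation X := (one_point_compactification 'rV[R]_N).
Implicit Types (a : R) (A B : 'M[R]_N) (b c d x : 'rV[R]_N).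

(** With at most one inversion, of radius 1, followed by a similarity, there is a single explicit
    formula to differentiate later. *)
Definition moebius_normal (phi : X -> X) : Prop :=
  exists a A b, [/\ 0 < a, A *m A^T = 1%:M &
    phi = similarity a A b \/ exists c, phi = similarity a A b \o inversion c 1].

Lemma orth_mul A B : A *m A^T = 1%:M -> B *m B^T = 1%:M -> (A *m B) *m (A *m B)^T = 1%:M.
Proof. by move=> hA hB; rewrite trmx_mul mulmxA -(mulmxA A) hB mulmx1. Qed.

Lemma sqnorm_orthR A x : A *m A^T = 1%:M -> sqnorm (x *m A) = sqnorm x.
Proof. by move=> h; rewrite /sqnorm (dotp_conformal _ _ h) mul1r. Qed.

Lemma sqnormZ a x : sqnorm (a *: x) = a ^+ 2 * sqnorm x.
Proof. by rewrite /sqnorm dotpZl dotpZr mulrA expr2. Qed.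

Lemma similarity_comp a A b a' A' b' :
  similarity a A b \o similarity a' A' b' =
  similarity (a * a') (A' *m A) (a *: (b' *m A) + b).
Proof.
apply/funext => -[x|]//=; congr Some.
by rewrite mulmxDl scalerDr -!scalemxAl scalerA mulmxA addrA.
Qed.

Lemma inversion_similarity c a A b : 0 < a -> A *m A^T = 1%:M ->
  exists b' c', inversion c 1 \o similarity a A b = similarity a^-1 A b' \o inversion c' 1.
Proof.
move=> a0 hA; have hA' := mulmx1C hA; have an0 : a != 0 by rewrite gt_eqF.
(* [c'] is the preimage of [c] under the similarity: the point that the composite sends to
   infinity. *)
have [c' c'E] : {c' | c' = a^-1 *: ((c - b) *m A^T)} by eexists.
exists (c - a^-1 *: (c' *m A)), c'.
have e : c = a *: (c' *m A) + b.
  by rewrite c'E -scalemxAl scalerA mulfV// scale1r -mulmxA hA' mulmx1 subrK.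
have d x : a *: (x *m A) + b - c = a *: ((x - c') *m A).
  by rewrite {1}e opprD addrACA subrr addr0 mulmxBl scalerBr.
apply/funext => -[x|] /=; last by congr Some; rewrite addrC subrK.
have eqc : (a *: (x *m A) + b == c) = (x == c').
  rewrite -subr_eq0 d scaler_eq0 (negPf an0) /= -sqnorm_eq0 sqnorm_orthR// sqnorm_eq0.
  by rewrite subr_eq0.
rewrite eqc; have [//|xc] := eqVneq x c'; rewrite /similarity; congr Some.
have s0 : sqnorm (x - c') != 0 by rewrite sqnorm_eq0 subr_eq0.
rewrite d sqnormZ sqnorm_orthR// expr1n [(c' + _) *m A]mulmxDl -scalemxAl.
move: (sqnorm _) s0 (_ *m A) (c' *m A) => s s0 p q; apply/rowP => j; rewrite !mxE.
by field; rewrite s0 an0.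
Qed.

Lemma inversion_radius c r : 0 < r ->
  inversion c r = similarity (r ^+ 2) 1%:M ((1 - r ^+ 2) *: c) \o inversion c 1.
Proof.
move=> r0; apply/funext => -[x|] /=; last first.
  by congr Some; rewrite mulmx1 -scalerDl addrC subrK scale1r.
case: eqP => //= _; congr Some.
rewrite mulmx1 expr1n; apply/rowP => j; rewrite !mxE.
by move: (sqnorm _) => s; ring.
Qed.

Lemma inversion_inversion_eq c : inversion c 1 \o inversion c 1 = similarity 1 1%:M 0.
Proof.
apply/funext => -[x|] /=; last by rewrite eqxx.
case: eqP => [->|/eqP xc] /=; first by rewrite mulmx1 scale1r addr0.
have s0 : sqnorm (x - c) != 0 by rewrite sqnorm_eq0 subr_eq0.
rewrite expr1n -subr_eq0 [c + _]addrC addrK scaler_eq0 subr_eq0 (negPf xc) orbF.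
rewrite mul1r invr_eq0 (negPf s0); congr Some.
rewrite mulmx1 scale1r addr0 sqnormZ scalerA.
rewrite (_ : 1 / _ / _ = 1) ?scale1r ?subrKC//.
by rewrite expr2 mulfVK// mul1r invrK divff.
Qed.

(** Householder reflection in the hyperplane orthogonal to [w]; up to scale it is the differential
    of an inversion at distance vector [w] from the centre. *)
Definition reflection (w : 'rV[R]_N) : 'M[R]_N := 1%:M - (2 / sqnorm w) *: (w^T *m w).

Lemma mul_reflection w x : x *m reflection w = x - (2 * dotp x w / sqnorm w) *: w.
Proof.
rewrite /reflection mulmxBr mulmx1 -scalemxAr mulmxA.
have -> : x *m w^T = (dotp x w)%:M by rewrite [LHS]mx11_scalar.
by rewrite mul_scalar_mx scalerA mulrAC.
Qed.

Lemma reflection_orth w : w != 0 -> reflection w *m (reflection w)^T = 1%:M.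
Proof.
move=> w0; have s0 : sqnorm w != 0 by rewrite sqnorm_eq0.
have tr : (reflection w)^T = reflection w.
  by rewrite /reflection linearB /= trmx1 linearZ /= trmx_mul trmxK.
rewrite tr; apply/row_matrixP => i; rewrite !rowE mulmxA mulmx1.
move: (delta_mx 0 i) => x; rewrite !mul_reflection dotpDl dotpNl dotpZl -/(sqnorm w).
move: (sqnorm w) (dotp x w) s0 => s t s0; apply/rowP => j; rewrite !mxE.
by field.
Qed.

Lemma inversion_inversion_neq c d : c != d ->
  exists a A b e, [/\ 0 < a, A *m A^T = 1%:M &
    inversion c 1 \o inversion d 1 = similarity a A b \o inversion e 1].
Proof.
move=> cd; have [w wE] : {w | w = c - d} by eexists.
have w0 : w != 0 by rewrite wE subr_eq0.
have [k kE] : {k | k = sqnorm w} by exists (sqnorm w).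
have k0 : 0 < k by rewrite kE sqnorm_gt0.
have kn : k != 0 by rewrite gt_eqF.
(* [e] is the point that the inversion at [d] sends to [c], hence the composite to infinity. The
   translation in the witness is then fixed by the image of infinity, which is c - w/k. *)
pose e := d + k^-1 *: w; pose A := reflection w.
exists k^-1, A, (c - k^-1 *: w - k^-1 *: (e *m A)), e.
split; [by rewrite invr_gt0|exact: reflection_orth|].
have dE : d = c - w by rewrite wE opprB addrC subrK.
have eqe x : (x == e) = (x - d == k^-1 *: w) by rewrite subr_eq addrC.
have rhs x : x != e -> similarity k^-1 A (c - k^-1 *: w - k^-1 *: (e *m A)) (inversion e 1 (Some x)) =
    Some (c - k^-1 *: w + (k^-1 / sqnorm (x - e)) *: ((x - e) *m A)).
  move=> xe; rewrite /= (negPf xe) /=; congr Some.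
  rewrite mulmxDl scalerDr addrC -!addrA; congr (_ + (_ + _)).
  by rewrite addKr -scalemxAl scalerA expr1n mul1r mulrC.
apply/funext => -[x|]; last first.
  rewrite /= eq_sym (negPf cd); congr Some.
  rewrite [RHS]addrC subrK -[d - c]opprB -wE scalerN /sqnorm dotpNl dotpNr opprK -/(sqnorm w) -kE.
  by rewrite expr1n mul1r.
have [xe|xe] := eqVneq x e.
  have we : x - d = k^-1 *: w by apply/eqP; rewrite -eqe xe.
  have xd : x != d by rewrite -subr_eq0 we scaler_eq0 invr_eq0 negb_or kn.
  rewrite /= xe eqxx -xe (negPf xd) we sqnormZ -kE scalerA.
  rewrite (_ : _ * _ = 1) ?scale1r; last by field.
  by rewrite (_ : d + w = c) /inversion ?eqxx// wE addrC subrK.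
rewrite [RHS]rhs//.
have ve : x - e = (x - d) - k^-1 *: w by rewrite /e opprD addrA.
have v0 : sqnorm (x - e) != 0 by rewrite sqnorm_eq0 subr_eq0.
have [xd|xd] := eqVneq x d.
  rewrite /= xd eqxx; congr Some; rewrite -xd ve xd subrr sub0r.
  have n1 : sqnorm (- (k^-1 *: w)) = k^-1.
    by rewrite /sqnorm dotpNl dotpNr opprK -/(sqnorm _) sqnormZ -kE expr2 mulfVK.
  have n2 : dotp (- (k^-1 *: w)) w = -1.
    by rewrite dotpNl dotpZl -/(sqnorm w) -kE mulVf.
  rewrite /A mul_reflection n1 n2 -kE; apply/rowP => j; rewrite !mxE.
  by field.
have u0 : sqnorm (x - d) != 0 by rewrite sqnorm_eq0 subr_eq0.
have [u uE] : {u | u = x - d} by eexists.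
have [v vE] : {v | v = x - e} by eexists.
rewrite -vE -uE in ve; rewrite -uE in u0; rewrite -vE in v0.
have vs : sqnorm v = sqnorm u - 2 / k * dotp u w + k^-1.
  rewrite ve /sqnorm dotpDl !dotpDr !dotpNl !dotpNr !dotpZl !dotpZr (dotpC w u).
  by rewrite -/(sqnorm w) -kE; move: (dotp u w) (dotp u u) => p q; field.
have yc : d + (1 ^+ 2 / sqnorm u) *: u - c = (sqnorm u)^-1 *: u - w.
  by rewrite expr1n mul1r addrAC -opprB -wE addrC.
have ys : sqnorm ((sqnorm u)^-1 *: u - w) = k * sqnorm v / sqnorm u.
  rewrite vs /sqnorm dotpDl !dotpDr !dotpNl !dotpNr !dotpZl !dotpZr (dotpC w u).
  rewrite -/(sqnorm u) -/(sqnorm w) -kE; move: (sqnorm u) (dotp u w) u0 => p q p0.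
  by field; rewrite p0 kn.
rewrite /= (negPf xd) -uE /= -subr_eq0 yc -sqnorm_eq0 ys.
rewrite !mulf_eq0 invr_eq0 (negPf u0) (negPf v0) (negPf kn) /=; congr Some.
rewrite -vE /A mul_reflection -kE.
have vw : dotp v w = dotp u w - 1.
  by rewrite ve dotpDl dotpNl dotpZl -/(sqnorm w) -kE mulVf.
have uv : u = v + k^-1 *: w by rewrite ve subrK.
rewrite vw expr1n [X in _ *: X - w]uv.
have us : sqnorm u = sqnorm v + 2 / k * dotp u w - k^-1 by rewrite vs; ring.
move: (sqnorm u) (sqnorm v) (dotp u w) us u0 v0 => p q t pE p0 q0.
apply/rowP => j; rewrite !mxE.
have tE : t = k / 2 * (p - q + k^-1) by rewrite pE; field.
by rewrite tE; field; rewrite q0 kn p0.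
Qed.

Lemma moebius_normal_sim a A b phi : 0 < a -> A *m A^T = 1%:M ->
  moebius_normal phi -> moebius_normal (similarity a A b \o phi).
Proof.
move=> a0 hA [a' [A' [b' [a'0 hA' h]]]].
exists (a * a'), (A' *m A), (a *: (b' *m A) + b); split; [exact: mulr_gt0|exact: orth_mul|].
by case: h => [->|[c ->]]; [left|right; exists c]; rewrite -similarity_comp.
Qed.

(** In a composite of two normal forms, the similarity between the inversions is moved to the left
    past the inversion there, and the two inversions that become adjacent merge. *)
Lemma moebius_normalP phi : moebius phi -> moebius_normal phi.
Proof.
elim=> [a A b a0 hA|c r r0|{}phi psi _ h1 _ h2].
- by exists a, A, b; split=> //; left.
- exists (r ^+ 2), 1%:M, ((1 - r ^+ 2) *: c); split; first by rewrite exprn_gt0.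
    by rewrite trmx1 mulmx1.
  by right; exists c; exact: inversion_radius.
- case: h1 => a [A [b [a0 hA [->|[c ->]]]]]; first exact: moebius_normal_sim.
  apply: (@moebius_normal_sim a A b (inversion c 1 \o psi)) => //.
  case: h2 => a' [A' [b' [a'0 hA' h]]].
  have [b2 [c2 e]] := inversion_similarity c b' a'0 hA'.
  have ia : 0 < a'^-1 by rewrite invr_gt0.
  case: h => [->|[d ->]].
    by rewrite e; exists a'^-1, A', b2; split=> //; right; exists c2.
  rewrite compA e -compA; apply: moebius_normal_sim => //.
  have [->|cd] := eqVneq c2 d.
    rewrite inversion_inversion_eq; exists 1, 1%:M, 0; split=> //; last by left.
    by rewrite trmx1 mulmx1.
  have [a3 [A3 [b3 [e3 [a30 hA3 ->]]]]] := inversion_inversion_neq cd.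
  by exists a3, A3, b3; split=> //; right; exists e3.
Qed.

(* F is the image of f under a Moebius transformation finite on f *)
Definition conformal_rel T (f F : T -> 'rV[R]_N) : Prop :=
  exists a A b, [/\ 0 < a, A *m A^T = 1%:M &
    (forall t, F t = a *: (f t *m A) + b) \/
    exists c, forall t, f t != c /\ F t = b + (a / sqnorm (f t - c)) *: ((f t - c) *m A)].

Lemma moebius_conformal_rel phi T (f F : T -> 'rV[R]_N) : moebius phi ->
  moebius_image phi f F -> conformal_rel f F.
Proof.
move=> /moebius_normalP[a [A [b [a0 hA h]]]] im; case: h => [e|[c e]].
  by exists a, A, b; split=> //; left => t; have := im t; rewrite e => -[].
exists a, A, (a *: (c *m A) + b); split=> //; right; exists c => t.
have := im t; rewrite e /=; case: eqP => // /eqP fc [<-]; split=> //.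
rewrite mulmxDl scalerDr addrAC -scalemxAl scalerA expr1n mul1r; by [].
Qed.

(** For an inversion the inverse has the same form, with the centre [c] and the value [b] at
    infinity exchanged. *)
Lemma conformal_rel_sym T (f F : T -> 'rV[R]_N) : conformal_rel f F -> conformal_rel F f.
Proof.
move=> [a [A [b [a0 hA h]]]]; have hA' := mulmx1C hA; have an : a != 0 by rewrite gt_eqF.
have hAt : A^T *m A^T^T = 1%:M by rewrite trmxK.
case: h => [h|[c h]].
  exists a^-1, A^T, (- (a^-1 *: (b *m A^T))); split=> //; first by rewrite invr_gt0.
  left=> t; rewrite h mulmxDl scalerDr addrK -scalemxAl scalerA mulVf// scale1r.
  by rewrite -mulmxA hA mulmx1.
exists a, A^T, c; split=> //; right; exists b => t; have [fc e] := h t.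
have s0 : sqnorm (f t - c) != 0 by rewrite sqnorm_eq0 subr_eq0.
have Fb : F t - b = (a / sqnorm (f t - c)) *: ((f t - c) *m A) by rewrite e addrC addKr.
have sF : sqnorm (F t - b) = a ^+ 2 / sqnorm (f t - c).
  by rewrite Fb sqnormZ sqnorm_orthR//; move: (sqnorm _) s0 => s s0; field.
split.
  by rewrite -subr_eq0 -sqnorm_eq0 sF mulf_eq0 invr_eq0 sqrf_eq0 negb_or an.
rewrite sF Fb -scalemxAl -mulmxA hA mulmx1 scalerA (_ : _ * _ = 1).
  by rewrite scale1r addrC subrK.
by move: (sqnorm _) s0 => s s0; field; rewrite s0 an.
Qed.

End NormalForm.

Section ConformalDerivatives.
Variables (R : realType) (n N : nat).
Variables (f F : 'rV[R]_n -> 'rV[R]_N).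

Lemma conformal_rel_vsmooth : vsmooth f -> conformal_rel f F -> vsmooth F.
Proof.
move=> sf [a [A [b [a0 hA [h|[c h]]]]]].
  have -> : F = (fun x => f x *m (a *: A) + b).
    by apply/funext => x; rewrite h -scalemxAr.
  by apply: vsmoothD; [exact: vsmooth_mulmx|exact: vsmooth_cst].
have -> : F = (fun x => b + (sqnorm (f x - c))^-1 *: ((f x - c) *m (a *: A))).
  by apply/funext => x; rewrite (h x).2 -scalemxAr scalerA mulrC.
have sY : vsmooth (fun x => f x - c) by apply: vsmoothD => //; exact: vsmooth_cst.
apply: vsmoothD; first exact: vsmooth_cst.
apply: vsmoothZ; last exact: vsmooth_mulmx.
apply: smoothV; last exact: smooth_dotpf.
by move=> x; rewrite sqnorm_eq0 subr_eq0 (h x).1.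
Qed.

(** The Hessian has the shape that [conformal_pointwise] expects, with p = 0 for a similarity. For
    an inversion, [O] is a multiple of the reflection in Y = f - c followed by [A], and p = -2
    Y/|Y|^2. *)
Lemma conformal_rel_derivatives : vsmooth f -> conformal_rel f F -> forall x,
  exists (O : 'M[R]_N) rho p, [/\ 0 < rho, O *m O^T = rho%:M,
    forall v, vd v F x = vd v f x *m O &
    forall v w, vd v (vd w F) x =
      (vd v (vd w f) x - dotp (vd v f x) (vd w f x) *: p +
       (dotp p (vd v f x) *: vd w f x + dotp p (vd w f x) *: vd v f x)) *m O].
Proof.
move=> sf [a [A [b [a0 hA [h|[c h]]]]]] x.
  have FE : F = (fun x => f x *m (a *: A) + b).
    by apply/funext => y; rewrite h -scalemxAr.
  have d v : vd v F = (fun x => vd v f x *m (a *: A)).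
    apply/funext => y; rewrite FE vdD; [|exact: vsmooth_mulmx|exact: vsmooth_cst].
    by rewrite vd_cst addr0 vd_mulmx.
  exists (a *: A), (a ^+ 2), 0; split; first by rewrite exprn_gt0.
  - by rewrite linearZ /= -scalemxAl -scalemxAr scalerA hA scalemx1 expr2.
  - by move=> v; rewrite d.
  - move=> v w; rewrite d vd_mulmx; last exact: vsmooth_vd.
    by rewrite !dotp0l !scale0r scaler0 subr0 !addr0.
pose Y x := f x - c; pose s x := (sqnorm (Y x))^-1.
have Y0 y : Y y != 0 by rewrite subr_eq0 (h y).1.
have q0 y : sqnorm (Y y) != 0 by rewrite sqnorm_eq0.
have sY : vsmooth Y by apply: vsmoothD => //; exact: vsmooth_cst.
have dY v : vd v Y = vd v f.
  by apply/funext => y; rewrite vdD ?vd_cst ?addr0//; exact: vsmooth_cst.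
have sq : smooth (fun y => sqnorm (Y y)) by exact: smooth_dotpf.
have ss : smooth s by exact: smoothV.
pose B := a *: A.
have FE : F = (fun x => b + s x *: (Y x *m B)).
  by apply/funext => y; rewrite (h y).2 -scalemxAr scalerA mulrC.
have ds v : dd v s = (fun y => - (2 * dotp (vd v f y) (Y y) * (s y * s y))).
  apply/funext => y; rewrite /s ddV// dd_dotpf// dY (dotpC (Y y)).
  by congr (- (_ * _)); ring.
have sYB : vsmooth (fun y => Y y *m B) by exact: vsmooth_mulmx.
have sfv v : vsmooth (vd v f) by exact: vsmooth_vd.
have sfB v : vsmooth (fun y => vd v f y *m B) by exact: vsmooth_mulmx.
have dF v : vd v F = (fun y => dd v s y *: (Y y *m B) + s y *: (vd v f y *m B)).
  apply/funext => y; rewrite FE vdD; [|exact: vsmooth_cst|exact: vsmoothZ].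
  by rewrite vd_cst add0r vdZ// vd_mulmx// dY.
have sds v : smooth (dd v s) by exact: smooth_dd.
have dds v w : dd v (dd w s) x = - (2 * (dotp (vd v (vd w f) x) (Y x) +
     dotp (vd v f x) (vd w f x)) * (s x * s x) +
     2 * dotp (vd w f x) (Y x) * (2 * s x * dd v s x)).
  have s1 : smooth (fun y => dotp (vd w f y) (Y y)) by exact: smooth_dotpf.
  rewrite [dd w s]ds ddN; last first.
    by apply: smoothM; [exact: smoothZ|exact: smoothM].
  rewrite ddM; [|exact: smoothZ|exact: smoothM].
  rewrite ddZ// ddM// dd_dotpf// dY [dotp (vd w f x) (vd v f x)]dotpC.
  by move: (dd v s x) (s x) (dotp _ _) (dotp _ _) (dotp _ _) => u v1 v2 v3 v4; ring.
pose O := (a * s x) *: (reflection (Y x) *m A).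
have uO u : u *m O = (s x *: (u - (2 * s x * dotp u (Y x)) *: Y x)) *m B.
  rewrite /O /B -!scalemxAr mulmxA mul_reflection -scalemxAl scalerA; congr (_ *: (_ *m _)).
  by rewrite /s mulrAC.
have s0 : 0 < s x by rewrite invr_gt0 sqnorm_gt0.
exists O, ((a * s x) ^+ 2), (- (2 * s x) *: Y x); split.
- by rewrite exprn_gt0// mulr_gt0.
- rewrite /O linearZ /= -scalemxAl -scalemxAr scalerA orth_mul ?scalemx1 -?expr2//.
  exact: reflection_orth.
- move=> v; rewrite dF ds uO scalemxAl scalemxAl -mulmxDl; congr (_ *m _).
  move: (s x) (dotp _ _) => t q; apply/rowP => j; rewrite !mxE.
  by ring.
- move=> v w; rewrite dF vdD; [|exact: vsmoothZ|exact: vsmoothZ].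
  rewrite !vdZ// !vd_mulmx// dY uO -addrA !scalemxAl -!mulmxDl; congr (_ *m _).
  rewrite dds !ds !dotpDl !dotpNl !dotpZl.
  have -> : dotp (Y x) (Y x) = (s x)^-1 by rewrite /s invrK.
  rewrite (dotpC (Y x) (vd v f x)) (dotpC (Y x) (vd w f x)).
  move: (lt0r_neq0 s0); move: (s x) (dotp (vd v (vd w f) x) (Y x)) (dotp (vd v f x) (Y x))
    (dotp (vd w f x) (Y x)) (dotp (vd v f x) (vd w f x)) => t g al be de t0.
  move: (vd v (vd w f) x) (vd v f x) (vd w f x) (Y x) => U W Z y.
  by apply/rowP => j; rewrite !mxE; field.
Qed.

End ConformalDerivatives.

Section WillmoreFlat.
Variables (R : realType) (n N : nat) (V : 'M[R]_n).
Hypothesis hn : (1 < n)%N.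
Hypothesis hV : V \in unitmx.
Local Notation e_ i := (delta_mx 0 i : 'rV[R]_n).

Lemma conformal_rel_lift (f F : torus V -> 'rV[R]_N) : conformal_rel f F ->
  conformal_rel (torus_lift f) (torus_lift F).
Proof.
move=> [a [A [b [a0 hA h]]]]; exists a, A, b; split=> //.
by case: h => [h|[c h]]; [left => t; exact: h|right; exists c => t; exact: h].
Qed.

Lemma smooth_periodic_sqnorm_vlapl (G : 'rV[R]_n -> 'rV[R]_N) : vsp V G ->
  smooth_periodic V (fun x => sqnorm (vlapl G x)).
Proof.
move=> sG; have sL : vsp V (vlapl G) by apply: vsp_sum => i; do 2 apply: vsp_vd.
exact: vsp_dotp.
Qed.

(** For the flat [F] the Gauss equation turns the trace-free norm into (n - 1)/n times |Lap F|^2.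
    This factor cancels the normalisation in W, and rho^(-n/2) cancels the volume density. *)
Theorem willmore_flat (f F : torus V -> 'rV[R]_N) : vsp V (torus_lift F) ->
  (forall x i k, dotp (vd (e_ i) (torus_lift F) x) (vd (e_ k) (torus_lift F) x) = (i == k)%:R) ->
  conformal_rel F f ->
  willmore f = torus_integral V (fun x => sqnorm (vlapl (torus_lift F) x) `^ (n%:R / 2)).
Proof.
move=> sF flat rel; have sF' := vsp_smooth sF.
have relL := conformal_rel_lift rel.
have sf : vsmooth (torus_lift f) := conformal_rel_vsmooth sF' relL.
have n0 : (0 < n)%N by exact: ltnW.
have nR : 1 < n%:R :> R by rewrite ltr1n.
have nn0 : n%:R != 0 :> R by rewrite gt_eqF//; lra.
have n1 : n%:R - 1 != 0 :> R by rewrite gt_eqF//; lra.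
pose g x := sqnorm (vlapl (torus_lift F) x).
have g0 x : 0 <= g x by exact: sqnorm_ge0.
pose K : R := ((n%:R - 1) / n%:R) `^ (n%:R / 2).
have pt x : (sqnorm_second_ff f x - n%:R * sqnorm (mean_curvature f x)) `^ (n%:R / 2)
    * volume_density f x = K * g x `^ (n%:R / 2).
  have [M [rho [p [rho0 hO d1 d2]]]] := conformal_rel_derivatives sF' relL x.
  have [J JE] : {J | J = 'J (torus_lift F) x} by eexists.
  have Jrow i : row i J = vd (e_ i) (torus_lift F) x by rewrite JE jacobianE.
  have hP : J *m J^T = 1%:M.
    by apply/matrixP => i k; rewrite JE (gram_jacobian _ _ _ sF') flat mxE.
  have hJ : 'J (torus_lift f) x = J *m M.
    by apply/row_matrixP => i; rewrite (jacobianE x i sf) row_mul Jrow d1.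
  have FP i j : hess (torus_lift F) i j x *m J^T = 0.
    apply/rowP => k; rewrite [RHS]mxE -dotp_row Jrow.
    exact: (flat_normal hV sF flat).
  have h2 i j : partial i (partial j (torus_lift f)) x =
     (hess (torus_lift F) i j x + (i == j)%:R *: - p +
      (dotp p (vd (e_ i) (torus_lift F) x) *: e_ j +
       dotp p (vd (e_ j) (torus_lift F) x) *: e_ i) *m J) *m M.
    rewrite (partialE j sf) (partialE i (vsmooth_vd (e_ j) sf)).
    rewrite d2 flat scalerN; congr (_ *m M); congr (_ + _).
    by rewrite mulmxDl -!scalemxAl -!rowE !Jrow.
  have [-> ->] := conformal_pointwise n0 rho0 hO hP hJ FP h2.
  have e1 : \sum_i \sum_j sqnorm (hess (torus_lift F) i j x) = g x.
    exact: (flat_gauss hV sF flat).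
  have -> : \sum_i \sum_j sqnorm (hess (torus_lift F) i j x) -
       n%:R^-1 * sqnorm (\sum_i hess (torus_lift F) i i x) = (n%:R - 1) / n%:R * g x.
    rewrite e1 -/(vlapl (torus_lift F) x) -/(g x); move: (g x) => t.
    by field.
  have c0 : 0 <= (n%:R - 1) / n%:R :> R by rewrite divr_ge0//; lra.
  have r0 : 0 <= rho by exact: ltW.
  have -> : Num.sqrt (rho ^+ n) = rho `^ (n%:R / 2).
    by rewrite powRrM powR_mulrn// powR12_sqrt// exprn_ge0.
  have i0 : 0 <= rho^-1 by rewrite invr_ge0.
  have cg : 0 <= (n%:R - 1) / n%:R * g x by exact: mulr_ge0.
  rewrite (powRM _ i0 cg) (powRM _ c0 (g0 x)) -/K mulrAC -(powRM _ i0 r0).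
  by rewrite mulVf ?gt_eqF// powR1 mul1r.
have bg : bl (fun u => g (u *m V^T)) := bl_pull (smooth_periodic_sqnorm_vlapl sF).
have s1 : 1 <= n%:R / 2 :> R by rewrite ler_pdivlMr// mul1r ler_nat.
have bp : bl (fun u => g (u *m V^T) `^ (n%:R / 2)) by exact: bl_powR.
rewrite /willmore /torus_integral.
have -> : (fun u : 'rV[R]_n =>
    (sqnorm_second_ff f (u *m V^T) - n%:R * sqnorm (mean_curvature f (u *m V^T))) `^ (n%:R / 2)
    * volume_density f (u *m V^T)) = (fun u => K * g (u *m V^T) `^ (n%:R / 2)).
  by apply/funext => u; exact: pt.
rewrite cube_integralZ// mulrCA; congr (_ * _).
rewrite mulrA /K -powRM ?divr_ge0//; [|lra|lra].
by rewrite mulrA divfK// divff// powR1 mul1r.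
Qed.

End WillmoreFlat.

(** * The lower bound *)

Section EnergyBound.
Variables (R : realType) (n N : nat) (V : 'M[R]_n).
Hypothesis hn : (1 < n)%N.
Hypothesis hV : V \in unitmx.
Local Notation e_ i := (delta_mx 0 i : 'rV[R]_n).
Variable G : 'rV[R]_n -> 'rV[R]_N.
Hypothesis sG : vsp V G.
Hypothesis flat : forall x i k, dotp (vd (e_ i) G x) (vd (e_ k) G x) = (i == k)%:R.
Local Notation comp j := (fun x => G x 0 j).

Lemma vlapl_comp x j : vlapl G x 0 j = lapl (comp j) x.
Proof.
rewrite /vlapl summxE; apply: eq_bigr => i _; rewrite /hess mxE.
by rewrite vdE.
Qed.

Lemma avg_sqnorm_vlapl : avg V (fun x => sqnorm (vlapl G x)) =
  \sum_j avg V (fun x => lapl (comp j) x * lapl (comp j) x).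
Proof.
rewrite -avg_sum => [|j]; last by apply: smooth_periodicM; exact: smooth_periodic_lapl.
congr (avg V _); apply/funext => x; rewrite /sqnorm dotp_sum.
by apply: eq_bigr => j _; rewrite vlapl_comp.
Qed.

Lemma flat_dotp v w x : dotp (vd v G x) (vd w G x) = dotp v w.
Proof.
have vE u : vd u G x = \sum_i u 0 i *: vd (e_ i) G x.
  apply/rowP => j; rewrite mxE dd_coord; last exact: (sG j).1.
  by rewrite summxE; apply: eq_bigr => i _; rewrite !mxE.
rewrite !vE dotp_suml dotp_sum; apply: eq_bigr => i _.
rewrite dotp_sumr (bigD1 i)//= big1 => [|k ki].
  by rewrite dotpZl dotpZr flat eqxx addr0 mulr1.
by rewrite dotpZl dotpZr flat eq_sym (negPf ki) !mulr0.
Qed.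

Lemma avg_direction v : \sum_j avg V (fun x => dd v (comp j) x * dd v (comp j) x) = sqnorm v.
Proof.
rewrite -avg_sum => [|j]; last by apply: smooth_periodicM; exact: smooth_periodic_dd.
rewrite -[RHS](avg_cst V); congr (avg V _); apply/funext => x.
rewrite /sqnorm -(flat_dotp v v x) dotp_sum.
by apply: eq_bigr => j _; rewrite mxE.
Qed.

(** With m the mean of the [lam i], the gap gives a >= 4 pi^2 n m, and the certificate gives |det V|
    m^(n/2) >= 1. In the equality case only frequencies of squared length 0 or 4 pi^2 c survive. *)
Theorem energy_bound (a := avg V (fun x => sqnorm (vlapl G x))) :
  (4 * n%:R * pi ^+ 2) `^ (n%:R / 2) <= `|\det V| * a `^ (n%:R / 2) /\
  (`|\det V| * a `^ (n%:R / 2) = (4 * n%:R * pi ^+ 2) `^ (n%:R / 2) ->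
   exists (c : R) (L : 'M[int]_n), [/\ 0 < c, (`|\det L| = 1)%N,
     (map_mx intr L *m invmx V) *m (map_mx intr L *m invmx V)^T = c%:M &
     forall j l, sqnorm (freq V l) ^+ 2 != 4 * pi ^+ 2 * (c * sqnorm (freq V l)) ->
       cos_coef V l (comp j) = 0 /\ sin_coef V l (comp j) = 0]).
Proof.
have n0 : (0 < n)%N by exact: ltnW.
have [Q [lam [orth lam0 cert h1 h2]]] := lattice_certificate hV n0.
have nR : 0 < n%:R :> R by rewrite ltr0n.
have s0 : 0 < n%:R / 2 :> R by rewrite divr_gt0.
pose m := (\sum_i lam i) / n%:R; rewrite -/m in h1 h2.
have S0 : 0 <= \sum_i lam i by apply: sumr_ge0 => i _; exact: ltW.
have m0 : 0 <= m by rewrite divr_ge0// ltW.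
have Sm : \sum_i lam i = n%:R * m by rewrite /m mulrC divfK// gt_eqF.
have p2 : 0 < 4 * pi ^+ 2 :> R by rewrite mulr_gt0// exprn_gt0// pi_gt0.
have qn i : sqnorm (row i Q) = 1.
  have := congr1 (fun M : 'M[R]_n => M i i) orth; rewrite !mxE eqxx /sqnorm dotp_sum; apply: etrans.
  by apply: eq_bigr => k _; rewrite !mxE.
(* Summed over the components, the energy along q_i is |q_i|^2 = 1 by flatness, so the gap forms add
   up to the defect in the bound for [a]. When that is 0, each of them vanishes. *)
have gE : a - 4 * pi ^+ 2 * (n%:R * m) = \sum_j gap_form V Q lam (comp j) (comp j).
  rewrite /gap_form sumrB -avg_sqnorm_vlapl -/a -mulr_sumr -Sm; congr (_ - _ * _).
  rewrite exchange_big /=; apply: eq_bigr => i _.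
  by rewrite -mulr_sumr avg_direction qn mulr1.
have g0 j : 0 <= gap_form V Q lam (comp j) (comp j) by exact: gap_form_ge0.
have aS : 4 * pi ^+ 2 * (n%:R * m) <= a by rewrite -subr_ge0 gE sumr_ge0.
have nm0 : 0 <= 4 * n%:R * pi ^+ 2 :> R by rewrite !mulr_ge0 ?exprn_ge0 ?pi_ge0.
have aS' : 4 * n%:R * pi ^+ 2 * m <= a by rewrite (_ : _ * m = 4 * pi ^+ 2 * (n%:R * m))//; ring.
have a0 : 0 <= a by apply: le_trans aS'; exact: mulr_ge0.
have D0 : \det V != 0 by rewrite -unitfE -unitmxE.
have [d [dE d0]] : exists d, d = `|\det V| /\ 0 < d by exists `|\det V|; rewrite normr_gt0.
have d2 : (\det V)^-1 ^+ 2 = d^-1 ^+ 2 by rewrite dE !exprVn real_normK ?num_real.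
have mZ : (m `^ (n%:R / 2)) ^+ 2 = m ^+ n.
  rewrite -powR_mulrn ?powR_ge0// -powRrM -powR_mulrn//; congr (_ `^ _).
  by rewrite divfK.
have Z0 : 0 <= m `^ (n%:R / 2) := powR_ge0 _ _.
have dZ : 1 <= d * m `^ (n%:R / 2).
  have : d^-1 <= m `^ (n%:R / 2).
    by rewrite -(@ler_pXn2r _ 2)// ?nnegrE ?invr_ge0 ?(ltW d0)// mZ -d2.
  by move=> h; have := ler_wpM2l (ltW d0) h; rewrite mulfV// gt_eqF.
have Y0 : 0 < (4 * n%:R * pi ^+ 2) `^ (n%:R / 2) :> R.
  by apply: powR_gt0; rewrite !mulr_gt0 ?pi_gt0.
have XYZ : (4 * n%:R * pi ^+ 2) `^ (n%:R / 2) * m `^ (n%:R / 2) <= a `^ (n%:R / 2).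
  rewrite -(powRM _ nm0 m0); apply: ge0_ler_powR aS'; first exact: ltW.
    by rewrite nnegrE mulr_ge0.
  by rewrite nnegrE.
set Y := (4 * n%:R * pi ^+ 2) `^ (n%:R / 2) in Y0 XYZ *.
rewrite -dE; split.
  apply: le_trans (ler_wpM2l (ltW d0) XYZ).
  by rewrite [leRHS]mulrCA -[leLHS]mulr1 ler_wpM2l// ltW.
move=> e.
have dZ1 : d * m `^ (n%:R / 2) = 1.
  apply/le_anti; rewrite dZ andbT -(ler_pM2l Y0) mulr1 [leLHS]mulrCA -[leRHS]e.
  by rewrite ler_pM2l.
have mn : m ^+ n = (\det V)^-1 ^+ 2.
  rewrite -mZ d2; congr (_ ^+ 2); apply: (mulfI (lt0r_neq0 d0)).
  by rewrite dZ1 divff// gt_eqF.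
have aE : a = 4 * n%:R * pi ^+ 2 * m.
  have : a `^ (n%:R / 2) = (4 * n%:R * pi ^+ 2 * m) `^ (n%:R / 2).
    rewrite (powRM _ nm0 m0) -/Y; apply: (mulfI (lt0r_neq0 d0)).
    by rewrite e [RHS]mulrCA dZ1 mulr1.
  by apply: (powR_injective s0); rewrite nnegrE// mulr_ge0.
have [c [L [c0 lamc detL XX]]] := h2 mn.
exists c, L; split=> // j l gl.
have gz : gap_form V Q lam (comp j) (comp j) = 0.
  have /eqP : \sum_j gap_form V Q lam (comp j) (comp j) = 0.
    by rewrite -gE aE; ring.
  by rewrite psumr_eq0// => /allP/(_ j (mem_index_enum _))/eqP.
apply: (gap_form_coef hV lam0 cert (sG j) gz).
rewrite /gap subr_eq0 (_ : \sum_i _ = c * sqnorm (freq V l))//.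
rewrite (sqnorm_orth _ orth) mulr_sumr; apply: eq_bigr => i _.
by rewrite lamc.
Qed.

End EnergyBound.

(** * Rigidity of conformal Clifford maps *)

Section Rigidity.
Variables (R : realType) (n : nat) (V : 'M[R]_n).
Hypothesis hn : (1 < n)%N.
Hypothesis hV : V \in unitmx.
Local Notation e_ i := (delta_mx 0 i : 'rV[R]_n).

Lemma delta_sum (i : 'I_n) (x : 'I_n -> R) : \sum_j (i == j)%:R * x j = x i.
Proof.
rewrite (bigD1 i)//= eqxx mul1r big1 ?addr0// => j ji.
by rewrite eq_sym (negPf ji) mul0r.
Qed.

(** With x the gradient of mu, this is 4 times the sum of the squared symbols computed in
    [christoffel]. *)
Lemma christoffel_norm (x : 'I_n -> R) :
  \sum_k \sum_l \sum_m ((l == m)%:R * x k + (k == m)%:R * x l - (k == l)%:R * x m) ^+ 2 =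
  (3 * n%:R - 2) * \sum_k x k ^+ 2.
Proof.
set g := \sum_k x k ^+ 2.
have inner k l : \sum_m ((l == m)%:R * x k + (k == m)%:R * x l - (k == l)%:R * x m) ^+ 2 =
    x k ^+ 2 + x l ^+ 2 + (k == l)%:R * (g - 2 * (x k * x l)).
  have -> : \sum_m ((l == m)%:R * x k + (k == m)%:R * x l - (k == l)%:R * x m) ^+ 2 =
     \sum_m ((l == m)%:R * (x k ^+ 2 + (k == m)%:R * (2 * x k * x l) -
                (k == l)%:R * (2 * x k * x m)) +
             (k == m)%:R * (x l ^+ 2 - (k == l)%:R * (2 * x l * x m)) +
             (k == l)%:R * x m ^+ 2).
    apply: eq_bigr => m _.
    by case: (l == m); case: (k == m); case: (k == l) => /=; ring.
  rewrite !big_split /= !delta_sum -mulr_sumr -/g.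
  by move: ((k == l)%:R) => b; ring.
under eq_bigr do under eq_bigr do rewrite inner.
have -> : \sum_k \sum_l (x k ^+ 2 + x l ^+ 2 + (k == l)%:R * (g - 2 * (x k * x l))) =
   \sum_k (n%:R * x k ^+ 2 + g + (g - 2 * x k ^+ 2)).
  apply: eq_bigr => k _; rewrite !big_split /= delta_sum sumr_const card_ord.
  by rewrite -/g -[x k * x k]expr2 -[_ *+ n]mulr_natl.
rewrite !big_split /= -mulr_sumr -/g sumr_const card_ord -[g *+ n]mulr_natl.
rewrite sumrN -mulr_sumr -/g; ring.
Qed.

Variables (al : 'I_n -> 'rV[R]_n -> 'rV[R]_n) (mu : 'rV[R]_n -> R).
Hypothesis sal : forall k, vsp V (al k).
Hypothesis closed_al : forall k l x, vd (e_ k) (al l) x = vd (e_ l) (al k) x.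
Hypothesis conf : forall k l x, dotp (al k x) (al l x) = (k == l)%:R * mu x.
Hypothesis mu0 : forall x, 0 < mu x.

Lemma conformal_factor_smooth : smooth_periodic V mu.
Proof.
have i0 : 'I_n := Ordinal (ltnW hn).
have -> : mu = (fun x => dotp (al i0 x) (al i0 x)).
  by apply/funext => x; rewrite conf eqxx mul1r.
exact: vsp_dotp.
Qed.

Let smu := conformal_factor_smooth.

(** Koszul's formula: closedness makes the symbol symmetric in k, l, and differentiating the Gram
    matrix gives three permuted relations that determine it. *)
Lemma christoffel k l m x : dotp (vd (e_ k) (al l) x) (al m x) =
  2^-1 * ((l == m)%:R * dd (e_ k) mu x + (k == m)%:R * dd (e_ l) mu x -
          (k == l)%:R * dd (e_ m) mu x).
Proof.
pose T k l m := dotp (vd (e_ k) (al l) x) (al m x).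
have Ts i j p : T i j p = T j i p by rewrite /T closed_al.
have Ta i j p : T i j p + T i p j = (j == p)%:R * dd (e_ i) mu x.
  have := dd_dotpf (e_ i) x (vsp_smooth (sal j)) (vsp_smooth (sal p)).
  have -> : (fun y => dotp (al j y) (al p y)) = (fun y => (j == p)%:R * mu y).
    by apply/funext => y; exact: conf.
  rewrite (ddZ _ _ _ smu.1) => ->; congr (_ + _); exact: dotpC.
have := (Ta k l m, Ta l k m, Ta m k l); rewrite -/(T k l m).
rewrite (Ts k m l) (Ts l m k) (Ts l k m).
move: (T k l m) (T m k l) (T m l k) => a b c [[<- <-] <-].
by field.
Qed.

(** The n vectors [al m x] lie in R^n, are orthogonal and have squared length mu, so they form a
    basis. Derivatives of the frame thus have no component outside it, and their norms can be read
    off from the symbols in [christoffel]. *)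
Lemma frame_parseval x (u v : 'rV[R]_n) :
  mu x * dotp u v = \sum_m dotp u (al m x) * dotp v (al m x).
Proof.
pose M : 'M[R]_n := \matrix_(k, j) al k x 0 j.
have rM k : row k M = al k x by apply/rowP => j; rewrite !mxE.
have MM : M *m ((mu x)^-1 *: M^T) = 1%:M.
  rewrite -scalemxAr; apply/matrixP => i j; rewrite !mxE.
  have -> : \sum_k M i k * M^T k j = (i == j)%:R * mu x.
    by rewrite -conf dotp_sum; apply: eq_bigr => k _; rewrite !mxE.
  by rewrite mulrCA mulVf ?mulr1// gt_eqF.
have {}MM := mulmx1C MM.
have MM' : M^T *m M = (mu x)%:M.
  by rewrite -[RHS]scalemx1 -MM -scalemxAl scalerA mulfV ?scale1r// gt_eqF.
have -> : mu x * dotp u v = dotp (u *m M^T) (v *m M^T).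
  by rewrite dotp_mulmx trmxK -mulmxA MM' mul_mx_scalar dotpZr.
by rewrite dotp_sum; apply: eq_bigr => m _; rewrite -!dotp_row rM.
Qed.

(** The metric mu g_0 is locally the pullback of a flat metric on R^n, so its scalar curvature is 0.
    The constant comes from (n - 2)^2 - (3 n - 2) = (n - 1)(n - 6), divided by 1 - n. *)
Lemma scalar_curvature x :
  mu x * lapl mu x = (6 - n%:R) / 4 * \sum_k dd (e_ k) mu x ^+ 2.
Proof.
set g := \sum_k _.
have := gauss_identity hV x sal closed_al.
have -> : \sum_k \sum_l (dd (e_ k) (dd (e_ l) (fun y => dotp (al k y) (al l y))) x -
     dd (e_ k) (dd (e_ k) (fun y => dotp (al l y) (al l y))) x) = (1 - n%:R) * lapl mu x.
  have d k l : (fun y => dotp (al k y) (al l y)) = (fun y => (k == l)%:R * mu y).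
    by apply/funext => y; exact: conf.
  have dz v c : dd v (fun y => c * mu y) = (fun y => c * dd v mu y).
    by apply/funext => y; rewrite ddZ//; exact: smu.1.
  have e k l : dd (e_ k) (dd (e_ l) (fun y => dotp (al k y) (al l y))) x -
     dd (e_ k) (dd (e_ k) (fun y => dotp (al l y) (al l y))) x =
     (k == l)%:R * dd (e_ k) (dd (e_ l) mu) x - dd (e_ k) (dd (e_ k) mu) x.
    by rewrite !d !dz eqxx !ddZ ?mul1r//; apply: smooth_dd; exact: smu.1.
  under eq_bigr do under eq_bigr do rewrite e.
  under eq_bigr do rewrite sumrB delta_sum sumr_const card_ord.
  rewrite sumrB mulrBl mul1r /lapl; congr (_ - _).
  by rewrite mulr_sumr; apply: eq_bigr => k _; rewrite mulr_natl.
move=> h.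
have key : mu x * \sum_k \sum_l (dotp (vd (e_ k) (al k) x) (vd (e_ l) (al l) x) -
                 sqnorm (vd (e_ k) (al l) x)) = (n%:R - 1) * (n%:R - 6) / 4 * g.
  have s1 : mu x * \sum_k \sum_l dotp (vd (e_ k) (al k) x) (vd (e_ l) (al l) x) =
      (n%:R - 2) ^+ 2 / 4 * g.
    have -> : \sum_k \sum_l dotp (vd (e_ k) (al k) x) (vd (e_ l) (al l) x) =
       dotp (\sum_k vd (e_ k) (al k) x) (\sum_k vd (e_ k) (al k) x).
      by rewrite dotp_suml; apply: eq_bigr => k _; rewrite dotp_sumr.
    rewrite frame_parseval mulr_sumr; apply: eq_bigr => m _.
    have -> : dotp (\sum_k vd (e_ k) (al k) x) (al m x) = (2 - n%:R) / 2 * dd (e_ m) mu x.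
      rewrite dotp_suml; under eq_bigr do rewrite christoffel eqxx.
      rewrite -mulr_sumr !big_split /= sumrN sumr_const card_ord -[_ *+ n]mulr_natl mul1r.
      under eq_bigr do rewrite eq_sym.
      by rewrite !delta_sum; field.
    by move: (dd _ _ x) => t; field.
  have s2 : mu x * \sum_k \sum_l sqnorm (vd (e_ k) (al l) x) = (3 * n%:R - 2) / 4 * g.
    rewrite mulrAC -(christoffel_norm (fun k => dd (e_ k) mu x)) mulrC mulr_suml mulr_suml.
    apply: eq_bigr => k _; rewrite !mulr_suml; apply: eq_bigr => l _.
    rewrite mulrC /sqnorm frame_parseval mulr_suml; apply: eq_bigr => m _.
    by rewrite christoffel; move: (_ - _) => t; field.
  under eq_bigr do rewrite sumrB.
  by rewrite sumrB mulrBr s1 s2; move: (g) => t; field.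
rewrite h in key; move: key; move: (lapl mu x) (mu x) => p q key.
have nR : 1 < n%:R :> R by rewrite ltr1n.
apply: (@mulfI _ (1 - n%:R)); first by rewrite lt_eqF//; lra.
by rewrite mulrCA key; field.
Qed.

(* Integrating the scalar curvature identity against mu^n by parts leaves a *)
(* positive multiple of the integral of mu^n |grad mu|^2.                   *)
Lemma conformal_factor_cst k x : dd (e_ k) mu x = 0.
Proof.
pose g x := \sum_k dd (e_ k) mu x ^+ 2.
have sk i : smooth_periodic V (dd (e_ i) mu) := smooth_periodic_dd (e_ i) smu.
have sg : smooth_periodic V g by apply: smooth_periodic_sum => i; exact: smooth_periodicX.
have smn m : smooth_periodic V (fun x => mu x ^+ m) by exact: smooth_periodicX.
have smg : smooth_periodic V (fun x => mu x ^+ n * g x) by exact: smooth_periodicM.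
have sl : smooth_periodic V (lapl mu) := smooth_periodic_lapl smu.
have e1 : avg V (fun x => lapl mu x * mu x ^+ n.+1) =
    (6 - n%:R) / 4 * avg V (fun x => mu x ^+ n * g x).
  rewrite -avgZ//; congr (avg V _); apply/funext => y.
  have := scalar_curvature y; rewrite -/(g y) exprS => e.
  by rewrite mulrA [lapl mu y * _]mulrC e; move: (g y) (mu y ^+ n) => s t; ring.
have e2 : avg V (fun x => lapl mu x * mu x ^+ n.+1) =
    - n.+1%:R * avg V (fun x => mu x ^+ n * g x).
  have -> : (fun x => lapl mu x * mu x ^+ n.+1) =
     (fun x => \sum_i dd (e_ i) (dd (e_ i) mu) x * mu x ^+ n.+1).
    by apply/funext => y; rewrite /lapl mulr_suml.
  rewrite avg_sum => [|i]; last by apply: smooth_periodicM => //; exact: smooth_periodic_dd.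
  rewrite -avgZ//.
  have -> : (fun x => - n.+1%:R * (mu x ^+ n * g x)) =
     (fun x => \sum_i - (dd (e_ i) mu x * dd (e_ i) (fun y => mu y ^+ n.+1) x)).
    apply/funext => y; rewrite /g !mulr_sumr; apply: eq_bigr => i _.
    rewrite ddX; last exact: smu.1.
    by move: (dd _ _ y) (mu y ^+ n) (n.+1%:R) => a b c; ring.
  rewrite avg_sum => [|i]; last first.
    by apply: smooth_periodicN; apply: smooth_periodicM => //; exact: smooth_periodic_dd.
  apply: eq_bigr => i _; rewrite (avg_dd_parts hV _ (sk i) (smn _)) avgN//.
  by apply: smooth_periodicM => //; exact: smooth_periodic_dd.
have a0 : avg V (fun x => mu x ^+ n * g x) = 0.
  (* The coefficient is (3 n + 10)/4. With weight 1 in place of mu^n it would be (10 - n)/4, of no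
     fixed sign; the exponent n is large enough in every dimension. *)
  have : (n.+1%:R + (6 - n%:R) / 4) * avg V (fun x => mu x ^+ n * g x) = 0.
    by rewrite mulrDl -e1 e2; move: (avg _ _) => t; ring.
  move/eqP; rewrite mulf_eq0 => /orP[|/eqP//].
  rewrite gt_eqF// -[n.+1%:R]natr1.
  have : 0 <= n%:R :> R by [].
  by lra.
have mu_ge0 y : 0 <= mu y by exact: ltW.
have g0 y : 0 <= g y by apply: sumr_ge0 => i _; exact: sqr_ge0.
have z := avg_eq0 hV smg (fun y => mulr_ge0 (exprn_ge0 _ (mu_ge0 y)) (g0 y)) a0 x.
move/eqP: z; rewrite mulf_eq0 expf_eq0 [mu x == 0]gt_eqF// andbF /=.
rewrite psumr_eq0 => [/allP/(_ k (mem_index_enum _))|i _]; last exact: sqr_ge0.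
by rewrite sqrf_eq0 => /eqP.
Qed.

(** For constant mu the symbols in [christoffel] vanish, and these are all the components of the
    derivatives of the frame. *)
Theorem conformal_rigidity k x : al k x = al k 0.
Proof.
have z i l y : vd (e_ i) (al l) y = 0.
  have : mu y * sqnorm (vd (e_ i) (al l) y) = 0.
    rewrite /sqnorm frame_parseval big1// => m _.
    by rewrite christoffel !conformal_factor_cst !mulr0 addr0 subr0 !mulr0.
  by move/eqP; rewrite mulf_eq0 [mu y == 0]gt_eqF//= sqnorm_eq0 => /eqP.
apply/rowP => j; apply: (dd_eq0_cst (sal k j).1) => i y.
by have := congr1 (fun M : 'rV[R]_n => M 0 j) (z i k y); rewrite !mxE.
Qed.

End Rigidity.

(** * Conformal maps to products of circles *)

Section CircleMaps.
Variables (R : realType) (n : nat) (V : 'M[R]_n).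
Hypothesis hn : (1 < n)%N.
Hypothesis hV : V \in unitmx.
Local Notation e_ i := (delta_mx 0 i : 'rV[R]_n).
Variables C S : 'I_n -> 'rV[R]_n -> R.
Hypothesis sC : forall i, smooth_periodic V (C i).
Hypothesis sS : forall i, smooth_periodic V (S i).
Hypothesis circle : forall i x, C i x ^+ 2 + S i x ^+ 2 = 1.

(* The derivative along v of the angle of the i-th circle. *)
Definition angular v i x := C i x * dd v (S i) x - S i x * dd v (C i) x.

Lemma angular_dd v i x :
  dd v (C i) x = - (angular v i x * S i x) /\ dd v (S i) x = angular v i x * C i x.
Proof.
have h : C i x * dd v (C i) x + S i x * dd v (S i) x = 0.
  have := dd_cst v 1 x.
  have -> : (fun=> 1) = (fun y => C i y ^+ 2 + S i y ^+ 2).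
    by apply/funext => y; rewrite circle.
  have c1 := (sC i).1; have s1 := (sS i).1.
  rewrite ddD ?ddX//; try exact: smoothX.
  by move: (dd _ _ x) (dd _ _ x) (C i x) (S i x) => a b c d h; lra.
have := circle i x; rewrite /angular.
move: (dd _ _ x) (dd _ _ x) (C i x) (S i x) h => a b c d h e; split.
  by transitivity (b * (c ^+ 2 + d ^+ 2) - c * (c * b + d * a)); [rewrite e h|]; ring.
by transitivity (a * (c ^+ 2 + d ^+ 2) - d * (c * b + d * a)); [rewrite e h|]; ring.
Qed.

Lemma smooth_periodic_angular v i : smooth_periodic V (angular v i).
Proof.
by apply: smooth_periodicB; apply: smooth_periodicM => //; exact: smooth_periodic_dd.
Qed.

(** Apart from second derivatives, which commute, only the exterior product of dC and dS remains; it
    vanishes because both are multiples of the same angular form. *)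
Lemma angular_closed v w i x : dd v (angular w i) x = dd w (angular v i) x.
Proof.
have c1 := (sC i).1; have s1 := (sS i).1.
have k u u' : dd u (angular u' i) x = dd u (C i) x * dd u' (S i) x - dd u (S i) x * dd u' (C i) x +
   (C i x * dd u (dd u' (S i)) x - S i x * dd u (dd u' (C i)) x).
  rewrite ddB; try (by apply: smoothM => //; exact: smooth_dd).
  rewrite !ddM//; try exact: smooth_dd.
  by move: (dd _ (dd _ _) x) (dd _ (dd _ _) x) => p q; ring.
rewrite !k (ddC hV v w x (sC i)) (ddC hV v w x (sS i)).
have [-> ->] := angular_dd v i x; have [-> ->] := angular_dd w i x.
by move: (dd _ (dd _ _) x) (dd _ (dd _ _) x) (angular v i x) (angular w i x) => a b c d; ring.
Qed.

Variable mu : 'rV[R]_n -> R.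
Hypothesis mu0 : forall x, 0 < mu x.
Hypothesis conf : forall k l x,
  \sum_i (dd (e_ k) (C i) x * dd (e_ l) (C i) x + dd (e_ k) (S i) x * dd (e_ l) (S i) x) =
  (k == l)%:R * mu x.

Lemma conformal_circle_map : exists (A : 'M[R]_n) (m : R), [/\ 0 < m, A *m A^T = m%:M,
  forall x, mu x = m &
  forall i k x, dd (e_ k) (C i) x = - (A k i * S i x) /\ dd (e_ k) (S i) x = A k i * C i x].
Proof.
pose al k x := \row_i angular (e_ k) i x : 'rV[R]_n.
have alE k i : (fun x => al k x 0 i) = angular (e_ k) i by apply/funext => x; rewrite mxE.
have sal k : vsp V (al k) by move=> i; rewrite alE; exact: smooth_periodic_angular.
have cl k l x : vd (e_ k) (al l) x = vd (e_ l) (al k) x.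
  by apply/rowP => i; rewrite !mxE !alE angular_closed.
have cf k l x : dotp (al k x) (al l x) = (k == l)%:R * mu x.
  rewrite -conf dotp_sum; apply: eq_bigr => i _; rewrite !mxE.
  have [-> ->] := angular_dd (e_ k) i x; have [-> ->] := angular_dd (e_ l) i x.
  have := circle i x; move: (angular _ _ _) (angular _ _ _) (C i x) (S i x) => a b c d e.
  by rewrite -[LHS]mulr1 -e; ring.
have rig := conformal_rigidity hn hV sal cl cf mu0.
have muc x : mu x = mu 0.
  have i0 : 'I_n := Ordinal (ltnW hn).
  by have := cf i0 i0 x; rewrite rig cf !eqxx !mul1r.
exists (\matrix_(k, i) angular (e_ k) i 0), (mu 0); split=> //.
  apply/matrixP => k l; rewrite !mxE mulrb -mulrb -[RHS]mulr_natl -cf dotp_sum.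
  by apply: eq_bigr => i _; rewrite !mxE.
move=> i k x; rewrite mxE; have := congr1 (fun M : 'rV[R]_n => M 0 i) (rig k x).
by rewrite !mxE => <-; exact: angular_dd.
Qed.

Variables (A : 'M[R]_n) (m : R).
Hypothesis AA : A *m A^T = m%:M.
Hypothesis dA : forall i k x,
  dd (e_ k) (C i) x = - (A k i * S i x) /\ dd (e_ k) (S i) x = A k i * C i x.

Lemma circle_map_lapl i x : lapl (C i) x = - (m * C i x) /\ lapl (S i) x = - (m * S i x).
Proof.
have c1 := (sC i).1; have s1 := (sS i).1.
have Am : \sum_k A k i ^+ 2 = m.
  have AtA : A^T *m A = m%:M.
    (* A^T A = m follows by inverting [A], except for m = 0, where A A^T = 0 forces A = 0. *)
    have [m0|m0] := eqVneq m 0.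
      have z : A = 0.
        apply/row_matrixP => k; rewrite row0; apply/eqP; rewrite -sqnorm_eq0 /sqnorm dotp_sum.
        have := congr1 (fun M : 'M[R]_n => M k k) AA; rewrite m0 !mxE mul0rn => h.
        by apply/eqP; rewrite -[RHS]h; apply: eq_bigr => j _; rewrite !mxE.
      by rewrite z mulmx0 m0; apply/matrixP => a b; rewrite !mxE mul0rn.
    have h : (m^-1 *: A) *m A^T = 1%:M.
      by rewrite -scalemxAl AA scale_scalar_mx mulVf.
    by rewrite -[LHS](scalerKV m0) scalemxAr (mulmx1C h) scalemx1.
  have := congr1 (fun M : 'M[R]_n => M i i) AtA; rewrite !mxE eqxx mulr1n => <-.
  by apply: eq_bigr => k _; rewrite !mxE expr2.
have dC k : dd (e_ k) (C i) = (fun y => (- A k i) * S i y).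
  by apply/funext => y; rewrite (dA i k y).1 mulNr.
have dS k : dd (e_ k) (S i) = (fun y => A k i * C i y).
  by apply/funext => y; rewrite (dA i k y).2.
rewrite -Am !mulr_suml -!sumrN /lapl; split; apply: eq_bigr => k _.
  by rewrite dC ddZ// dS; move: (C i x) => t; ring.
by rewrite dS ddZ// dC; move: (S i x) => t; ring.
Qed.

(** The vector (C, S), rotated back by the linear angle, has zero derivative and keeps its value at
    0. *)
Lemma circle_map_solution i x :
  C i x = C i 0 * cos ((x *m A) 0 i) - S i 0 * sin ((x *m A) 0 i) /\
  S i x = C i 0 * sin ((x *m A) 0 i) + S i 0 * cos ((x *m A) 0 i).
Proof.
have c1 := (sC i).1; have s1 := (sS i).1.
pose xi := row i A^T.
have thE y : (y *m A) 0 i = dotp xi y by rewrite dotpC dotp_row trmxK.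
have xe k : dotp xi (e_ k) = A k i by rewrite -thE -rowE mxE.
have [sc ss] := smooth_cos_sin xi.
have u y : C i y * cos (dotp xi y) + S i y * sin (dotp xi y) = C i 0.
  rewrite (@dd_eq0_cst _ _ (fun y => C i y * cos (dotp xi y) + S i y * sin (dotp xi y))).
  - by rewrite dotp0r cos0 sin0 mulr1 mulr0 addr0.
  - by apply: smoothD; exact: smoothM.
  move=> k z; rewrite ddD; try exact: smoothM.
  rewrite !ddM// dd_cos dd_sin xe (dA i k z).1 (dA i k z).2.
  by move: (C i z) (S i z) (cos _) (sin _) => a b c d; ring.
have v y : S i y * cos (dotp xi y) - C i y * sin (dotp xi y) = S i 0.
  rewrite (@dd_eq0_cst _ _ (fun y => S i y * cos (dotp xi y) - C i y * sin (dotp xi y))).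
  - by rewrite dotp0r cos0 sin0 mulr1 mulr0 subr0.
  - by apply: smoothB; exact: smoothM.
  move=> k z; rewrite ddB; try exact: smoothM.
  rewrite !ddM// dd_cos dd_sin xe (dA i k z).1 (dA i k z).2.
  by move: (C i z) (S i z) (cos _) (sin _) => a b c d; ring.
rewrite thE -(u x) -(v x).
have := cos2Dsin2 (dotp xi x).
move: (cos _) (sin _) (C i x) (S i x) => c s a b e; split.
  by rewrite -[LHS]mulr1 -e; ring.
by rewrite -[LHS]mulr1 -e; ring.
Qed.

End CircleMaps.

(** * The Clifford map and conformal maps through it *)

Section CliffordMap.
Variable R : realType.

Lemma dotp_mxvec m n (A B : 'M[R]_(m, n)) :
  dotp (mxvec A) (mxvec B) = \sum_i \sum_j A i j * B i j.
Proof.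
rewrite dotp_sum (reindex _ (curry_mxvec_bij m n)) /= pair_bigA /=.
by apply: eq_bigr => -[i j] _ /=; rewrite !mxvecE.
Qed.

Lemma ord2 (k : 'I_2) : k = 0 \/ k = 1.
Proof. by case: k => -[|[|//]] Hk; [left|right]; exact/val_inj. Qed.

Lemma cos_sin_2pi_inj (x y : R) : cos (2 * pi * x) = cos (2 * pi * y) ->
  sin (2 * pi * x) = sin (2 * pi * y) -> exists k : int, x = y + k%:~R.
Proof.
move=> c s; have [k hk] := near_int (x - y); exists k.
have h : cos (2 * pi * x - 2 * pi * y) = 1.
  by rewrite cosB c s -!expr2 cos2Dsin2.
have z : sin (pi * (x - y)) = 0.
  have e : 2 * pi * x - 2 * pi * y = (pi * (x - y)) *+ 2 by rewrite -mulr_natl; ring.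
  move: h; rewrite e cos_mulr2n => h; have := cos2Dsin2 (pi * (x - y)).
  move: h; move: (cos _) (sin _) => a b h h'; apply/eqP; rewrite -sqrf_eq0; apply/eqP.
  by rewrite -mulr_natl in h; lra.
move: hk; rewrite z normr0 mulr0 normr_le0 subr_eq0 => /eqP <-.
by rewrite addrC subrK.
Qed.

Lemma cliffordE n (t : torus (1%:M : 'M[R]_n)) i (k : 'I_2) : (0 < n)%N ->
  Num.sqrt n%:R * clifford t 0 (mxvec_index i k) =
  let x := (repr (t : {quot (lattice (1%:M : 'M[R]_n))}) : 'rV[R]_n) 0 i in
  if k == 0 then cos (2 * pi * x) else sin (2 * pi * x).
Proof.
move=> n0; rewrite /clifford mxE mxvecE mxE mulrA mulfV ?mul1r//.
by rewrite gt_eqF// sqrtr_gt0 ltr0n.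
Qed.

Lemma clifford_inj n : (0 < n)%N -> injective (@clifford R n).
Proof.
move=> n0 t s e.
have [x xE] : {x : 'rV[R]_n | x = repr (t : {quot (lattice (1%:M : 'M[R]_n))})} by eexists.
have [y yE] : {x : 'rV[R]_n | x = repr (s : {quot (lattice (1%:M : 'M[R]_n))})} by eexists.
have /choice[k hk] i : exists k : int, x 0 i = y 0 i + k%:~R.
  apply: cos_sin_2pi_inj.
    by have := cliffordE t i 0 n0; rewrite e cliffordE//= -xE -yE => <-.
  by have := cliffordE t i 1 n0; rewrite e cliffordE//= -xE -yE => <-.
rewrite -(torus_proj_repr t) -(torus_proj_repr s) -xE -yE.
apply/torus_projP; exists (\row_i k i); rewrite trmx1 mulmx1.
by apply/rowP => i; rewrite !mxE.
Qed.

End CliffordMap.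

Section CliffordCongruent.
Variables (R : realType) (n N : nat) (V : 'M[R]_n).
Hypothesis hn : (1 < n)%N.
Hypothesis hV : V \in unitmx.
Local Notation e_ i := (delta_mx 0 i : 'rV[R]_n).

Variables (h : torus V -> torus (1%:M : 'M[R]_n)).
Let K := torus_lift (@clifford R n \o h).
Hypothesis hinj : injective h.
Hypothesis sK : vsp V K.
Variable rho : 'rV[R]_n -> R.
Hypothesis rho0 : forall x, 0 < rho x.
Hypothesis conf : forall k l x, dotp (vd (e_ k) K x) (vd (e_ l) K x) = (k == l)%:R * rho x.

(** By rigidity the angular forms are a constant matrix [A] with A A^T = m. The rows of 2 pi A^-1
    are periods of [K], and injectivity of [h] puts them in the lattice V Z^n. So 2 pi A^-1 = M V^T
    with [M] integral and nonsingular, and determinants give the bound on |det V|. The opposite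
    inequality will come from the lower bound on W. *)
Lemma conformal_clifford_map : exists m : R, [/\ 0 < m,
  `|\det V| * m `^ (n%:R / 2) <= (2 * pi) ^+ n, forall x, rho x = m / n%:R,
  forall x, sqnorm (K x) = 1 & forall x, vlapl K x = - m *: K x].
Proof.
have n0 : (0 < n)%N := ltnW hn.
have nR : 0 < n%:R :> R by rewrite ltr0n.
have [r [rE r0]] : exists r, r = Num.sqrt n%:R :> R /\ r != 0.
  by exists (Num.sqrt n%:R); rewrite gt_eqF// sqrtr_gt0.
have r2 : r ^+ 2 = n%:R by rewrite rE sqr_sqrtr// ltW.
pose T (k : 'I_2) i x := r * K x 0 (mxvec_index i k).
have KE x : K x = r^-1 *: mxvec (\matrix_(i < n, k < 2) T k i x).
  apply/rowP => j; case/mxvec_indexP: j => i k.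
  by rewrite [RHS]mxE mxvecE [X in _ = _ * X]mxE /T (mulKf r0).
have sT k i : smooth_periodic V (T k i) by exact: smooth_periodicZ.
have circle i x : T 0 i x ^+ 2 + T 1 i x ^+ 2 = 1.
  by rewrite /T /K /torus_lift /= rE !cliffordE//= cos2Dsin2.
have dotK (X Y : 'M[R]_(n, 2)) : dotp (r^-1 *: mxvec X) (r^-1 *: mxvec Y) =
    n%:R^-1 * \sum_i (X i 0 * Y i 0 + X i 1 * Y i 1).
  rewrite dotpZl dotpZr mulrA dotp_mxvec -invfM -expr2 r2; congr (_ * _).
  apply: eq_bigr => i _; rewrite big_ord_recl big_ord1.
  have -> : lift ord0 ord0 = 1 :> 'I_2 by exact/val_inj.
  by [].
have dK v x : vd v K x = r^-1 *: mxvec (\matrix_(i < n, k < 2) dd v (T k i) x).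
  apply/rowP => j; case/mxvec_indexP: j => i k.
  rewrite [LHS]mxE [RHS]mxE mxvecE [X in _ = _ * X]mxE /T (ddZ _ _ _ (sK _).1).
  by rewrite (mulKf r0).
have cf k l x : \sum_i (dd (e_ k) (T 0 i) x * dd (e_ l) (T 0 i) x +
     dd (e_ k) (T 1 i) x * dd (e_ l) (T 1 i) x) = (k == l)%:R * (n%:R * rho x).
  have e := conf k l x; rewrite !dK dotK in e.
  rewrite mulrCA -e mulVKf ?gt_eqF//.
  by apply: eq_bigr => i _; rewrite !mxE.
have mu0 x : 0 < n%:R * rho x by exact: mulr_gt0.
have [A [m [m0 AA muE dA]]] := conformal_circle_map hn hV (sT 0) (sT 1) circle mu0 cf.
exists m; split=> //.
- have Au : A \in unitmx.
    have : A *m (m^-1 *: A^T) = 1%:M by rewrite -scalemxAr AA scale_scalar_mx mulVf// gt_eqF.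
    by case/mulmx1_unit.
  have per j : exists k : 'rV[int]_n,
      row j ((2 * pi) *: invmx A) = map_mx intr k *m V^T.
    have : torus_proj V (row j ((2 * pi) *: invmx A)) = torus_proj V 0.
      apply: hinj; apply: (clifford_inj n0).
      rewrite -[LHS]/(K (row j ((2 * pi) *: invmx A))) -[RHS]/(K 0) !KE; congr (_ *: mxvec _).
      apply/matrixP => i k; rewrite !mxE.
      have [] := circle_map_solution (sT 0) (sT 1) dA i (row j ((2 * pi) *: invmx A)).
      have -> : (row j ((2 * pi) *: invmx A) *m A) 0 i = 0 + 2 * pi * (i == j)%:~R.
        rewrite -row_mul -scalemxAl mulVmx// !mxE add0r eq_sym.
        by case: (i == j).
      rewrite cosDint sinDint cos0 sin0 !mulr1 !mulr0 subr0 add0r => e0 e1.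
      by case: (ord2 k) => ->.
    by case/torus_projP => k; rewrite add0r => h0; exists k.
  have [k hk] := choice per; pose M := \matrix_(j, i) k j 0 i.
  have ME : (2 * pi) *: invmx A = map_mx intr M *m V^T.
    apply/row_matrixP => j; rewrite hk row_mul; congr (_ *m _).
    by apply/rowP => i; rewrite !mxE.
  have := congr1 (fun X => \det X * \det A) ME.
  rewrite /= detZ -mulrA -det_mulmx mulVmx// det1 mulr1 det_mulmx det_map_mx det_tr => dE.
  have dM : 1 <= `|(\det M)%:~R| :> R.
    rewrite -intr_norm -[1]/(1%:~R) ler_int -gtz0_ge1 normr_gt0.
    apply/eqP => M0; move/eqP: dE; rewrite M0 !mul0r expf_eq0 mulf_eq0 !gt_eqF ?andbF//.
    exact: pi_gt0.
  have mA : m `^ (n%:R / 2) = `|\det A|.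
    rewrite powRrM powR_mulrn ?(ltW m0)// powR12_sqrt ?exprn_ge0 ?(ltW m0)//.
    by rewrite -sqrtr_sqr -det_scalar -AA det_mulmx det_tr expr2.
  rewrite mA -[leRHS]ger0_norm; last by rewrite exprn_ge0// mulr_ge0// pi_ge0.
  rewrite dE !normrM -mulrA ler_peMl//.
- by move=> x; rewrite -(muE x) mulrC mulKf// gt_eqF.
- move=> x; rewrite KE /sqnorm dotK.
  have -> : \sum_i ((\matrix_(i < n, k < 2) T k i x) i 0 * (\matrix_(i < n, k < 2) T k i x) i 0 +
     (\matrix_(i < n, k < 2) T k i x) i 1 * (\matrix_(i < n, k < 2) T k i x) i 1) = \sum_(i < n) 1.
    by apply: eq_bigr => i _; rewrite !mxE -!expr2 circle.
  by rewrite sumr_const card_ord mulVf// gt_eqF.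
move=> x; apply/rowP => j; rewrite vlapl_comp [RHS]mxE.
case/mxvec_indexP: j => i k.
have -> : lapl (fun y => K y 0 (mxvec_index i k)) x = r^-1 * lapl (T k i) x.
  rewrite /lapl mulr_sumr; apply: eq_bigr => j _.
  have s0 : smooth (fun y => K y 0 (mxvec_index i k)) := (sK _).1.
  have -> : dd (e_ j) (T k i) = (fun y => r * dd (e_ j) (fun y => K y 0 (mxvec_index i k)) y).
    by apply/funext => y; rewrite /T ddZ.
  by rewrite ddZ ?(mulKf r0)//; exact: smooth_dd.
have -> : lapl (T k i) x = - m * T k i x.
  have [] := circle_map_lapl (sT 0) (sT 1) AA dA i x.
  by move=> e0 e1; rewrite mulNr; case: (ord2 k) => ->.
by rewrite mulrCA /T (mulKf r0).
Qed.

End CliffordCongruent.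

(** * Upper bound for Clifford congruent tori *)

Section Converse.
Variables (R : realType) (n N : nat) (V : 'M[R]_n).
Hypothesis hn : (1 < n)%N.
Hypothesis hV : V \in unitmx.
Local Notation e_ i := (delta_mx 0 i : 'rV[R]_n).

Lemma vlapl_mulmx M M' (G : 'rV[R]_n -> 'rV[R]_M) (P : 'M[R]_(M, M')) x : vsmooth G ->
  vlapl (fun y => G y *m P) x = vlapl G x *m P.
Proof.
move=> sG; rewrite /vlapl mulmx_suml; apply: eq_bigr => i _; rewrite /hess.
have -> : vd (e_ i) (fun y => G y *m P) = (fun y => vd (e_ i) G y *m P).
  by apply/funext => y; rewrite vd_mulmx.
by rewrite vd_mulmx//; exact: vsmooth_vd.
Qed.

Theorem willmore_clifford_congruent (f F : torus V -> 'rV[R]_N) : vsp V (torus_lift F) ->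
  (forall x i k, dotp (vd (e_ i) (torus_lift F) x) (vd (e_ k) (torus_lift F) x) = (i == k)%:R) ->
  conformal_rel F f -> moebius_congruent_clifford f ->
  willmore f <= (4 * n%:R * pi ^+ 2) `^ (n%:R / 2).
Proof.
move=> sF flat rel [n2N [psi [h [mpsi [h' [hK _ _ _]] im]]]].
have n0 : (0 < n)%N := ltnW hn.
have nR : 0 < n%:R :> R by rewrite ltr0n.
pose P : 'M[R]_(n * 2, N) := pid_mx (n * 2).
have PP : P *m P^T = 1%:M by rewrite tr_pid_mx pid_mx_id// pid_mx_1.
pose g t := std_incl N (clifford (h t)).
have relg : conformal_rel f g := moebius_conformal_rel mpsi im.
pose K := torus_lift (@clifford R n \o h).
have gE : torus_lift g = (fun x => K x *m P) by [].
have sF' := vsp_smooth sF.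
have relF := conformal_rel_lift rel; have relG := conformal_rel_lift relg.
have sf := conformal_rel_vsmooth sF' relF.
have sg := conformal_rel_vsmooth sf relG.
have KE : K = (fun x => torus_lift g x *m P^T).
  by apply/funext => x; rewrite gE -mulmxA PP mulmx1.
have sK' : vsmooth K by rewrite KE; exact: vsmooth_mulmx.
have sK : vsp V K := torus_lift_vsp sK'.
(* [K] is conformal for g_0 because it is reached from the flat [F] by two Moebius maps, whose
   factors multiply. *)
have /choice[rho hrho] x : exists rho, 0 < rho /\
    forall k l, dotp (vd (e_ k) K x) (vd (e_ l) K x) = (k == l)%:R * rho.
  have [M1 [r1 [p1 [r10 OO1 d1 _]]]] := conformal_rel_derivatives sF' relF x.
  have [M2 [r2 [p2 [r20 OO2 d2 _]]]] := conformal_rel_derivatives sf relG x.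
  exists (r2 * r1); split=> [|k l]; first exact: mulr_gt0.
  have <- : dotp (vd (e_ k) (torus_lift g) x) (vd (e_ l) (torus_lift g) x) =
            dotp (vd (e_ k) K x) (vd (e_ l) K x).
    by rewrite gE !vd_mulmx// (dotp_conformal _ _ PP) mul1r.
  by rewrite !d2 !d1 (dotp_conformal _ _ OO2) (dotp_conformal _ _ OO1) flat mulrA mulrC.
have rho0 x := (hrho x).1; have conf k l x := (hrho x).2 k l.
have [m [m0 mle rhoE K1 lK]] := conformal_clifford_map hn hV (can_inj hK) sK rho0 conf.
pose r := Num.sqrt (m / n%:R).
have mn0 : 0 < m / n%:R by rewrite divr_gt0.
have r0 : 0 < r by rewrite sqrtr_gt0.
have r2 : r ^+ 2 = m / n%:R by rewrite sqr_sqrtr// ltW.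
(* A rescaled Clifford map is a second flat representative in the Moebius class of [f]. On it
   |Lap|^2 is the constant n m, so W can be computed exactly. *)
pose F' t := r^-1 *: (g t *m 1%:M) + 0.
have relF' : conformal_rel F' f.
  apply: conformal_rel_sym.
  apply: (@moebius_conformal_rel _ _ (similarity r^-1 1%:M 0 \o psi)).
    apply: moebius_comp => //; apply: moebius_similarity; first by rewrite invr_gt0.
    by rewrite trmx1 mulmx1.
  by move=> t; rewrite /= im.
have F'E : torus_lift F' = (fun x => K x *m (r^-1 *: P)).
  by apply/funext => x; rewrite /torus_lift /= /F' mulmx1 addr0 -scalemxAr.
have PP' : (r^-1 *: P) *m (r^-1 *: P)^T = (n%:R / m)%:M.
  rewrite linearZ /= -scalemxAl -scalemxAr PP scalerA -invfM -expr2 r2 scalemx1.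
  by rewrite invf_div.
have sF2 : vsp V (torus_lift F').
  by apply: torus_lift_vsp; rewrite F'E; exact: vsmooth_mulmx.
have flat' x i k : dotp (vd (e_ i) (torus_lift F') x) (vd (e_ k) (torus_lift F') x) = (i == k)%:R.
  rewrite F'E !vd_mulmx// (dotp_conformal _ _ PP') conf rhoE mulrCA.
  by rewrite -[n%:R / m]invf_div (mulVf (lt0r_neq0 mn0)) mulr1.
rewrite (willmore_flat hn hV sF2 flat' relF').
have -> : (fun x => sqnorm (vlapl (torus_lift F') x) `^ (n%:R / 2)) =
    (fun=> (n%:R * m) `^ (n%:R / 2)).
  apply/funext => x; rewrite F'E vlapl_mulmx// /sqnorm (dotp_conformal _ _ PP') lK.
  rewrite dotpZl dotpZr -/(sqnorm (K x)) K1 mulr1; congr (_ `^ _).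
  by field; rewrite gt_eqF.
rewrite /torus_integral cube_integral_cst powRM ?(ltW m0)// mulrCA.
have -> : (4 * n%:R * pi ^+ 2) `^ (n%:R / 2) = n%:R `^ (n%:R / 2) * (2 * pi) ^+ n :> R.
  have -> : 4 * n%:R * pi ^+ 2 = n%:R * (2 * pi) ^+ 2 :> R by ring.
  rewrite powRM ?exprn_ge0 ?mulr_ge0 ?pi_ge0//; congr (_ * _).
  rewrite -powR_mulrn ?mulr_ge0 ?pi_ge0// -powRrM -powR_mulrn ?mulr_ge0 ?pi_ge0//.
  by congr (_ `^ _); rewrite mulrC divfK.
by apply: ler_wpM2l; first exact: powR_ge0.
Qed.

End Converse.

Lemma mxvec_mulmx (R : realType) m n N (M : 'M[R]_(m, n)) (B : 'M[R]_(m * n, N)) :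
  mxvec M *m B = \sum_i \sum_k M i k *: row (mxvec_index i k) B.
Proof.
rewrite mulmx_sum_row (reindex _ (curry_mxvec_bij m n)) /= pair_bigA /=.
by apply: eq_bigr => -[i k] _ /=; rewrite mxvecE.
Qed.

(** * The case of equality *)

Section ExtremalTorus.
Variables (R : realType) (n N : nat) (V : 'M[R]_n).
Hypothesis hV : V \in unitmx.
Local Notation e_ i := (delta_mx 0 i : 'rV[R]_n).
Variable G : 'rV[R]_n -> 'rV[R]_N.
Hypothesis sG : vsp V G.
Hypothesis flat : forall x i k, dotp (vd (e_ i) G x) (vd (e_ k) G x) = (i == k)%:R.
Local Notation comp j := (fun x => G x 0 j).
Variables (c : R) (L : 'M[int]_n).
Hypothesis c0 : 0 < c.
Hypothesis detL : (`|\det L| = 1)%N.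
Let X := map_mx intr L *m invmx V.
Hypothesis XX : X *m X^T = c%:M.
Hypothesis hcoef : forall j l, sqnorm (freq V l) ^+ 2 != 4 * pi ^+ 2 * (c * sqnorm (freq V l)) ->
  cos_coef V l (comp j) = 0 /\ sin_coef V l (comp j) = 0.

(** Scaled so that pairing a frequency with [v i] yields its i-th integer coordinate. *)
Let v i : 'rV[R]_n := (2 * pi * c)^-1 *: row i X.

Let pc0 : 2 * pi * c != 0 :> R.
Proof. by rewrite !mulf_neq0 ?gt_eqF ?pi_gt0. Qed.

Lemma dotp_frame i k : dotp (row i X) (row k X) = (i == k)%:R * c.
Proof.
have := congr1 (fun M : 'M[R]_n => M i k) XX; rewrite !mxE mulr_natl => <-.
by rewrite dotp_sum; apply: eq_bigr => j _; rewrite !mxE.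
Qed.

Lemma unimodular_unit : L \in unitmx.
Proof.
rewrite unitmxE; apply/orP; move: detL; case: (\det L) => [m|m] /=.
  by move=> ->; left.
by case: m => // _; right.
Qed.

(** [L] is unimodular, so the rows of [X] are an orthogonal basis of the dual lattice, and [t]
    collects the coordinates in it. *)
Lemma freq_frame l : exists t : 'rV[int]_n,
  (forall i, dotp (freq V l) (v i) = (t 0 i)%:~R) /\
  sqnorm (freq V l) = 4 * pi ^+ 2 * c * \sum_i (t 0 i)%:~R ^+ 2.
Proof.
exists (l *m invmx L); set t := l *m invmx L.
have fE : freq V l = (2 * pi) *: \sum_i (t 0 i)%:~R *: row i X.
  rewrite freq.unlock; congr (_ *: _).
  have -> : map_mx intr l = map_mx intr t *m map_mx intr L :> 'rV[R]_n.
    by rewrite -map_mxM /t mulmxKV// unimodular_unit.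
  rewrite -mulmxA -/X mulmx_sum_row; apply: eq_bigr => i _.
  by rewrite mxE.
have fX i : dotp (freq V l) (row i X) = 2 * pi * ((t 0 i)%:~R * c).
  rewrite fE dotpZl dotp_suml (bigD1 i)//= big1 => [|k ki].
    by rewrite dotpZl dotp_frame eqxx mul1r addr0.
  by rewrite dotpZl dotp_frame (negPf ki) mul0r mulr0.
split=> [i|].
  rewrite /v dotpZr fX; move: pc0; move: (2 * pi : R) => a h.
  by rewrite [a * (_ * c)]mulrCA [LHS]mulrCA mulVf// mulr1.
rewrite /sqnorm {2}fE dotpZr dotp_sumr !mulr_sumr; apply: eq_bigr => i _.
by rewrite dotpZr fX; move: pi => p; ring.
Qed.

(* The coordinates of a surviving frequency in the basis 2 pi (row i X) are *)
(* integers whose squares add up to 0 or 1.                                 *)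
Lemma freq_dichotomy j l : (cos_coef V l (comp j) = 0 /\ sin_coef V l (comp j) = 0) \/
  (forall i, dotp (freq V l) (v i) ^+ 3 = dotp (freq V l) (v i)) /\
  (forall i k, i != k -> dotp (freq V l) (v i) * dotp (freq V l) (v k) = 0).
Proof.
have [h|/hcoef h] := eqVneq (sqnorm (freq V l) ^+ 2) (4 * pi ^+ 2 * (c * sqnorm (freq V l)));
  last by left.
right; have [t [tE sE]] := freq_frame l; move: h; rewrite sE.
set S := \sum_i _ => h.
have q0 : 4 * pi ^+ 2 * c != 0 :> R by rewrite !mulf_neq0 ?expf_neq0 ?gt_eqF ?pi_gt0.
have S1 : S <= 1.
  have e : S * (S - 1) = 0.
    apply: (mulfI (mulf_neq0 q0 q0)); rewrite mulr0.
    move/eqP: h; rewrite -subr_eq0 => /eqP <-.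
    by move: (4 * pi ^+ 2 : R) => q; ring.
  by move/eqP: e; rewrite mulf_eq0 => /orP[/eqP ->|]; rewrite ?ler01// subr_eq0 => /eqP ->.
have S1' : (\sum_i t 0 i ^+ 2 <= 1)%R.
  rewrite -(ler_int R) rmorph_sum /=; apply: le_trans S1.
  by apply: ler_sum => i _; rewrite rmorphXn.
have S2 i k : i != k -> t 0 i ^+ 2 + t 0 k ^+ 2 <= 1.
  move=> ik; apply: le_trans S1'; rewrite (bigD1 i)//= (bigD1 k) 1?eq_sym//= addrA lerDl.
  by apply: sumr_ge0 => m _; exact: sqr_ge0.
have S3 i : t 0 i ^+ 2 <= 1.
  apply: le_trans S1'; rewrite (bigD1 i)//= lerDl.
  by apply: sumr_ge0 => m _; exact: sqr_ge0.
split=> [i|i k ik]; rewrite !tE.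
  have e : t 0 i ^+ 3 = t 0 i.
    move: (t 0 i) (S3 i) => a; rewrite !exprS expr0 !mulr1 => h3.
    have [->|a0] := eqVneq a 0; first by rewrite mul0r.
    have a1 : 1 <= a * a by nia.
    have -> : a * a = 1 by lia.
    by rewrite mulr1.
  by rewrite -[in RHS]e rmorphXn.
have e : t 0 i * t 0 k = 0.
  move: (t 0 i) (t 0 k) (S2 i k ik) => a b; rewrite !expr2 => h3.
  have [->|a0] := eqVneq a 0; first by rewrite mul0r.
  have [->|b0] := eqVneq b 0; first by rewrite mulr0.
  have a1 : 1 <= a * a by nia.
  have b1 : 1 <= b * b by nia.
  by lia.
by rewrite -rmorphM e.
Qed.

(** The [v i] span R^n, because X X^T = c is invertible. *)
Lemma dd_frame_cst phi : smooth phi -> (forall i x, dd (v i) phi x = 0) ->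
  forall x, phi x = phi 0.
Proof.
move=> sp h; apply: dd_eq0_cst => // k x.
pose p : 'rV[R]_n := \row_j dd (e_ j) phi x.
have pv i : dotp p (row i X) = 0.
  have := h i x; rewrite dd_coord// /v => e.
  have : (2 * pi * c)^-1 * dotp p (row i X) = 0.
    rewrite -[RHS]e dotp_sum mulr_sumr; apply: eq_bigr => j _.
    by rewrite !mxE; move: (dd _ _ _) => u; rewrite mulrA mulrAC.
  by move/eqP; rewrite mulf_eq0 invr_eq0 (negPf pc0) /= => /eqP.
have pX : p *m X^T = 0 by apply/rowP => i; rewrite -dotp_row pv mxE.
have XtX : X^T *m (c^-1 *: X) = 1%:M.
  by apply: mulmx1C; rewrite -scalemxAl XX scale_scalar_mx mulVf// gt_eqF.
have p0 : p = 0 by rewrite -[p]mulmx1 -XtX mulmxA pX mul0mx.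
by have := congr1 (fun M : 'rV[R]_n => M 0 k) p0; rewrite !mxE.
Qed.

Let sc j : smooth_periodic V (comp j) := sG j.
Let sd i j : smooth_periodic V (dd (v i) (comp j)) := smooth_periodic_dd (v i) (sc j).
Let sdd i k j : smooth_periodic V (dd (v k) (dd (v i) (comp j))) :=
  smooth_periodic_dd (v k) (sd i j).

(** The symbol is, up to sign, the product of two distinct coordinates, which is 0 on surviving
    frequencies. *)
Lemma dd_frame_mixed i k j x : i != k -> dd (v i) (dd (v k) (comp j)) x = 0.
Proof.
move=> ik; move: x; apply: (fourier_unique hV (sdd k i j)) => l.
rewrite (cos_coef_dd hV l (v i) (sd k j)) (sin_coef_dd hV l (v i) (sd k j)).
rewrite (cos_coef_dd hV l (v k) (sc j)) (sin_coef_dd hV l (v k) (sc j)).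
rewrite !mulrN !mulrA.
case: (freq_dichotomy j l) => [[-> ->]|[_ /(_ i k ik) ->]].
  by rewrite !mulr0 oppr0.
by rewrite !mul0r oppr0.
Qed.

(** The symbol (i t)^3 equals - i t, because t^3 = t on surviving frequencies. *)
Lemma dd_frame_cubic i j x : dd (v i) (dd (v i) (dd (v i) (comp j))) x = - dd (v i) (comp j) x.
Proof.
have s3 := smooth_periodic_dd (v i) (sdd i i j).
suff h y : dd (v i) (dd (v i) (dd (v i) (comp j))) y - - dd (v i) (comp j) y = 0.
  by apply/eqP; rewrite -subr_eq0 h.
have sN := smooth_periodicN (sd i j).
move: y; apply: (fourier_unique hV (smooth_periodicB s3 sN)) => l.
rewrite (cos_coefB hV l s3 sN) (sin_coefB hV l s3 sN).
have -> : (fun y => - dd (v i) (comp j) y) = (fun y => 0 - dd (v i) (comp j) y).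
  by apply/funext => y; rewrite sub0r.
have s0 := smooth_periodic_cst V 0.
rewrite (cos_coefB hV l s0 (sd i j)) (sin_coefB hV l s0 (sd i j)).
have c00 : cos_coef V l (fun=> 0) = 0.
  by rewrite cos_coef.unlock -[RHS](avg_cst V); congr (avg V _); apply/funext => y; rewrite mul0r.
have s00 : sin_coef V l (fun=> 0) = 0.
  by rewrite sin_coef.unlock -[RHS](avg_cst V); congr (avg V _); apply/funext => y; rewrite mul0r.
rewrite c00 s00 !sub0r !opprK.
rewrite (cos_coef_dd hV l (v i) (sdd i i j)) (sin_coef_dd hV l (v i) (sdd i i j)).
rewrite (cos_coef_dd hV l (v i) (sd i j)) (sin_coef_dd hV l (v i) (sd i j)).
rewrite (cos_coef_dd hV l (v i) (sc j)) (sin_coef_dd hV l (v i) (sc j)).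
case: (freq_dichotomy j l) => [[-> ->]|[/(_ i) e _]].
  by rewrite !(mulr0, oppr0, addr0).
move: e; move: (dotp _ _) (cos_coef _ _ _) (sin_coef _ _ _) => t p q e.
split.
  by transitivity ((t - t ^+ 3) * q); [ring|rewrite e subrr mul0r].
by transitivity ((t ^+ 3 - t) * p); [ring|rewrite e subrr mul0r].
Qed.

(** By [vd_frame1] and [vd_frame2] the pair [al i], [be i] rotates along [v i] and is constant along
    the other [v k]. *)
Let al i := vd (v i) G.
Let be i := vd (v i) (al i).

Let alE i j : (fun x => al i x 0 j) = dd (v i) (comp j).
Proof. exact: vdE. Qed.

Let beE i j : (fun x => be i x 0 j) = dd (v i) (dd (v i) (comp j)).
Proof. by rewrite vdE alE. Qed.

Let sal i : vsp V (al i) := vsp_vd (v i) sG.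
Let sbe i : vsp V (be i) := vsp_vd (v i) (sal i).

Lemma vd_frame1 i k x : vd (v i) (al k) x = (i == k)%:R *: be i x.
Proof.
have [<-|ik] := eqVneq i k; first by rewrite scale1r.
by apply/rowP => j; rewrite scale0r !mxE alE dd_frame_mixed.
Qed.

Lemma vd_frame2 i k x : vd (v i) (be k) x = - (i == k)%:R *: al i x.
Proof.
apply/rowP => j; rewrite mxE beE; have [<-|ik] := eqVneq i k.
  by rewrite dd_frame_cubic scaleN1r !mxE.
rewrite (ddC hV _ _ _ (sd k j)).
have -> : dd (v i) (dd (v k) (comp j)) = (fun=> 0).
  by apply/funext => y; exact: dd_frame_mixed.
by rewrite dd_cst oppr0 scale0r mxE.
Qed.

(** The basis dual to [v]; the surviving nonzero frequencies are among these vectors and their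
    opposites. *)
Let z i : 'rV[R]_n := (2 * pi) *: row i X.

Lemma dual_frame i k : dotp (z i) (v k) = (i == k)%:R.
Proof.
rewrite /z /v dotpZl dotpZr dotp_frame; move: pc0; move: (2 * pi : R) => a h.
by move: h; rewrite mulf_eq0 negb_or => /andP[a1 c1]; field; rewrite a1 c1.
Qed.

Lemma frame_solution i x :
  be i x = cos (dotp (z i) x) *: be i 0 - sin (dotp (z i) x) *: al i 0.
Proof.
apply/rowP => j.
have [sC sS] := smooth_cos_sin (z i).
have sb : smooth (fun y => be i y 0 j) := (sbe i j).1.
have sa : smooth (fun y => al i y 0 j) := (sal i j).1.
have da k y : dd (v k) (fun y => al i y 0 j) y = (k == i)%:R * be i y 0 j.
  have := congr1 (fun M : 'rV[R]_N => M 0 j) (vd_frame1 k i y); rewrite !mxE => ->.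
  by case: eqVneq => [->|]; rewrite ?mul0r.
have db k y : dd (v k) (fun y => be i y 0 j) y = - ((k == i)%:R * al i y 0 j).
  have := congr1 (fun M : 'rV[R]_N => M 0 j) (vd_frame2 k i y); rewrite !mxE mulNr => ->.
  by case: eqVneq => [->|]; rewrite ?mul0r.
have e1 y : be i y 0 j * cos (dotp (z i) y) + al i y 0 j * sin (dotp (z i) y) = be i 0 0 j.
  rewrite (@dd_frame_cst (fun y => be i y 0 j * cos (dotp (z i) y) + al i y 0 j * sin (dotp (z i) y))).
  - by rewrite dotp0r cos0 sin0 mulr1 mulr0 addr0.
  - by apply: smoothD; exact: smoothM.
  move=> k w; rewrite ddD; try exact: smoothM.
  rewrite !ddM// dd_cos dd_sin dual_frame eq_sym da db.
  by move: (be i w 0 j) (al i w 0 j) (cos _) (sin _) => a b p q; ring.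
have e2 y : al i y 0 j * cos (dotp (z i) y) - be i y 0 j * sin (dotp (z i) y) = al i 0 0 j.
  rewrite (@dd_frame_cst (fun y => al i y 0 j * cos (dotp (z i) y) - be i y 0 j * sin (dotp (z i) y))).
  - by rewrite dotp0r cos0 sin0 mulr1 mulr0 subr0.
  - by apply: smoothB; exact: smoothM.
  move=> k w; rewrite ddB; try exact: smoothM.
  rewrite !ddM// dd_cos dd_sin dual_frame eq_sym da db.
  by move: (be i w 0 j) (al i w 0 j) (cos _) (sin _) => a b p q; ring.
rewrite [RHS]mxE [X in _ = X + _]mxE [X in _ = _ + X]mxE [X in _ = _ - X]mxE -(e1 x) -(e2 x).
have := cos2Dsin2 (dotp (z i) x).
move: (cos _) (sin _) (be i x 0 j) (al i x 0 j) => p q a b e.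
by rewrite -[LHS]mulr1 -e; ring.
Qed.

(** The first relation is flatness. Differentiating it along [v i] gives the second, and
    differentiating the second along [v k] gives the third. *)
Lemma frame_orthogonal i k x :
  [/\ dotp (al i x) (al k x) = (i == k)%:R * (4 * pi ^+ 2 * c)^-1,
      dotp (be i x) (al k x) = 0 &
      dotp (be i x) (be k x) = (i == k)%:R * (4 * pi ^+ 2 * c)^-1].
Proof.
have aa i' k' y : dotp (al i' y) (al k' y) = (i' == k')%:R * (4 * pi ^+ 2 * c)^-1.
  rewrite /al (flat_dotp sG flat) /v dotpZl dotpZr dotp_frame.
  have p0 : pi != 0 :> R by rewrite gt_eqF ?pi_gt0.
  have c1 : c != 0 by rewrite gt_eqF.
  by move: p0; move: pi => p p0; field; rewrite p0 c1.
have sa i' := vsp_smooth (sal i'); have sb i' := vsp_smooth (sbe i').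
have ba i' k' y : dotp (be i' y) (al k' y) = 0.
  have := dd_dotpf (v i') y (sa i') (sa k').
  have -> : (fun y => dotp (al i' y) (al k' y)) = (fun=> (i' == k')%:R * (4 * pi ^+ 2 * c)^-1).
    by apply/funext => y'; rewrite aa.
  rewrite dd_cst !vd_frame1 eqxx scale1r; case: eqVneq => [<-|_].
    by rewrite scale1r [dotp (al i' y) _]dotpC; move: (dotp _ _) => t h; lra.
  by rewrite scale0r dotp0r addr0.
split=> //; have := dd_dotpf (v k) x (sb i) (sa k).
have -> : (fun y => dotp (be i y) (al k y)) = (fun=> 0) by apply/funext => y; rewrite ba.
rewrite dd_cst vd_frame1 eqxx scale1r vd_frame2 dotpZl aa eqxx mul1r mulNr eq_sym.
by move: (dotp _ _) (_^-1) => s t h; lra.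
Qed.

Theorem extremal_embedding : exists (b : 'rV[R]_N) (r : R) (B : 'M[R]_(n * 2, N)),
  [/\ 0 < r, B *m B^T = 1%:M & forall x, G x = b + r *:
    (mxvec (\matrix_(i < n, k < 2) if k == 0 then cos (2 * pi * (x *m X^T) 0 i)
                                   else sin (2 * pi * (x *m X^T) 0 i)) *m B)].
Proof.
have q0 : 0 < 4 * pi ^+ 2 * c :> R by rewrite !mulr_gt0 ?exprn_gt0 ?pi_gt0.
pose r := Num.sqrt (4 * pi ^+ 2 * c)^-1.
have r0 : 0 < r by rewrite sqrtr_gt0 invr_gt0.
have rn0 : r != 0 by rewrite gt_eqF.
have r2 : (4 * pi ^+ 2 * c)^-1 = r * r by rewrite -expr2 sqr_sqrtr// invr_ge0 ltW.
(* The normalised amplitudes of cos and sin: [frame_solution] writes minus [be i] as cos times -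
   be_i(0) plus sin times al_i(0), and these vectors have length [r]. *)
pose E i (k : 'I_2) : 'rV[R]_N := r^-1 *: (if k == 0 then - be i 0 else al i 0).
have EE i k i' k' : dotp (E i k) (E i' k') = ((i == i') && (k == k'))%:R.
  have [aa ba bb] := frame_orthogonal i i' 0; have [_ ab _] := frame_orthogonal i' i 0.
  rewrite /E dotpZl dotpZr mulrA -mulnb natrM; case: (ord2 k) => ->; case: (ord2 k') => -> /=.
  - by rewrite dotpNl dotpNr opprK bb r2 mulr1; field.
  - by rewrite dotpNl ba oppr0 !mulr0.
  - by rewrite dotpNr dotpC ab oppr0 !mulr0.
  - by rewrite aa r2 mulr1; field.
pose B : 'M[R]_(n * 2, N) := \matrix_(p, j) mxvec (\matrix_(i < n, k < 2) E i k 0 j) 0 p.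
have rB i k : row (mxvec_index i k) B = E i k.
  by apply/rowP => j; rewrite [LHS]mxE [LHS]mxE mxvecE mxE.
exists (G 0 + \sum_i be i 0), r, B; split=> //.
  apply/matrixP => p q; case/mxvec_indexP: p => i k; case/mxvec_indexP: q => i' k'.
  have -> : (B *m B^T) (mxvec_index i k) (mxvec_index i' k') = dotp (E i k) (E i' k').
    by rewrite -!rB mxE dotp_sum; apply: eq_bigr => j _; rewrite !mxE.
  rewrite EE; have := congr1 (fun M : 'rV[R]_(n * 2) => M 0 (mxvec_index i k))
    (mxvec_delta R i' k').
  by rewrite mxvecE !mxE => ->.
(* G plus the sum of the [be i] is constant: its derivative along [v k] is al_k - al_k, by the cubic
   and mixed relations. *)
move=> x; have -> : G x = G 0 + \sum_i be i 0 - \sum_i be i x.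
  apply/rowP => j; apply/eqP; rewrite -subr_eq0; apply/eqP.
  pose psi y := G y 0 j + \sum_i be i y 0 j.
  have sbs i : smooth (fun y => be i y 0 j) := (sbe i j).1.
  have sS : smooth (fun y => \sum_i be i y 0 j) by exact: smooth_sum.
  have e : psi x = psi 0.
    apply: dd_frame_cst => [|k y]; first by apply: smoothD => //; exact: (sG j).1.
    rewrite ddD//; last exact: (sG j).1.
    rewrite dd_sum// (bigD1 k)//= big1 => [|i ik].
      by rewrite beE dd_frame_cubic addr0 subrr.
    have := congr1 (fun M : 'rV[R]_N => M 0 j) (vd_frame2 k i y).
    by rewrite eq_sym (negPf ik) oppr0 scale0r !mxE.
  move: e; rewrite /psi !mxE !summxE; move: (\sum_i _) (\sum_i _) (G x 0 j) (G 0 0 j).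
  by move=> s t a d e; lra.
congr (_ + _); rewrite mxvec_mulmx scaler_sumr -sumrN; apply: eq_bigr => i _.
rewrite big_ord_recl big_ord1 [lift _ _](_ : _ = 1); last exact/val_inj.
have th : 2 * pi * (x *m X^T) 0 i = dotp (z i) x.
  by rewrite /z dotpZl -dotp_row dotpC.
rewrite 2!mxE !rB /E eqxx /= th scalerDr !scalerA !(mulrAC r _ r^-1) mulfV// !mul1r.
by rewrite frame_solution opprB scalerN addrC.
Qed.

End ExtremalTorus.

(** * Completion of orthonormal frames *)

Section OrthonormalCompletion.
Variable R : realType.

Lemma orthonormal_complement m N (B : 'M[R]_(m, N)) d : (m + d <= N)%N ->
  exists C : 'M[R]_(d, N), C *m C^T = 1%:M /\ B *m C^T = 0.
Proof.
elim: d => [|d IH] le.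
  by exists 0; split; [apply/matrixP => -[]|rewrite trmx0 mulmx0].
have [|C [CC BC]] := IH; first by apply: leq_trans le; rewrite leq_add2l.
(* At most N - 1 rows are present, so some nonzero vector is orthogonal to all of them. *)
have : (0 < \rank (kermx (col_mx B C)^T))%N.
  rewrite mxrank_ker subn_gt0 (leq_ltn_trans (rank_leq_col _))//.
  by apply: leq_trans le; rewrite addnS.
rewrite lt0n mxrank_eq0 => /rowV0Pn[u /sub_kermxP uk u0].
have s0 : 0 < sqnorm u by rewrite sqnorm_gt0.
have [w wE] : {w | w = (Num.sqrt (sqnorm u))^-1 *: u} by eexists.
have ww : w *m w^T = 1%:M.
  rewrite [LHS]mx11_scalar; congr (_%:M).
  rewrite -[LHS]/(dotp w w) wE dotpZl dotpZr mulrA -invfM -expr2 sqr_sqrtr ?(ltW s0)//.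
  by rewrite -/(sqnorm u) mulVf// gt_eqF.
have wk : w *m (col_mx B C)^T = 0 by rewrite wE -scalemxAl uk scaler0.
move: wk; rewrite tr_col_mx mul_mx_row -row_mx0 => /eq_row_mx[wB wC].
have Bw : B *m w^T = 0 by rewrite -[B]trmxK -trmx_mul wB trmx0.
have Cw : C *m w^T = 0 by rewrite -[C]trmxK -trmx_mul wC trmx0.
have h1 : col_mx w C *m (col_mx w C)^T = 1%:M.
  by rewrite tr_col_mx mul_col_row ww wC Cw CC -scalar_mx_block.
have h2 : B *m (col_mx w C)^T = 0.
  by rewrite tr_col_mx mul_mx_row Bw BC row_mx0.
by exists (col_mx w C).
Qed.

(** Applied to the frame of an extremal torus, [A] carries the standard R^(2n) in R^N onto the span
    of that frame. *)
Lemma orthonormal_completion m N (B : 'M[R]_(m, N)) : B *m B^T = 1%:M ->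
  exists A : 'M[R]_N, A *m A^T = 1%:M /\ pid_mx m *m A = B.
Proof.
move=> BB; have le := mulmx1_min BB.
have [d e] : exists d, N = (m + d)%N by exists (N - m)%N; rewrite subnKC.
subst N; have [C [CC BC]] := orthonormal_complement B (leqnn (m + d)).
exists (col_mx B C); split.
  have CB : C *m B^T = 0 by rewrite -[C]trmxK -trmx_mul BC trmx0.
  by rewrite tr_col_mx mul_col_row BB BC CB CC -scalar_mx_block.
by rewrite pid_mx_row mul_row_col mul1mx mul0mx addr0.
Qed.

End OrthonormalCompletion.

(** * Linear maps between tori *)

Section LinearTorusMaps.
Variables (R : realType) (n : nat).

Definition torus_linear (V W M : 'M[R]_n) (t : torus V) : torus W :=
  torus_proj W ((repr (t : {quot (lattice V)}) : 'rV[R]_n) *m M).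

(** The hypothesis says that [M] maps the lattice of [V] into that of [W], with integer matrix [L],
    so the choice of representative does not matter. *)
Lemma torus_linear_proj (V W M : 'M[R]_n) (L : 'M[int]_n) x :
  V^T *m M = map_mx intr L *m W^T ->
  torus_linear W M (torus_proj V x) = torus_proj W (x *m M).
Proof.
move=> h; have [y yE] : {y : 'rV[R]_n | y = repr (torus_proj V x : {quot (lattice V)})} by eexists.
have : torus_proj V y = torus_proj V x by rewrite yE torus_proj_repr.
case/torus_projP => k yx; rewrite /torus_linear -yE; apply/torus_projP; exists (k *m L).
by rewrite yx mulmxDl -mulmxA h map_mxM mulmxA.
Qed.

Lemma torus_linear_smooth (V W M : 'M[R]_n) (L : 'M[int]_n) :
  V^T *m M = map_mx intr L *m W^T -> torus_smooth (@torus_linear V W M).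
Proof.
move=> h x; exists setT, (fun y => y *m M); split=> //.
- exact: openT.
- apply/smooth_onP; apply: vsmooth_mulmx => j; exact: smooth_coord.
by move=> y _; exact: (torus_linear_proj y h).
Qed.

Lemma torus_linearK (V W M M' : 'M[R]_n) (L L' : 'M[int]_n) :
  V^T *m M = map_mx intr L *m W^T -> W^T *m M' = map_mx intr L' *m V^T ->
  M *m M' = 1%:M -> cancel (@torus_linear V W M) (@torus_linear W V M').
Proof.
move=> h h' MM t; rewrite -(torus_proj_repr t).
by rewrite (torus_linear_proj _ h) (torus_linear_proj _ h') -mulmxA MM mulmx1.
Qed.

(** Since [L] is invertible over the integers, [X] maps V Z^n onto Z^n, and its inverse descends to
    the inverse map of tori. *)
Lemma torus_linear_diffeo (V : 'M[R]_n) (X : 'M[R]_n) (L : 'M[int]_n) : V \in unitmx ->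
  L \in unitmx -> X = map_mx intr L *m invmx V -> torus_diffeo (@torus_linear V 1%:M X^T).
Proof.
move=> hV hL XE.
have LL : map_mx intr L *m map_mx intr (invmx L) = 1%:M :> 'M[R]_n.
  by rewrite -map_mxM mulmxV// map_mx1.
have X'X : (V *m map_mx intr (invmx L)) *m X = 1%:M.
  by rewrite XE mulmxA -(mulmxA V) (mulmx1C LL) mulmx1 mulmxV.
have XX' := mulmx1C X'X.
have h : V^T *m X^T = map_mx intr L^T *m (1%:M : 'M[R]_n)^T.
  by rewrite -trmx_mul XE mulmxKV// trmx1 mulmx1 map_trmx.
have h' : (1%:M : 'M[R]_n)^T *m (V *m map_mx intr (invmx L))^T =
    map_mx intr (invmx L)^T *m V^T.
  by rewrite trmx1 mul1mx trmx_mul map_trmx.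
exists (@torus_linear 1%:M V (V *m map_mx intr (invmx L))^T); split.
- by apply: (torus_linearK h h'); rewrite -trmx_mul X'X trmx1.
- by apply: (torus_linearK h' h); rewrite -trmx_mul XX' trmx1.
- exact: torus_linear_smooth h.
- exact: torus_linear_smooth h'.
Qed.

Lemma clifford_proj (x : 'rV[R]_n) : clifford (torus_proj 1%:M x) =
  (Num.sqrt n%:R)^-1 *: mxvec (\matrix_(i < n, k < 2)
     if k == 0 then cos (2 * pi * x 0 i) else sin (2 * pi * x 0 i)).
Proof.
rewrite /clifford; congr (_ *: mxvec _).
have [y yE] : {y : 'rV[R]_n | y =
  repr (torus_proj 1%:M x : {quot (lattice (1%:M : 'M[R]_n))})} by eexists.
have : torus_proj 1%:M y = torus_proj 1%:M x by rewrite yE torus_proj_repr.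
case/torus_projP => k yx; apply/matrixP => i j; rewrite -yE !mxE yx trmx1 mulmx1 !mxE.
by rewrite mulrDr cosDint sinDint.
Qed.

End LinearTorusMaps.

(** * Congruence in the equality case, and conclusion *)

Section Equality.
Variables (R : realType) (n N : nat) (V : 'M[R]_n).
Hypothesis hn : (1 < n)%N.
Hypothesis hV : V \in unitmx.
Local Notation e_ i := (delta_mx 0 i : 'rV[R]_n).
Variables (f F : torus V -> 'rV[R]_N).
Hypothesis sF : vsp V (torus_lift F).
Hypothesis flat : forall x i k,
  dotp (vd (e_ i) (torus_lift F) x) (vd (e_ k) (torus_lift F) x) = (i == k)%:R.

(** Jensen with exponent n/2, which is at least 1 because n >= 2. *)
Lemma willmore_energy : conformal_rel F f ->
  `|\det V| * avg V (fun x => sqnorm (vlapl (torus_lift F) x)) `^ (n%:R / 2) <= willmore f.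
Proof.
move=> rel; rewrite (willmore_flat hn hV sF flat rel) avg.unlock /torus_integral.
apply: ler_wpM2l => //.
apply: (@cube_integral_jensen _ _ (fun u => sqnorm (vlapl (torus_lift F) (u *m V^T)))).
- by rewrite ler_pdivlMr// mul1r ler_nat.
- exact: (bl_pull (smooth_periodic_sqnorm_vlapl sF)).
- by move=> x; exact: sqnorm_ge0.
Qed.

Lemma equality_congruent phi : moebius phi -> moebius_image phi f F ->
  `|\det V| * avg V (fun x => sqnorm (vlapl (torus_lift F) x)) `^ (n%:R / 2) =
    (4 * n%:R * pi ^+ 2) `^ (n%:R / 2) ->
  moebius_congruent_clifford f.
Proof.
move=> mphi im /(energy_bound hn hV sF flat).2[c [L [c0 detL XX hcoef]]].
have [b [r [B [r0 BB GE]]]] := extremal_embedding hV sF flat c0 detL XX hcoef.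
have [X XE] : {X | X = map_mx intr L *m invmx V} by eexists.
rewrite -XE in GE.
split; first exact: mulmx1_min BB.
have [A [AA pA]] := orthonormal_completion BB.
have AtA : A^T *m A^T^T = 1%:M by rewrite trmxK; exact: mulmx1C.
have sn0 : 0 < Num.sqrt n%:R :> R by rewrite sqrtr_gt0 ltr0n ltnW.
(* The extremal torus has circles of radius [r], the Clifford torus of radius 1/sqrt n. *)
pose a := (r * Num.sqrt n%:R)^-1.
have a0 : 0 < a by rewrite invr_gt0 mulr_gt0.
exists (similarity a A^T (- (a *: (b *m A^T))) \o phi), (@torus_linear _ _ V 1%:M X^T); split.
- by apply: moebius_comp => //; exact: moebius_similarity.
- by apply: (torus_linear_diffeo hV _ XE); exact: unimodular_unit detL.
move=> t; rewrite /= im; congr Some.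
have [x xE] : {x : 'rV[R]_n | x = repr (t : {quot (lattice V)})} by eexists.
have -> : F t = torus_lift F x by rewrite /torus_lift /= xE torus_proj_repr.
have -> : torus_linear 1%:M X^T t = torus_proj 1%:M (x *m X^T) by rewrite /torus_linear -xE.
rewrite GE clifford_proj /std_incl mulmxDl scalerDr addrAC subrr add0r.
rewrite -scalemxAl scalerA -scalemxAl -mulmxA -pA -mulmxA AA mulmx1.
by congr (_ *: _); rewrite /a invfM mulrAC mulVf ?mul1r// gt_eqF.
Qed.

End Equality.

Theorem theorem3p1 (R : realType) (n N : nat) (hn : (2 <= n)%N)
    (V : 'M[R]_n) (hV : V \in unitmx)
    (f : torus V -> 'rV[R]_N) (hf : immersion f)
    (hconf : exists phi (F : torus V -> 'rV[R]_N),
       [/\ moebius phi, moebius_image phi f F &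
           forall x : 'rV[R]_n, induced_metric F x = flat_metric x]) :
  (4 * n%:R * pi ^+ 2) `^ (n%:R / 2) <= willmore f /\
  (willmore f = (4 * n%:R * pi ^+ 2) `^ (n%:R / 2) <->
   moebius_congruent_clifford f).
Proof.
case: hconf => phi [F [mphi im flatF]].
have rel := moebius_conformal_rel mphi im; have rel' := conformal_rel_sym rel.
have sf : vsmooth (torus_lift f) by apply/smooth_onP; exact: hf.1.
have sF' := conformal_rel_vsmooth sf (conformal_rel_lift rel).
have sF := torus_lift_vsp sF'.
have flat x i k : dotp (vd (delta_mx 0 i) (torus_lift F) x) (vd (delta_mx 0 k) (torus_lift F) x) =
    (i == k)%:R.
  by rewrite -(gram_jacobian _ _ _ sF') -/(induced_metric F x) flatF mxE.
have lower := (energy_bound hn hV sF flat).1.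
have energy := willmore_energy hn hV sF flat rel'.
split; first exact: le_trans energy.
(* Equality squeezes the energy between the bound and W, which is what [equality_congruent] asks
   for. In the other direction the upper bound meets the lower one. *)
split=> [e|congr_f].
  apply: (equality_congruent hn hV sF flat mphi im); apply/le_anti.
  by rewrite lower -e energy.
apply/le_anti; rewrite (willmore_clifford_congruent hn hV sF flat rel' congr_f) /=.
exact: le_trans energy.
Qed.
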